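(* ($\mathsf{ZF}$) If $\mathbb{P}$ is a proper notion of forcing and $\mathsf{DC}$ holds, then $1_{\mathbb{P}}\Vdash\mathsf{DC}$.
   Context: Base theory: $\mathsf{ZF}$ (no Axiom of Choice). $\mathsf{DC}$ (Dependent Choice) is the statement that every $\aleph_0$-closed tree without maximal elements has a chain of order type $\omega$. Here a tree is a well-founded partial order whose lower cones are chains, and a tree is $\kappa$-closed if for every $\alpha<\kappa$ every increasing sequence of nodes indexed by $\alpha$ has an upper bound. Equivalently, every (nonempty) partial order without maximal points has an infinite chain. A notion of forcing is a partially ordered set $\mathbb{P}$ with a maximum $1_{\mathbb{P}}$; $q\le p$ means $q$ is stronger. ''Countable'' means injectable into $\omega$. For sets $x,y$ write $|x|\le^*|y|$ if $x$ is empty or there is a surjection from $y$ onto $x$. For a well-ordered cardinal $\kappa$, $H(\kappa)=\{y : |\kappa|\not\le^*|\mathrm{tcl}(y)|\}$, where $\mathrm{tcl}$ is transitive closure. Given a countable $M\prec (H(\kappa),\in,\mathbb{P})$, a condition $q\in\mathbb{P}$ is $M$-generic if for every open dense $D\subseteq\mathbb{P}$ with $D\in M$, $D\cap M$ is predense below $q$. $\mathbb{P}$ is proper if for all sufficiently large cardinals $\kappa$ (i.e. for a tail of $\kappa$) and every countable elementary submodel $M\prec (H(\kappa),\in,\mathbb{P})$, every $p\in\mathbb{P}\cap M$ has an extension $q\le p$ which is $M$-generic. *)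

(* Defs.v *)
(* The theorem is a theorem of ZF; it is rendered as "the following sentence of
   the language of set theory holds in every model of first-order ZF".

   Rocq-level separation or replacement (over arbitrary predicates V -> Prop)
   is deliberately avoided: together with choice in the metatheory it would
   make every model satisfy AC, and both the hypothesis and the conclusion about
   Dependent Choice would be void. *)

Set Implicit Arguments.
Unset Strict Implicit.
Unset Printing Implicit Defensive.

(** * First-order formulas of the language {∈} *)

Definition var := nat.

Inductive form : Type :=
| FMem (x y : var)
| FEq (x y : var)
| FBot
| FImp (a b : form)
| FAnd (a b : form)
| FOr (a b : form)
| FAll (x : var) (a : form)
| FEx (x : var) (a : form).

Definition upd (X : Type) (e : var -> X) (x : var) (v : X) : var -> X :=
  fun y => if Nat.eqb y x then v else e y.

(* Tarski satisfaction in the structure (V, E); [E x y] reads "x ∈ y". *)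
Fixpoint sat (V : Type) (E : V -> V -> Prop) (e : var -> V) (a : form) : Prop :=
  match a with
  | FMem x y => E (e x) (e y)
  | FEq x y => e x = e y
  | FBot => False
  | FImp a b => sat E e a -> sat E e b
  | FAnd a b => sat E e a /\ sat E e b
  | FOr a b => sat E e a \/ sat E e b
  | FAll x a => forall v : V, sat E (upd e x v) a
  | FEx x a => exists v : V, sat E (upd e x v) a
  end.

(* The parameters of the two schemas are the values that [e] gives to the
   variables other than 0 (resp. 0 and 1). *)
Record ZF (V : Type) (E : V -> V -> Prop) : Prop := {
  zf_extensionality :
    forall x y, (forall z, E z x <-> E z y) -> x = y;
  zf_foundation :
    forall x, (exists y, E y x) -> exists y, E y x /\ forall z, E z y -> ~ E z x;
  zf_pairing :
    forall x y, exists z, forall w, E w z <-> w = x \/ w = y;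
  zf_union :
    forall x, exists u, forall w, E w u <-> exists y, E y x /\ E w y;
  zf_powerset :
    forall x, exists p, forall y, E y p <-> forall z, E z y -> E z x;
  zf_infinity :
    exists w, (exists z, E z w /\ forall u, ~ E u z) /\
      forall x, E x w -> exists y, E y w /\ forall u, E u y <-> E u x \/ u = x;
  zf_separation :
    forall (a : form) (e : var -> V) (x : V), exists y, forall z,
      E z y <-> E z x /\ sat E (upd e 0 z) a;
  zf_replacement :
    forall (a : form) (e : var -> V) (x : V),
      (forall z, E z x -> exists! u, sat E (upd (upd e 0 z) 1 u) a) ->
      exists y, forall u,
        E u y <-> exists z, E z x /\ sat E (upd (upd e 0 z) 1 u) a
}.

(** * Writing formulas

   An [fml] is a formula awaiting the least variable name that is still unused:
   a quantifier binds the variable named by its depth, so that in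
   [∀ x, F x] the Rocq variable [x] is a name distinct from all those in scope
   and capture cannot occur.  A closed [fml] [F] denotes the sentence [F 0]. *)

Definition fml := nat -> form.

Declare Scope fml_scope.
Delimit Scope fml_scope with fml.
Bind Scope fml_scope with fml.
Local Open Scope fml_scope.

Definition mem (x y : var) : fml := fun _ => FMem x y.
Definition eqv (x y : var) : fml := fun _ => FEq x y.
Definition bot : fml := fun _ => FBot.
Definition imp (a b : fml) : fml := fun n => FImp (a n) (b n).
Definition conj (a b : fml) : fml := fun n => FAnd (a n) (b n).
Definition disj (a b : fml) : fml := fun n => FOr (a n) (b n).
Definition all (F : var -> fml) : fml := fun n => FAll n (F n (S n)).
Definition ex (F : var -> fml) : fml := fun n => FEx n (F n (S n)).
Definition neg (a : fml) : fml := imp a bot.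
Definition equ (a b : fml) : fml := conj (imp a b) (imp b a).
Definition all_in (y : var) (F : var -> fml) : fml := all (fun x => imp (mem x y) (F x)).
Definition ex_in (y : var) (F : var -> fml) : fml := ex (fun x => conj (mem x y) (F x)).

Notation "x ∈ y" := (mem x y) (at level 70) : fml_scope.
Notation "x ≐ y" := (eqv x y) (at level 70) : fml_scope.
Notation "¬ a" := (neg a) (at level 75, right associativity) : fml_scope.
Notation "a ∧ b" := (conj a b) (at level 80, right associativity) : fml_scope.
Notation "a ∨ b" := (disj a b) (at level 85, right associativity) : fml_scope.
Notation "a ⇔ b" := (equ a b) (at level 95, no associativity) : fml_scope.
Notation "a ⇒ b" := (imp a b) (at level 99, b at level 200, right associativity) : fml_scope.
Notation "∀ x , F" := (all (fun x : var => F))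
  (at level 10, x name, F at level 200) : fml_scope.
Notation "∃ x , F" := (ex (fun x : var => F))
  (at level 10, x name, F at level 200) : fml_scope.
Notation "∀ x ∈ y , F" := (all_in y (fun x : var => F))
  (at level 10, x name, y at level 69, F at level 200) : fml_scope.
Notation "∃ x ∈ y , F" := (ex_in y (fun x : var => F))
  (at level 10, x name, y at level 69, F at level 200) : fml_scope.

Definition holds (V : Type) (E : V -> V -> Prop) (a : fml) : Prop :=
  forall e : var -> V, sat E e (a 0).

(** * Basic set theory *)

Definition is_empty (x : var) : fml := ∀ z, ¬ z ∈ x.
Definition sub (x y : var) : fml := ∀ z ∈ x, z ∈ y.
Definition is_upair (z x y : var) : fml := ∀ w, w ∈ z ⇔ w ≐ x ∨ w ≐ y.
Definition is_pair (z x y : var) : fml :=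
  ∃ a, ∃ b, is_upair a x x ∧ is_upair b x y ∧ is_upair z a b.
Definition is_triple (z x y w : var) : fml := ∃ u, is_pair u y w ∧ is_pair z x u.
Definition rel (R x y : var) : fml := ∃ z ∈ R, is_pair z x y.
Definition rel3 (R x y w : var) : fml := ∃ z ∈ R, is_triple z x y w.

Definition is_fun (f a b : var) : fml :=
  (∀ z ∈ f, ∃ x ∈ a, ∃ y ∈ b, is_pair z x y) ∧
  (∀ x ∈ a, ∃ y, rel f x y ∧ ∀ y', rel f x y' ⇒ y' ≐ y).
Definition injective (f : var) : fml :=
  ∀ x, ∀ x', ∀ y, rel f x y ⇒ rel f x' y ⇒ x ≐ x'.
Definition onto (f b : var) : fml := ∀ y ∈ b, ∃ x, rel f x y.

Definition is_succ (y x : var) : fml := ∀ w, w ∈ y ⇔ w ∈ x ∨ w ≐ x.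
Definition inductive (w : var) : fml :=
  (∀ z, is_empty z ⇒ z ∈ w) ∧ (∀ x ∈ w, ∀ y, is_succ y x ⇒ y ∈ w).
Definition is_omega (w : var) : fml := inductive w ∧ ∀ y, inductive y ⇒ sub w y.

Definition transitive (x : var) : fml := ∀ y ∈ x, sub y x.
Definition ordinal (x : var) : fml := transitive x ∧ ∀ y ∈ x, transitive y.
Definition cardinal (k : var) : fml :=
  ordinal k ∧ ¬ (∃ a ∈ k, ∃ f, is_fun f a k ∧ injective f ∧ onto f k).

Definition countable (x : var) : fml :=
  ∃ w, is_omega w ∧ ∃ f, is_fun f x w ∧ injective f.

(* |x| ≤* |y| *)
Definition le_star (x y : var) : fml :=
  is_empty x ∨ ∃ f, is_fun f y x ∧ onto f x.

Definition is_tcl (t y : var) : fml :=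
  sub y t ∧ transitive t ∧ ∀ s, sub y s ⇒ transitive s ⇒ sub t s.

(* h = H(k) *)
Definition is_H (h k : var) : fml :=
  ∀ y, y ∈ h ⇔ ∃ t, is_tcl t y ∧ ¬ le_star k t.

(* r is a reflexive partial order on c; [rel r x y] reads "x ≤ y". *)
Definition poset (c r : var) : fml :=
  (∀ z ∈ r, ∃ x ∈ c, ∃ y ∈ c, is_pair z x y) ∧
  (∀ x ∈ c, rel r x x) ∧
  (∀ x ∈ c, ∀ y ∈ c, rel r x y ⇒ rel r y x ⇒ x ≐ y) ∧
  (∀ x ∈ c, ∀ y ∈ c, ∀ z ∈ c, rel r x y ⇒ rel r y z ⇒ rel r x z).

Definition lt (r x y : var) : fml := rel r x y ∧ ¬ x ≐ y.

(** * Dependent Choice *)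

(* Well-foundedness is the existence of minimal elements, as usual without
   choice. *)
Definition tree (t r : var) : fml :=
  poset t r ∧
  (∀ x, sub x t ⇒ (∃ y, y ∈ x) ⇒ ∃ m ∈ x, ∀ y ∈ x, ¬ lt r y m) ∧
  (∀ z ∈ t, ∀ x ∈ t, ∀ y ∈ t,
     rel r x z ⇒ rel r y z ⇒ rel r x y ∨ rel r y x).

(* f is a strictly increasing sequence indexed by the ordinal a *)
Definition increasing (f a r : var) : fml :=
  ∀ i ∈ a, ∀ j ∈ a, i ∈ j ⇒ ∀ x, ∀ y, rel f i x ⇒ rel f j y ⇒ lt r x y.

(* The case a = 0 makes every k-closed tree (k > 0) nonempty. *)
Definition tree_closed (k t r : var) : fml :=
  ∀ a ∈ k, ∀ f, is_fun f a t ⇒ increasing f a r ⇒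
    ∃ u ∈ t, ∀ i ∈ a, ∀ x, rel f i x ⇒ rel r x u.

Definition no_maximal (t r : var) : fml := ∀ x ∈ t, ∃ y ∈ t, lt r x y.

Definition has_chain_of_type (a t r : var) : fml :=
  ∃ c, sub c t ∧ (∀ x ∈ c, ∀ y ∈ c, rel r x y ∨ rel r y x) ∧
    ∃ f, is_fun f a c ∧ onto f c ∧ increasing f a r.

Definition DC : fml :=
  ∀ w, is_omega w ⇒ ∀ t, ∀ r,
    tree t r ⇒ tree_closed w t r ⇒ no_maximal t r ⇒ has_chain_of_type w t r.

(** * Elementary submodels, inside the model

   Formulas are coded by sets; numerals below are tags:
   v_i ∈ v_j is ⟨0,i,j⟩, v_i = v_j is ⟨1,i,j⟩, ¬a is ⟨2,a⟩, a ∧ b is ⟨3,a,b⟩,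
   ∃ v_i a is ⟨4,i,a⟩, with i, j ∈ ω. *)

Fixpoint is_num (n : nat) (x : var) : fml :=
  match n with
  | O => is_empty x
  | S m => ∃ y, is_num m y ∧ is_succ x y
  end.

Definition code1 (n : nat) (z x : var) : fml := ∃ t, is_num n t ∧ is_pair z t x.
Definition code2 (n : nat) (z x y : var) : fml := ∃ t, is_num n t ∧ is_triple z t x y.

Definition code_closed (w x : var) : fml :=
  (∀ i ∈ w, ∀ j ∈ w, ∀ z, code2 0 z i j ⇒ z ∈ x) ∧
  (∀ i ∈ w, ∀ j ∈ w, ∀ z, code2 1 z i j ⇒ z ∈ x) ∧
  (∀ a ∈ x, ∀ z, code1 2 z a ⇒ z ∈ x) ∧
  (∀ a ∈ x, ∀ b ∈ x, ∀ z, code2 3 z a b ⇒ z ∈ x) ∧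
  (∀ i ∈ w, ∀ a ∈ x, ∀ z, code2 4 z i a ⇒ z ∈ x).

Definition is_formula (w a : var) : fml := ∀ x, code_closed w x ⇒ a ∈ x.

(* The assignment e' : ω -> m is e with the value at i replaced by u. *)
Definition is_upd (w m e' e i u : var) : fml :=
  is_fun e' w m ∧ rel e' i u ∧
  ∀ j ∈ w, ¬ j ≐ i ⇒ ∀ x, rel e' j x ⇔ rel e j x.

(* s is a satisfaction relation between coded formulas and assignments for the
   structure (m, ∈). *)
Definition tarski (w m s : var) : fml :=
  ∀ e, is_fun e w m ⇒
    (∀ i ∈ w, ∀ j ∈ w, ∀ z, code2 0 z i j ⇒
       (rel s z e ⇔ ∃ x, ∃ y, rel e i x ∧ rel e j y ∧ x ∈ y)) ∧
    (∀ i ∈ w, ∀ j ∈ w, ∀ z, code2 1 z i j ⇒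
       (rel s z e ⇔ ∃ x, ∃ y, rel e i x ∧ rel e j y ∧ x ≐ y)) ∧
    (∀ a, is_formula w a ⇒ ∀ z, code1 2 z a ⇒
       (rel s z e ⇔ ¬ rel s a e)) ∧
    (∀ a, is_formula w a ⇒ ∀ b, is_formula w b ⇒ ∀ z, code2 3 z a b ⇒
       (rel s z e ⇔ rel s a e ∧ rel s b e)) ∧
    (∀ i ∈ w, ∀ a, is_formula w a ⇒ ∀ z, code2 4 z i a ⇒
       (rel s z e ⇔ ∃ u ∈ m, ∃ e', is_upd w m e' e i u ∧ rel s a e')).

Definition satisfies (w m a e : var) : fml := ∃ s, tarski w m s ∧ rel s a e.

(* (m, ∈, p) ≺ (h, ∈, p), with p a constant of the structure: a substructure
   contains p, and as the parameters in the assignments range over m the formulas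
   mentioning the constant are covered. *)
Definition elementary (m h p : var) : fml :=
  sub m h ∧ p ∈ m ∧
  ∀ w, is_omega w ⇒ ∀ a, is_formula w a ⇒ ∀ e, is_fun e w m ⇒
    (satisfies w m a e ⇔ satisfies w h a e).

(** * Proper forcing *)

(* p = ⟨c, r, o⟩ where [rel r x y] reads "x is stronger than y". *)
Definition notion_of_forcing (p c r o : var) : fml :=
  is_triple p c r o ∧ poset c r ∧ o ∈ c ∧ ∀ x ∈ c, rel r x o.

Definition open_dense (c r d : var) : fml :=
  sub d c ∧
  (∀ x ∈ c, ∃ y ∈ d, rel r y x) ∧
  (∀ x ∈ d, ∀ y ∈ c, rel r y x ⇒ y ∈ d).

Definition predense_below (c r a q : var) : fml :=
  ∀ x ∈ c, rel r x q ⇒ ∃ y ∈ a, ∃ z ∈ c, rel r z x ∧ rel r z y.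

Definition is_inter (a x y : var) : fml := ∀ z, z ∈ a ⇔ z ∈ x ∧ z ∈ y.

Definition generic_for (c r m q : var) : fml :=
  ∀ d ∈ m, open_dense c r d ⇒ ∀ a, is_inter a d m ⇒ predense_below c r a q.

Definition proper (p c r : var) : fml :=
  ∃ k0, cardinal k0 ∧ ∀ k, cardinal k ⇒ sub k0 k ⇒
    ∀ h, is_H h k ⇒ ∀ m, countable m ⇒ elementary m h p ⇒
      ∀ x ∈ c, x ∈ m ⇒ ∃ q ∈ c, rel r q x ∧ generic_for c r m q.

(** * The forcing relation

   Names are sets of pairs ⟨name, condition⟩. The recursions defining names and
   the forcing of atomic formulas are expressed by sets closed under passing to
   the names occurring in a name. *)

Definition name_closed (c n : var) : fml :=
  ∀ x ∈ n, ∀ z ∈ x, ∃ y ∈ n, ∃ p ∈ c, is_pair z y p.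

Definition is_name (c x : var) : fml := ∃ n, x ∈ n ∧ name_closed c n.

Definition dense_below (c r p : var) (F : var -> fml) : fml :=
  ∀ q ∈ c, rel r q p ⇒ ∃ s ∈ c, rel r s q ∧ F s.

(* Given g = {⟨s, y, y'⟩ : s ⊩ y = y'}, the condition p forces x ⊆ x'. *)
Definition forces_sub (c r g p x x' : var) : fml :=
  ∀ y, ∀ u, rel x y u ⇒ ∀ q ∈ c, rel r q p ⇒ rel r q u ⇒
    dense_below c r q (fun s =>
      ∃ y', ∃ u', rel x' y' u' ∧ rel r s u' ∧ rel3 g s y y').

Definition forces_eq (c r p x x' : var) : fml :=
  ∃ n, ∃ g, name_closed c n ∧ x ∈ n ∧ x' ∈ n ∧
    (∀ q ∈ c, ∀ y ∈ n, ∀ y' ∈ n,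
       rel3 g q y y' ⇔ forces_sub c r g q y y' ∧ forces_sub c r g q y' y) ∧
    rel3 g p x x'.

Definition forces_mem (c r p x x' : var) : fml :=
  dense_below c r p (fun s =>
    ∃ y, ∃ u, rel x' y u ∧ rel r s u ∧ forces_eq c r s x y).

(* The formula "p ⊩ a", the free variables of a being interpreted by the names
   that rho assigns to them. *)
Fixpoint forces (c r : var) (p : var) (a : form) (rho : var -> var) : fml :=
  match a with
  | FMem x y => forces_mem c r p (rho x) (rho y)
  | FEq x y => forces_eq c r p (rho x) (rho y)
  | FBot => bot
  | FImp a b => ∀ q ∈ c, rel r q p ⇒ forces c r q a rho ⇒ forces c r q b rho
  | FAnd a b => forces c r p a rho ∧ forces c r p b rho
  | FOr a b => dense_below c r p (fun q => forces c r q a rho ∨ forces c r q b rho)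
  | FAll x a => ∀ v, is_name c v ⇒ forces c r p a (upd rho x v)
  | FEx x a => dense_below c r p (fun q =>
      ∃ v, is_name c v ∧ forces c r q a (upd rho x v))
  end.

(* For a sentence a the value of rho is irrelevant. *)
Definition forces_sentence (c r p : var) (a : fml) : fml :=
  forces c r p (a 0) (fun x => x).

(* Main.v *)
From Stdlib Require Import Classical ClassicalEpsilon FunctionalExtensionality PropExtensionality.
From Stdlib Require Import Arith Cantor Lia List.
Require Import Defs.

(* A failure of the theorem would persist in a countable elementary submodel V of
   the given model of ZF, and over a countable V every condition p lies in a
   generic filter; so p forces a sentence iff it holds in V[G] for all generic
   G containing p, and one can argue in V[G].

   Let tau name a nonempty tree without maximal nodes.  By DC in V there is a
   countable M ≺ H(k) which contains, for each of its elements x in dom(tau), the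
   dense set D_x of the conditions that force some y in dom(tau) above x or have no
   extension doing so, and which contains such a y for every condition in M that
   forces one; these two closure properties are built into the construction of M
   and not derived from elementarity.  If q in G is M-generic, then G meets
   D_x ∩ M for all these x, so the values of the names in M ∩ dom(tau) have no
   maximal node among them.  V[G] enumerates them in type ω, and stepping each time
   to the least index of a larger value yields the chain, without choice.

   The model V may be ill-founded or have nonstandard natural numbers:
   recursion, satisfaction and finiteness are those of the model. *)

(** * Definable classes *)

(** Two obstacles shape the proof. The metatheory has choice, so no set of the model may be formed
    from an arbitrary predicate: every class that enters separation, replacement or induction must
    come with a formula, and much of the bookkeeping serves this. Secondly, properness speaks of
    submodels of H(κ) in the sense of the model, so coded satisfaction, a Löwenheim-Skolem argument
    from DC alone, and the existence of H(κ) without choice have to be developed inside an arbitrary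
    model of ZF. The set D_x is a subset of the forcing and therefore an element of H(κ), but
    deriving D_x ∈ M from elementarity would require a definition of the forcing relation inside
    H(κ) and its absoluteness; this is why D_x is put into M by hand. In V[G] just the fragment of
    Zermelo set theory that carries the greedy chain is verified, and the set in which the graph of
    the chain lives receives an explicit name. *)

Class MemRel (V : Type) := memV : V -> V -> Prop.
Notation "x ∊ y" := (memV x y) (at level 70).

Section Definability.
Context {V : Type} {E : MemRel V}.

Lemma upd_eq (X : Type) (e : var -> X) x v : upd e x v x = v.
Proof. unfold upd. now rewrite Nat.eqb_refl. Qed.

Lemma upd_neq (X : Type) (e : var -> X) x y v : y <> x -> upd e x v y = e y.
Proof. intros H. unfold upd. apply Nat.eqb_neq in H. now rewrite H. Qed.

Lemma sat_ext (e e' : var -> V) a : (forall x, e x = e' x) -> sat memV e a <-> sat memV e' a.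
Proof. intros H. replace e' with e; [tauto|]. now apply functional_extensionality. Qed.

Fixpoint rename (f : nat -> nat) (a : form) : form :=
  match a with
  | FMem x y => FMem (f x) (f y)
  | FEq x y => FEq (f x) (f y)
  | FBot => FBot
  | FImp a b => FImp (rename f a) (rename f b)
  | FAnd a b => FAnd (rename f a) (rename f b)
  | FOr a b => FOr (rename f a) (rename f b)
  | FAll x a => FAll (f x) (rename f a)
  | FEx x a => FEx (f x) (rename f a)
  end.

Lemma sat_rename (f : nat -> nat) (hf : forall i j, f i = f j -> i = j) a :
  forall e : var -> V, sat memV e (rename f a) <-> sat memV (fun i => e (f i)) a.
Proof.
  assert (U : forall (e : var -> V) x v, (fun i => upd e (f x) v (f i)) = upd (fun i => e (f i)) x v).
  { intros e x v. apply functional_extensionality. intros i. unfold upd.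
    destruct (Nat.eqb_spec (f i) (f x)) as [h|h], (Nat.eqb_spec i x) as [h'|h']; auto.
    - now apply hf in h.
    - now subst. }
  induction a; intros e; simpl; try tauto; try (rewrite IHa1, IHa2; tauto).
  - split; intros H v; specialize (H v); rewrite IHa, U in *; auto.
  - split; intros [v H]; exists v; rewrite IHa, U in *; auto.
Qed.

Fixpoint ctx (n : nat) : Type := match n with 0 => unit | S m => (ctx m * V)%type end.
Definition hd {n} (g : ctx (S n)) : V := snd g.
Definition tl {n} (g : ctx (S n)) : ctx n := fst g.
Definition cs {n} (g : ctx n) (v : V) : ctx (S n) := (g, v).

(** Contexts act as de Bruijn levels: the oldest entry is the value of variable 0 and the head of a
    context of length m+1 is that of variable m, so a new binder leaves the older variables in
    place. *)
Fixpoint envc (n : nat) : ctx n -> (nat -> V) -> nat -> V :=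
  match n with
  | 0 => fun _ r => r
  | S m => fun g r => upd (envc m (tl g) r) m (hd g)
  end.

(* Separation and replacement apply only to classes given by formulas.  A
   definable class is presented as a predicate on contexts; [dterm] does the same
   for class functions.  The variables from [n] on carry parameters, and the
   premise [V] spares us an inhabitation hypothesis. *)
Definition defn n (P : ctx n -> Prop) : Prop :=
  V -> exists a r, forall g, P g <-> sat memV (envc n g r) a.
Definition dterm n (t : ctx n -> V) : Prop := defn (S n) (fun g => hd g = t (tl g)).

Lemma envc_lt n : forall (g : ctx n) r r' i, i < n -> envc n g r i = envc n g r' i.
Proof.
  induction n; intros g r r' i h; [lia|]. simpl. unfold upd.
  destruct (Nat.eqb_spec i n); auto. apply IHn. lia.
Qed.

Lemma envc_ge n : forall (g : ctx n) r i, n <= i -> envc n g r i = r i.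
Proof.
  induction n; intros g r i h; [reflexivity|]. simpl. rewrite upd_neq by lia. apply IHn. lia.
Qed.

Lemma defn_reparam n (P : ctx n -> Prop) f (hf : forall i j, f i = f j -> i = j)
  (hlt : forall i, i < n -> f i = i) (hge : forall i, n <= i -> n <= f i) a r r' :
  (forall g, P g <-> sat memV (envc n g r) a) -> (forall i, n <= i -> r' (f i) = r i) ->
  forall g, P g <-> sat memV (envc n g r') (rename f a).
Proof.
  intros H Hr g. rewrite H, sat_rename by auto. apply sat_ext. intros i.
  destruct (le_lt_dec n i) as [h|h].
  - rewrite !envc_ge by auto. now rewrite Hr.
  - rewrite hlt by auto. now apply envc_lt.
Qed.

(** A connective needs one parameter list for both of its formulas. The parameters of the first move
    to even offsets from [n], those of the second to odd ones, and [q] interleaves the two lists. *)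
Lemma defn_params n (P Q : ctx n -> Prop) : V -> defn n P -> defn n Q ->
  exists r a b, (forall g, P g <-> sat memV (envc n g r) a) /\
                (forall g, Q g <-> sat memV (envc n g r) b).
Proof.
  intros v0 HP HQ. destruct (HP v0) as (a & r & Ha), (HQ v0) as (b & s & Hb).
  pose (f := fun i => if i <? n then i else n + 2 * (i - n)).
  pose (f' := fun i => if i <? n then i else n + 2 * (i - n) + 1).
  pose (q := fun i => if Nat.even (i - n) then r (n + Nat.div2 (i - n)) else s (n + Nat.div2 (i - n))).
  exists q, (rename f a), (rename f' b). split.
  - apply defn_reparam with r; auto; unfold f.
    + intros i j. destruct (Nat.ltb_spec i n), (Nat.ltb_spec j n); lia.
    + intros i h. destruct (Nat.ltb_spec i n); lia.
    + intros i h. destruct (Nat.ltb_spec i n); lia.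
    + intros i h. destruct (Nat.ltb_spec i n); [lia|]. unfold q.
      replace (n + 2 * (i - n) - n) with (2 * (i - n)) by lia.
      rewrite Nat.even_even, Nat.div2_double. f_equal. lia.
  - apply defn_reparam with s; auto; unfold f'.
    + intros i j. destruct (Nat.ltb_spec i n), (Nat.ltb_spec j n); lia.
    + intros i h. destruct (Nat.ltb_spec i n); lia.
    + intros i h. destruct (Nat.ltb_spec i n); lia.
    + intros i h. destruct (Nat.ltb_spec i n); [lia|]. unfold q.
      replace (n + 2 * (i - n) + 1 - n) with (S (2 * (i - n))) by lia.
      rewrite Nat.even_succ, Nat.odd_even, Nat.div2_succ_double. f_equal. lia.
Qed.

Lemma defn_ext n (P Q : ctx n -> Prop) : (forall g, P g <-> Q g) -> defn n Q -> defn n P.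
Proof. intros H HQ v. destruct (HQ v) as (a & r & Ha). exists a, r. intros g. now rewrite H. Qed.

Lemma defn_and n (P Q : ctx n -> Prop) : defn n P -> defn n Q -> defn n (fun g => P g /\ Q g).
Proof.
  intros HP HQ v. destruct (defn_params n P Q v HP HQ) as (r & a & b & Ha & Hb).
  exists (FAnd a b), r. intros g. rewrite Ha, Hb. reflexivity.
Qed.

Lemma defn_or n (P Q : ctx n -> Prop) : defn n P -> defn n Q -> defn n (fun g => P g \/ Q g).
Proof.
  intros HP HQ v. destruct (defn_params n P Q v HP HQ) as (r & a & b & Ha & Hb).
  exists (FOr a b), r. intros g. rewrite Ha, Hb. reflexivity.
Qed.

Lemma defn_imp n (P Q : ctx n -> Prop) : defn n P -> defn n Q -> defn n (fun g => P g -> Q g).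
Proof.
  intros HP HQ v. destruct (defn_params n P Q v HP HQ) as (r & a & b & Ha & Hb).
  exists (FImp a b), r. intros g. rewrite Ha, Hb. reflexivity.
Qed.

Lemma defn_iff n (P Q : ctx n -> Prop) : defn n P -> defn n Q -> defn n (fun g => P g <-> Q g).
Proof. intros HP HQ. unfold iff. apply defn_and; apply defn_imp; auto. Qed.

Lemma defn_not n (P : ctx n -> Prop) : defn n P -> defn n (fun g => ~ P g).
Proof.
  intros HP v. destruct (HP v) as (a & r & Ha). exists (FImp a FBot), r. intros g.
  rewrite Ha. reflexivity.
Qed.

Lemma defn_False n : defn n (fun g => False).
Proof. intros v. exists FBot, (fun _ => v). intros g. reflexivity. Qed.

Lemma defn_ex n (P : ctx n -> V -> Prop) :
  defn (S n) (fun g => P (tl g) (hd g)) -> defn n (fun g => exists v, P g v).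
Proof.
  intros HP v0. destruct (HP v0) as (a & r & Ha). exists (FEx n a), r. intros g. simpl.
  split; intros [v H]; exists v.
  - apply (Ha (cs g v)) in H. exact H.
  - apply (Ha (cs g v)). exact H.
Qed.

Lemma defn_all n (P : ctx n -> V -> Prop) :
  defn (S n) (fun g => P (tl g) (hd g)) -> defn n (fun g => forall v, P g v).
Proof.
  intros HP v0. destruct (HP v0) as (a & r & Ha). exists (FAll n a), r. intros g. simpl.
  split; intros H v; specialize (H v).
  - apply (Ha (cs g v)) in H. exact H.
  - apply (Ha (cs g v)). exact H.
Qed.

(** P(t) is expressed by a quantifier over the value of [t], so that no substitution into formulas
    occurs. *)
Lemma defn_sub n (P : ctx n -> V -> Prop) t : dterm n t ->
  defn (S n) (fun g => P (tl g) (hd g)) -> defn n (fun g => P g (t g)).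
Proof.
  intros Ht HP. apply defn_ext with (fun g => exists v, v = t g /\ P g v).
  - intros g. split; [eauto|]. now intros (v & -> & H).
  - apply defn_ex. apply defn_and; auto.
Qed.

Lemma dterm_const n c : dterm n (fun _ => c).
Proof.
  intros v. exists (FEq n (S n)), (fun _ => c). intros g. simpl.
  rewrite upd_eq, upd_neq, envc_ge by lia. reflexivity.
Qed.

Lemma dterm_v0 n : dterm (S n) (fun g => hd g).
Proof.
  intros v. exists (FEq (S n) n), (fun _ => v). intros g. simpl.
  rewrite !upd_eq, upd_neq, upd_eq by lia. reflexivity.
Qed.

Lemma dterm_w n t : dterm n t -> dterm (S n) (fun g => t (tl g)).
Proof.
  intros Ht v. destruct (Ht v) as (a & r & Ha).
  pose (f := fun i => if i <? n then i else S i).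
  exists (rename f a), (fun i => r (pred i)). intros g.
  rewrite (Ha (cs (tl (tl g)) (hd g))), sat_rename.
  - apply sat_ext. intros i. unfold f. simpl. unfold tl at 2, hd at 1. simpl.
    destruct (Nat.ltb_spec i n).
    + rewrite !upd_neq by lia. now apply envc_lt.
    + destruct (Nat.eq_dec i n) as [->|h]; [now rewrite !upd_eq|].
      rewrite !upd_neq, !envc_ge by lia. reflexivity.
  - intros i j. unfold f. destruct (Nat.ltb_spec i n), (Nat.ltb_spec j n); lia.
Qed.

Lemma dterm_v1 n : dterm (S (S n)) (fun g => hd (tl g)).
Proof. exact (dterm_w _ _ (dterm_v0 _)). Qed.
Lemma dterm_v2 n : dterm (S (S (S n))) (fun g => hd (tl (tl g))).
Proof. exact (dterm_w _ _ (dterm_v1 _)). Qed.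
Lemma dterm_v3 n : dterm (S (S (S (S n)))) (fun g => hd (tl (tl (tl g)))).
Proof. exact (dterm_w _ _ (dterm_v2 _)). Qed.
Lemma dterm_v4 n : dterm (S (S (S (S (S n))))) (fun g => hd (tl (tl (tl (tl g))))).
Proof. exact (dterm_w _ _ (dterm_v3 _)). Qed.
Lemma dterm_v5 n : dterm (S (S (S (S (S (S n)))))) (fun g => hd (tl (tl (tl (tl (tl g)))))).
Proof. exact (dterm_w _ _ (dterm_v4 _)). Qed.

Lemma defn_mem n (a b : ctx n -> V) : dterm n a -> dterm n b -> defn n (fun g => a g ∊ b g).
Proof.
  intros Ha Hb. apply (defn_sub n (fun g v => v ∊ b g) a Ha).
  apply (defn_sub (S n) (fun g w => hd g ∊ w) (fun g => b (tl g)) (dterm_w _ _ Hb)).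
  intros v. exists (FMem n (S n)), (fun _ => v). intros g. simpl.
  rewrite upd_eq, upd_neq, upd_eq by lia. reflexivity.
Qed.

Lemma defn_eq n (a b : ctx n -> V) : dterm n a -> dterm n b -> defn n (fun g => a g = b g).
Proof.
  intros Ha Hb. apply (defn_sub n (fun g v => v = b g) a Ha). exact Hb.
Qed.

(** Separation handles predicates of one variable: the context is frozen, its entries become
    parameters, and the head variable [n] is renamed to 0. *)
Lemma defn_at n (P : ctx n -> V -> Prop) (g : ctx n) :
  defn (S n) (fun g => P (tl g) (hd g)) -> defn 1 (fun h => P g (hd h)).
Proof.
  intros HP v0. destruct (HP v0) as (a & r & Ha).
  pose (f := fun i => if i =? n then 0 else S i).
  exists (rename f a), (fun i => envc n g r (pred i)). intros h.
  rewrite (Ha (cs g (hd h))), sat_rename.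
  - apply sat_ext. intros i. unfold f. simpl. unfold tl, hd. simpl.
    destruct (Nat.eqb_spec i n) as [->|k]; [now rewrite !upd_eq|].
    now rewrite !upd_neq by lia.
  - intros i j. unfold f. destruct (Nat.eqb_spec i n), (Nat.eqb_spec j n); lia.
Qed.

Lemma defn_mid n (P : ctx n -> V -> Prop) :
  defn (S n) (fun g => P (tl g) (hd g)) -> defn (S (S n)) (fun g => P (tl (tl g)) (hd g)).
Proof.
  intros HP v. destruct (HP v) as (a & r & Ha).
  pose (f := fun i => if i <? n then i else S i).
  exists (rename f a), (fun i => r (pred i)).
  intros g. rewrite (Ha (cs (tl (tl g)) (hd g))), sat_rename.
  - apply sat_ext. intros i. unfold f. simpl. unfold tl, hd. simpl.
    destruct (Nat.ltb_spec i n).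
    + rewrite !upd_neq by lia. now apply envc_lt.
    + destruct (Nat.eq_dec i n) as [->|k]; [now rewrite !upd_eq|].
      rewrite !upd_neq, !envc_ge by lia. reflexivity.
  - intros i j. unfold f. destruct (Nat.ltb_spec i n), (Nat.ltb_spec j n); lia.
Qed.

(** The [inst] lemmas are for predicates known only through a hypothesis of definability and applied
    to a term below up to three further binders. *)
Lemma defn_inst n (P : ctx n -> V -> Prop) t : defn (S n) (fun g => P (tl g) (hd g)) ->
  dterm n t -> defn n (fun g => P g (t g)).
Proof. intros. now apply defn_sub. Qed.
Lemma defn_inst1 n (P : ctx n -> V -> Prop) t : defn (S n) (fun g => P (tl g) (hd g)) ->
  dterm (S n) t -> defn (S n) (fun g => P (tl g) (t g)).
Proof. intros. apply (defn_inst (S n) (fun g => P (tl g))); auto. now apply defn_mid. Qed.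
Lemma defn_inst2 n (P : ctx n -> V -> Prop) t : defn (S n) (fun g => P (tl g) (hd g)) ->
  dterm (S (S n)) t -> defn (S (S n)) (fun g => P (tl (tl g)) (t g)).
Proof.
  intros. apply (defn_inst1 (S n) (fun g => P (tl g))); auto. now apply defn_mid.
Qed.
Lemma defn_inst3 n (P : ctx n -> V -> Prop) t : defn (S n) (fun g => P (tl g) (hd g)) ->
  dterm (S (S (S n))) t -> defn (S (S (S n))) (fun g => P (tl (tl (tl g))) (t g)).
Proof.
  intros. apply (defn_inst2 (S n) (fun g => P (tl g))); auto. now apply defn_mid.
Qed.

Lemma defn_closed (P : V -> Prop) : defn 1 (fun g => P (hd g)) ->
  forall n a, dterm n a -> defn n (fun g => P (a g)).
Proof.
  intros HP n a Ha. apply (defn_sub n (fun _ v => P v) a Ha).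
  intros v. destruct (HP v) as (f & r & Hf).
  exists (rename (fun i => n + i) f), (fun i => r (i - n)). intros g.
  rewrite (Hf (cs (n := 0) tt (hd g))), sat_rename by (intros; lia).
  apply sat_ext. intros i. simpl. unfold hd. simpl. destruct i.
  - now rewrite Nat.add_0_r, !upd_eq.
  - rewrite !upd_neq, envc_ge by lia. f_equal. lia.
Qed.

Lemma dterm_at n (F : ctx n -> V -> V) (g : ctx n) :
  dterm (S n) (fun g => F (tl g) (hd g)) -> dterm 1 (fun h => F g (hd h)).
Proof.
  intros HF v0. destruct (HF v0) as (a & r & Ha).
  pose (f := fun i => if i <? n then S (S i) else if i =? n then 0 else
    if i =? S n then 1 else S i).
  exists (rename f a), (fun i => if i <? S (S n) then envc n g r (i - 2) else r (pred i)). intros h.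
  rewrite (Ha (cs (cs g (hd (tl h))) (hd h))), sat_rename.
  - apply sat_ext. intros i. unfold f. simpl. unfold tl, hd. simpl.
    destruct (Nat.ltb_spec i n) as [l|l].
    + rewrite !upd_neq by lia. destruct (Nat.ltb_spec (S (S i)) (S (S n))); [|lia].
      now replace (S (S i) - 2) with i by lia.
    + destruct (Nat.eqb_spec i n) as [->|k].
      { now rewrite !upd_neq, !upd_eq, upd_neq, upd_eq by lia. }
      destruct (Nat.eqb_spec i (S n)) as [->|k']; [now rewrite !upd_eq|].
      rewrite !upd_neq, envc_ge by lia.
      destruct (Nat.ltb_spec (S i) (S (S n))); [lia|]. reflexivity.
  - intros i j. unfold f.
    destruct (Nat.ltb_spec i n), (Nat.ltb_spec j n), (Nat.eqb_spec i n), (Nat.eqb_spec j n),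
      (Nat.eqb_spec i (S n)), (Nat.eqb_spec j (S n)); lia.
Qed.

Lemma dterm_sub n (F : ctx n -> V -> V) t : dterm (S n) (fun g => F (tl g) (hd g)) ->
  dterm n t -> dterm n (fun g => F g (t g)).
Proof.
  intros HF Ht. unfold dterm.
  apply defn_ext with (fun g => exists v, v = t (tl g) /\ hd g = F (tl g) v).
  - intros g. split; [eauto|]. now intros (v & -> & H).
  - apply defn_ex, defn_and.
    + exact (dterm_w _ _ Ht).
    + intros v. destruct (HF v) as (a & r & Ha).
      (* The value of [F] and its argument [v] are bound here in the opposite order, so [n] and
         [S n] are exchanged. *)
      pose (f := fun i => if i =? n then S n else if i =? S n then n else i).
      exists (rename f a), r. intros g.
      rewrite (Ha (cs (cs (tl (tl g)) (hd g)) (hd (tl g)))), sat_rename.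
      * apply sat_ext. intros i. unfold f. simpl. unfold tl, hd. simpl.
        destruct (Nat.eqb_spec i n) as [->|k].
        { now rewrite (upd_neq _ _ (S n)), !upd_eq by lia. }
        destruct (Nat.eqb_spec i (S n)) as [->|k']; [|now rewrite !upd_neq by lia].
        now rewrite (upd_neq _ _ _ n), !upd_eq by lia.
      * intros i j. unfold f. destruct (Nat.eqb_spec i n), (Nat.eqb_spec j n),
          (Nat.eqb_spec i (S n)), (Nat.eqb_spec j (S n)); lia.
Qed.

Lemma dterm_mid n (F : ctx n -> V -> V) :
  dterm (S n) (fun g => F (tl g) (hd g)) -> dterm (S (S n)) (fun g => F (tl (tl g)) (hd g)).
Proof.
  intros HF v. destruct (HF v) as (a & r & Ha).
  pose (f := fun i => if i <? n then i else S i).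
  exists (rename f a), (fun i => r (pred i)).
  intros g. rewrite (Ha (cs (cs (tl (tl (tl g))) (hd (tl g))) (hd g))), sat_rename.
  - apply sat_ext. intros i. unfold f. simpl. unfold tl, hd. simpl.
    destruct (Nat.ltb_spec i n).
    + rewrite !upd_neq by lia. now apply envc_lt.
    + destruct (Nat.eq_dec i n) as [->|k].
      { now rewrite (upd_neq _ _ (S (S n))), (upd_neq _ _ (S n) n), !upd_eq by lia. }
      destruct (Nat.eq_dec i (S n)) as [->|k']; [now rewrite !upd_eq|].
      rewrite !upd_neq, !envc_ge by lia. reflexivity.
  - intros i j. unfold f. destruct (Nat.ltb_spec i n), (Nat.ltb_spec j n); lia.
Qed.
Lemma dterm_inst1 n (F : ctx n -> V -> V) t : dterm (S n) (fun g => F (tl g) (hd g)) ->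
  dterm (S n) t -> dterm (S n) (fun g => F (tl g) (t g)).
Proof. intros. apply (dterm_sub (S n) (fun g => F (tl g))); auto. now apply dterm_mid. Qed.
Lemma dterm_inst2 n (F : ctx n -> V -> V) t : dterm (S n) (fun g => F (tl g) (hd g)) ->
  dterm (S (S n)) t -> dterm (S (S n)) (fun g => F (tl (tl g)) (t g)).
Proof. intros. apply (dterm_inst1 (S n) (fun g => F (tl g))); auto. now apply dterm_mid. Qed.
Lemma dterm_inst3 n (F : ctx n -> V -> V) t : dterm (S n) (fun g => F (tl g) (hd g)) ->
  dterm (S (S (S n))) t -> dterm (S (S (S n))) (fun g => F (tl (tl (tl g))) (t g)).
Proof. intros. apply (dterm_inst2 (S n) (fun g => F (tl g))); auto. now apply dterm_mid. Qed.

Lemma dterm_closed (F : V -> V) : dterm 1 (fun g => F (hd g)) ->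
  forall n a, dterm n a -> dterm n (fun g => F (a g)).
Proof.
  intros HF n a Ha. apply (dterm_sub n (fun _ v => F v) a); auto. clear a Ha.
  induction n as [|n IH]; [exact HF|]. exact (dterm_mid n (fun _ => F) IH).
Qed.

End Definability.

(* Definability by proof search along the syntax of a predicate *)
Existing Class defn.
Existing Class dterm.
Create HintDb dfn discriminated.
#[global] Hint Constants Opaque : dfn.
#[global] Hint Variables Opaque : dfn.
#[global] Hint Resolve dterm_const | 0 : dfn.
#[global] Hint Resolve dterm_v0 dterm_v1 dterm_v2 dterm_v3 dterm_v4 dterm_v5 | 0 : dfn.
#[global] Hint Resolve defn_iff defn_and defn_or defn_imp defn_not defn_False defn_ex defn_all defn_mem defn_eq | 1 : dfn.
#[global] Hint Extern 3 (defn _ _) =>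
  match goal with H : defn _ _ |- _ =>
    first [exact H | simple apply (defn_closed _ H) | simple apply (defn_inst _ _ _ H) | simple apply (defn_inst1 _ _ _ H)
      | simple apply (defn_inst2 _ _ _ H) | simple apply (defn_inst3 _ _ _ H)] end : dfn.
Ltac weakened H :=
  first [exact H | exact (dterm_w _ _ H) | exact (dterm_w _ _ (dterm_w _ _ H))
  | exact (dterm_w _ _ (dterm_w _ _ (dterm_w _ _ H)))
  | exact (dterm_w _ _ (dterm_w _ _ (dterm_w _ _ (dterm_w _ _ H))))
  | exact (dterm_w _ _ (dterm_w _ _ (dterm_w _ _ (dterm_w _ _ (dterm_w _ _ H)))))
  | exact (dterm_w _ _ (dterm_w _ _ (dterm_w _ _ (dterm_w _ _ (dterm_w _ _ (dterm_w _ _ H))))))].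
#[global] Hint Extern 2 (dterm _ _) =>
  match goal with H : dterm _ _ |- _ => weakened H end : dfn.
#[global] Hint Extern 3 (dterm _ _) =>
  match goal with H : dterm _ _ |- _ =>
    first [simple apply (dterm_closed _ H) | simple apply (dterm_sub _ _ _ H) | simple apply (dterm_inst1 _ _ _ H)
      | simple apply (dterm_inst2 _ _ _ H) | simple apply (dterm_inst3 _ _ _ H)] end : dfn.

Ltac dfn := typeclasses eauto with dfn nocore.

Notation Def1 P := (forall n a, dterm n a -> defn n (fun g => P (a g))) (only parsing).
Notation Def2 P := (forall n a b, dterm n a -> dterm n b -> defn n (fun g => P (a g) (b g))) (only parsing).
Notation Def3 P := (forall n a b c, dterm n a -> dterm n b -> dterm n c ->
  defn n (fun g => P (a g) (b g) (c g))) (only parsing).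
Notation Def4 P := (forall n a b c d, dterm n a -> dterm n b -> dterm n c -> dterm n d ->
  defn n (fun g => P (a g) (b g) (c g) (d g))) (only parsing).
Notation DefF1 F := (forall n a, dterm n a -> dterm n (fun g => F (a g))) (only parsing).
Notation DefF2 F := (forall n a b, dterm n a -> dterm n b -> dterm n (fun g => F (a g) (b g))) (only parsing).

(** * The notions of the statement, as predicates on a structure *)

Section Shallow.
Context {V : Type} {E : MemRel V}.

Definition IsEmpty (x : V) := forall z, ~ z ∊ x.
Definition Sub (x y : V) := forall z, z ∊ x -> z ∊ y.
Definition IsUpair (z x y : V) := forall w, w ∊ z <-> w = x \/ w = y.
Definition IsPair (z x y : V) := exists a, exists b, IsUpair a x x /\ IsUpair b x y /\ IsUpair z a b.
Definition IsTriple (z x y w : V) := exists u, IsPair u y w /\ IsPair z x u.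
Definition Rel (R x y : V) := exists z, z ∊ R /\ IsPair z x y.
Definition Rel3 (R x y w : V) := exists z, z ∊ R /\ IsTriple z x y w.
Definition IsFun (f a b : V) :=
  (forall z, z ∊ f -> exists x, x ∊ a /\ exists y, y ∊ b /\ IsPair z x y) /\
  (forall x, x ∊ a -> exists y, Rel f x y /\ forall y', Rel f x y' -> y' = y).
Definition Injective (f : V) := forall x x' y, Rel f x y -> Rel f x' y -> x = x'.
Definition Onto (f b : V) := forall y, y ∊ b -> exists x, Rel f x y.
Definition IsSucc (y x : V) := forall w, w ∊ y <-> w ∊ x \/ w = x.
Definition Inductive_ (w : V) :=
  (forall z, IsEmpty z -> z ∊ w) /\ (forall x, x ∊ w -> forall y, IsSucc y x -> y ∊ w).
Definition IsOmega (w : V) := Inductive_ w /\ forall y, Inductive_ y -> Sub w y.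
Definition Transitive (x : V) := forall y, y ∊ x -> Sub y x.
Definition Ordinal (x : V) := Transitive x /\ forall y, y ∊ x -> Transitive y.
Definition Cardinal (k : V) :=
  Ordinal k /\ ~ (exists a, a ∊ k /\ exists f, IsFun f a k /\ Injective f /\ Onto f k).
Definition Countable (x : V) := exists w, IsOmega w /\ exists f, IsFun f x w /\ Injective f.
Definition LeStar (x y : V) := IsEmpty x \/ exists f, IsFun f y x /\ Onto f x.
Definition IsTcl (t y : V) :=
  Sub y t /\ Transitive t /\ forall s, Sub y s -> Transitive s -> Sub t s.
Definition IsH (h k : V) := forall y, y ∊ h <-> exists t, IsTcl t y /\ ~ LeStar k t.
Definition Poset (c r : V) :=
  (forall z, z ∊ r -> exists x, x ∊ c /\ exists y, y ∊ c /\ IsPair z x y) /\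
  (forall x, x ∊ c -> Rel r x x) /\
  (forall x, x ∊ c -> forall y, y ∊ c -> Rel r x y -> Rel r y x -> x = y) /\
  (forall x, x ∊ c -> forall y, y ∊ c -> forall z, z ∊ c -> Rel r x y -> Rel r y z -> Rel r x z).
Definition Lt (r x y : V) := Rel r x y /\ ~ x = y.
Definition Tree (t r : V) :=
  Poset t r /\
  (forall x, Sub x t -> (exists y, y ∊ x) -> exists m, m ∊ x /\ forall y, y ∊ x -> ~ Lt r y m) /\
  (forall z, z ∊ t -> forall x, x ∊ t -> forall y, y ∊ t ->
     Rel r x z -> Rel r y z -> Rel r x y \/ Rel r y x).
Definition Increasing (f a r : V) :=
  forall i, i ∊ a -> forall j, j ∊ a -> i ∊ j -> forall x y, Rel f i x -> Rel f j y -> Lt r x y.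
Definition TreeClosed (k t r : V) :=
  forall a, a ∊ k -> forall f, IsFun f a t -> Increasing f a r ->
    exists u, u ∊ t /\ forall i, i ∊ a -> forall x, Rel f i x -> Rel r x u.
Definition NoMaximal (t r : V) := forall x, x ∊ t -> exists y, y ∊ t /\ Lt r x y.
Definition HasChainOfType (a t r : V) :=
  exists c, Sub c t /\ (forall x, x ∊ c -> forall y, y ∊ c -> Rel r x y \/ Rel r y x) /\
    exists f, IsFun f a c /\ Onto f c /\ Increasing f a r.
Definition DepChoice :=
  forall w, IsOmega w -> forall t r,
    Tree t r -> TreeClosed w t r -> NoMaximal t r -> HasChainOfType w t r.

Fixpoint IsNum (n : nat) (x : V) : Prop :=
  match n with
  | O => IsEmpty x
  | S m => exists y, IsNum m y /\ IsSucc x y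
  end.
Definition Code1 (n : nat) (z x : V) := exists t, IsNum n t /\ IsPair z t x.
Definition Code2 (n : nat) (z x y : V) := exists t, IsNum n t /\ IsTriple z t x y.
Definition CodeClosed (w x : V) :=
  (forall i, i ∊ w -> forall j, j ∊ w -> forall z, Code2 0 z i j -> z ∊ x) /\
  (forall i, i ∊ w -> forall j, j ∊ w -> forall z, Code2 1 z i j -> z ∊ x) /\
  (forall a, a ∊ x -> forall z, Code1 2 z a -> z ∊ x) /\
  (forall a, a ∊ x -> forall b, b ∊ x -> forall z, Code2 3 z a b -> z ∊ x) /\
  (forall i, i ∊ w -> forall a, a ∊ x -> forall z, Code2 4 z i a -> z ∊ x).
Definition IsFormula (w a : V) := forall x, CodeClosed w x -> a ∊ x.
Definition IsUpd (w m e' e i u : V) :=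
  IsFun e' w m /\ Rel e' i u /\
  forall j, j ∊ w -> ~ j = i -> forall x, Rel e' j x <-> Rel e j x.
Definition Tarski (w m s : V) :=
  forall e, IsFun e w m ->
    (forall i, i ∊ w -> forall j, j ∊ w -> forall z, Code2 0 z i j ->
       (Rel s z e <-> exists x y, Rel e i x /\ Rel e j y /\ x ∊ y)) /\
    (forall i, i ∊ w -> forall j, j ∊ w -> forall z, Code2 1 z i j ->
       (Rel s z e <-> exists x y, Rel e i x /\ Rel e j y /\ x = y)) /\
    (forall a, IsFormula w a -> forall z, Code1 2 z a ->
       (Rel s z e <-> ~ Rel s a e)) /\
    (forall a, IsFormula w a -> forall b, IsFormula w b -> forall z, Code2 3 z a b ->
       (Rel s z e <-> Rel s a e /\ Rel s b e)) /\
    (forall i, i ∊ w -> forall a, IsFormula w a -> forall z, Code2 4 z i a ->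
       (Rel s z e <-> exists u, u ∊ m /\ exists e', IsUpd w m e' e i u /\ Rel s a e')).
Definition Satisfies (w m a e : V) := exists s, Tarski w m s /\ Rel s a e.
Definition Elementary (m h p : V) :=
  Sub m h /\ p ∊ m /\
  forall w, IsOmega w -> forall a, IsFormula w a -> forall e, IsFun e w m ->
    (Satisfies w m a e <-> Satisfies w h a e).

Definition NotionOfForcing (p c r o : V) :=
  IsTriple p c r o /\ Poset c r /\ o ∊ c /\ forall x, x ∊ c -> Rel r x o.
Definition OpenDense (c r d : V) :=
  Sub d c /\
  (forall x, x ∊ c -> exists y, y ∊ d /\ Rel r y x) /\
  (forall x, x ∊ d -> forall y, y ∊ c -> Rel r y x -> y ∊ d).
Definition PredenseBelow (c r a q : V) :=
  forall x, x ∊ c -> Rel r x q ->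
    exists y, y ∊ a /\ exists z, z ∊ c /\ Rel r z x /\ Rel r z y.
Definition IsInter (a x y : V) := forall z, z ∊ a <-> z ∊ x /\ z ∊ y.
Definition GenericFor (c r m q : V) :=
  forall d, d ∊ m -> OpenDense c r d -> forall a, IsInter a d m -> PredenseBelow c r a q.
Definition Proper (p c r : V) :=
  exists k0, Cardinal k0 /\ forall k, Cardinal k -> Sub k0 k ->
    forall h, IsH h k -> forall m, Countable m -> Elementary m h p ->
      forall x, x ∊ c -> x ∊ m -> exists q, q ∊ c /\ Rel r q x /\ GenericFor c r m q.

Definition NameClosed (c n : V) :=
  forall x, x ∊ n -> forall z, z ∊ x -> exists y, y ∊ n /\ exists p, p ∊ c /\ IsPair z y p.
Definition IsName (c x : V) := exists n, x ∊ n /\ NameClosed c n.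
Definition DenseBelow (c r p : V) (F : V -> Prop) :=
  forall q, q ∊ c -> Rel r q p -> exists s, s ∊ c /\ Rel r s q /\ F s.
Definition ForcesSub (c r g p x x' : V) :=
  forall y u, Rel x y u -> forall q, q ∊ c -> Rel r q p -> Rel r q u ->
    DenseBelow c r q (fun s =>
      exists y' u', Rel x' y' u' /\ Rel r s u' /\ Rel3 g s y y').
Definition ForcesEq (c r p x x' : V) :=
  exists n g, NameClosed c n /\ x ∊ n /\ x' ∊ n /\
    (forall q, q ∊ c -> forall y, y ∊ n -> forall y', y' ∊ n ->
       (Rel3 g q y y' <-> ForcesSub c r g q y y' /\ ForcesSub c r g q y' y)) /\
    Rel3 g p x x'.
Definition ForcesMem (c r p x x' : V) :=
  DenseBelow c r p (fun s =>
    exists y u, Rel x' y u /\ Rel r s u /\ ForcesEq c r s x y).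
Fixpoint Forces (c r p : V) (a : form) (rho : var -> V) : Prop :=
  match a with
  | FMem x y => ForcesMem c r p (rho x) (rho y)
  | FEq x y => ForcesEq c r p (rho x) (rho y)
  | FBot => False
  | FImp a b => forall q, q ∊ c -> Rel r q p -> Forces c r q a rho -> Forces c r q b rho
  | FAnd a b => Forces c r p a rho /\ Forces c r p b rho
  | FOr a b => DenseBelow c r p (fun q => Forces c r q a rho \/ Forces c r q b rho)
  | FAll x a => forall v, IsName c v -> Forces c r p a (upd rho x v)
  | FEx x a => DenseBelow c r p (fun q =>
      exists v, IsName c v /\ Forces c r q a (upd rho x v))
  end.

End Shallow.

Lemma iff_and (A B C D : Prop) : (A <-> C) -> (B <-> D) -> (A /\ B <-> C /\ D).
Proof. tauto. Qed.
Lemma iff_or (A B C D : Prop) : (A <-> C) -> (B <-> D) -> (A \/ B <-> C \/ D).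
Proof. tauto. Qed.
Lemma iff_imp (A B C D : Prop) : (A <-> C) -> (B <-> D) -> ((A -> B) <-> (C -> D)).
Proof. tauto. Qed.
Lemma iff_all (T : Type) (P Q : T -> Prop) : (forall v, P v <-> Q v) -> (forall v, P v) <-> (forall v, Q v).
Proof. firstorder. Qed.
Lemma iff_ex (T : Type) (P Q : T -> Prop) : (forall v, P v <-> Q v) -> (exists v, P v) <-> (exists v, Q v).
Proof. firstorder. Qed.

Ltac updates := repeat first [rewrite upd_eq | rewrite upd_neq by lia].
Ltac structural := repeat match goal with
  | |- (exists _, _) <-> (exists _, _) => apply iff_ex; intro
  | |- (_ /\ _) <-> (_ /\ _) => apply iff_and
  | |- (_ \/ _) <-> (_ \/ _) => apply iff_or
  | |- (_ -> _) <-> (_ -> _) => apply iff_imp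
  | |- ((_ -> _) /\ (_ -> _)) <-> (_ <-> _) => apply iff_and
  | |- (forall _, _) <-> (forall _, _) => apply iff_all; intro
  end.

(** * Satisfaction of the forcing formulas, compared with the predicates on the structure *)

Section Bridge.
Context {V : Type} {E : MemRel V}.

Lemma sat_is_pair n (e : var -> V) z x y : z < n -> x < n -> y < n ->
  sat memV e (is_pair z x y n) <-> IsPair (e z) (e x) (e y).
Proof.
  intros. cbn. unfold IsPair, IsUpair.
  structural; updates; reflexivity.
Qed.

Lemma sat_rel n (e : var -> V) z x y : z < n -> x < n -> y < n ->
  sat memV e (rel z x y n) <-> Rel (e z) (e x) (e y).
Proof.
  intros. unfold Rel. cbn -[is_pair]. structural; [|rewrite sat_is_pair by lia]; updates; reflexivity.
Qed.
Lemma sat_is_triple n (e : var -> V) z x y w : z < n -> x < n -> y < n -> w < n ->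
  sat memV e (is_triple z x y w n) <-> IsTriple (e z) (e x) (e y) (e w).
Proof.
  intros. unfold IsTriple. cbn -[is_pair]. structural; rewrite sat_is_pair by lia; updates; reflexivity.
Qed.
Lemma sat_rel3 n (e : var -> V) z x y w : z < n -> x < n -> y < n -> w < n ->
  sat memV e (rel3 z x y w n) <-> Rel3 (e z) (e x) (e y) (e w).
Proof.
  intros. unfold Rel3. cbn -[is_triple]. structural; [|rewrite sat_is_triple by lia]; updates; reflexivity.
Qed.
Ltac atoms := first [rewrite sat_rel3 by lia | rewrite sat_rel by lia | rewrite sat_is_pair by lia | idtac]; updates; reflexivity.
Lemma sat_name_closed m (e : var -> V) c x : c < m -> x < m ->
  sat memV e (name_closed c x m) <-> NameClosed (e c) (e x).
Proof.
  intros. unfold NameClosed. cbn -[is_pair]. structural; atoms.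
Qed.
Lemma sat_is_name m (e : var -> V) c x : c < m -> x < m ->
  sat memV e (is_name c x m) <-> IsName (e c) (e x).
Proof.
  intros. unfold IsName. cbn -[name_closed]. structural; [|rewrite sat_name_closed by lia]; updates; reflexivity.
Qed.
Lemma sat_forces_sub m (e : var -> V) c r g p x y : c < m -> r < m -> g < m -> p < m -> x < m -> y < m ->
  sat memV e (forces_sub c r g p x y m) <-> ForcesSub (e c) (e r) (e g) (e p) (e x) (e y).
Proof.
  intros. unfold ForcesSub, DenseBelow. cbn -[rel rel3]. structural; atoms.
Qed.
Lemma sat_forces_eq m (e : var -> V) c r p x y : c < m -> r < m -> p < m -> x < m -> y < m ->
  sat memV e (forces_eq c r p x y m) <-> ForcesEq (e c) (e r) (e p) (e x) (e y).
Proof.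
  intros. unfold ForcesEq. cbn -[rel3 name_closed forces_sub].
  structural; first [rewrite sat_forces_sub by lia | rewrite sat_name_closed by lia | idtac]; atoms.
Qed.
Lemma sat_forces_mem m (e : var -> V) c r p x y : c < m -> r < m -> p < m -> x < m -> y < m ->
  sat memV e (forces_mem c r p x y m) <-> ForcesMem (e c) (e r) (e p) (e x) (e y).
Proof.
  intros. unfold ForcesMem, DenseBelow. cbn -[rel forces_eq].
  structural; first [rewrite sat_forces_eq by lia | idtac]; atoms.
Qed.

Fixpoint fvs (a : form) : list nat :=
  match a with
  | FMem x y | FEq x y => x :: y :: nil
  | FBot => nil
  | FImp a b | FAnd a b | FOr a b => fvs a ++ fvs b
  | FAll x a | FEx x a => List.filter (fun y => negb (Nat.eqb y x)) (fvs a)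
  end.

(** [rho] sends the variables of [a] to variables of the translated formula, and [ρ] to the values
    of these. Agreement is asked on free variables only: the identity renaming used for sentences
    cannot satisfy [rho x < n] for all [x], but a sentence has no free variables. *)
Lemma sat_forces a : forall n (e : var -> V) c r p rho ρ, c < n -> r < n -> p < n ->
  (forall x, In x (fvs a) -> rho x < n /\ e (rho x) = ρ x) ->
  sat memV e (forces c r p a rho n) <-> Forces (e c) (e r) (e p) a ρ.
Proof.
  (* The induction hypothesis as it is applied under further quantifiers: [e'] agrees with [e] below
     the old depth [m], and only the condition [p] may be one of the new variables. *)
  assert (lift : forall a m (e e' : var -> V) c r p rho ρ k,
    (forall n (e : var -> V) c r p rho ρ, c < n -> r < n -> p < n ->
      (forall x, In x (fvs a) -> rho x < n /\ e (rho x) = ρ x) ->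
      sat memV e (forces c r p a rho n) <-> Forces (e c) (e r) (e p) a ρ) ->
    m <= k -> (forall i, i < m -> e' i = e i) -> c < m -> r < m -> p < k ->
    (forall x, In x (fvs a) -> rho x < m /\ e (rho x) = ρ x) ->
    sat memV e' (forces c r p a rho k) <-> Forces (e c) (e r) (e' p) a ρ).
  { intros b m e e' c r p rho ρ k IH hk he hc hr hp H.
    rewrite <- (he c), <- (he r) by auto. apply IH; try lia. intros x h.
    destruct (H x h). rewrite he by auto. split; [lia|auto]. }
  induction a; intros m e c r p rho ρ hc hr hp H.
  1,2: cbn [Forces forces]; destruct (H x) as [h1 <-]; [simpl; auto|]; destruct (H y) as [h2 <-]; [simpl; auto|].
  - now apply sat_forces_mem.
  - now apply sat_forces_eq.
  - reflexivity.
  - cbn -[rel]. structural; try atoms.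
    all: rewrite lift with (m := m) (e := e) (ρ := ρ); auto; try lia.
    all: try (intros; updates; reflexivity); try (intros; apply H; apply in_app_iff; auto).
  - cbn -[rel]. structural; try atoms.
    all: rewrite lift with (m := m) (e := e) (ρ := ρ); auto; try lia; try reflexivity.
    all: try (intros; updates; reflexivity); try (intros; apply H; apply in_app_iff; auto).
  - cbn -[rel]. unfold DenseBelow. structural; try atoms.
    all: rewrite lift with (m := m) (e := e) (ρ := ρ); auto; try lia.
    all: try (intros; updates; reflexivity); try (intros; apply H; apply in_app_iff; auto).
  - cbn -[is_name]. structural.
    + rewrite sat_is_name by lia; updates; reflexivity.
    + rewrite IHa with (ρ := upd ρ x v); try lia.
      * updates; reflexivity.
      * intros y h. unfold upd at 1 3 4. destruct (Nat.eqb_spec y x).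
        -- updates. split; [lia|auto].
        -- destruct (H y). { apply List.filter_In. split; auto. now apply Bool.negb_true_iff, Nat.eqb_neq. }
           updates. split; [lia|auto].
  - cbn -[is_name rel]. unfold DenseBelow. structural; try atoms.
    + rewrite sat_is_name by lia; updates; reflexivity.
    + match goal with |- sat memV (upd ?e' _ ?v) _ <-> _ =>
        rewrite IHa with (ρ := upd ρ x v); try lia end.
      * updates; reflexivity.
      * intros y h. unfold upd at 1 5 6. destruct (Nat.eqb_spec y x).
        -- updates. split; [lia|auto].
        -- destruct (H y). { apply List.filter_In. split; auto. now apply Bool.negb_true_iff, Nat.eqb_neq. }
           updates. split; [lia|auto].
Qed.

Lemma sat_forces_DC (e : var -> V) P C R one r:
    sat memV (upd (upd (upd (upd e 0 P) 1 C) 2 R) 3 one) (forces_sentence 1 2 3 DC 4)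
  <-> Forces C R one (DC 0) r.
Proof.
  unfold forces_sentence. rewrite sat_forces with (ρ := r); try lia; [reflexivity|].
  intros x h. exfalso. revert h. replace (fvs (DC 0)) with (@nil nat) by reflexivity. auto.
Qed.

(** Both sides are convertible: the predicates copy the formulas clause by clause, and lookups in
    the environment compute on numerals. *)
Lemma sat_theorem (e : var -> V) :
  sat memV e ((∀ P, ∀ C, ∀ R, ∀ one,
       notion_of_forcing P C R one ⇒ proper P C R ⇒ DC ⇒
       forces_sentence C R one DC)%fml 0) =
  forall P C R one : V, NotionOfForcing P C R one -> Proper P C R -> DepChoice (V:=V) ->
    sat memV (upd (upd (upd (upd e 0 P) 1 C) 2 R) 3 one) (forces_sentence 1 2 3 DC 4).
Proof. reflexivity. Qed.

Lemma sat_DC (e : var -> V) : sat memV e (DC 0) = DepChoice (V:=V).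
Proof. reflexivity. Qed.
End Bridge.

(** The common basis of ground model and extension: everything up to the greedy chain is derived
    from these axioms, so that it can be applied in V[G] as well. Union is binary, which suffices
    for adjoining elements. *)
Class Zax (V : Type) (E : MemRel V) : Prop := {
  zx_ext : forall x y : V, (forall z, z ∊ x <-> z ∊ y) -> x = y;
  zx_pair : forall x y : V, exists z, forall w, w ∊ z <-> w = x \/ w = y;
  zx_union : forall x y : V, exists z, forall w, w ∊ z <-> w ∊ x \/ w ∊ y;
  zx_sep : forall (a : form) (e : var -> V) (x : V), exists y, forall z,
      z ∊ y <-> z ∊ x /\ sat memV (upd e 0 z) a;
  zx_omega : exists w : V, IsOmega w
}.

Tactic Notation "defining" reference(x) := intros; unfold x; dfn.

(** * Definability of the notions of the statement *)

Section DefnNotions.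
Context {V : Type} {E : MemRel V}.
Lemma dfn_IsEmpty : Def1 IsEmpty. Proof. defining IsEmpty. Qed.
Lemma dfn_Sub : Def2 Sub. Proof. defining Sub. Qed.
Lemma dfn_IsUpair : Def3 IsUpair. Proof. defining IsUpair. Qed.
Hint Resolve dfn_IsEmpty dfn_Sub dfn_IsUpair : dfn.
Lemma dfn_IsPair : Def3 IsPair. Proof. defining IsPair. Qed.
Hint Resolve dfn_IsPair : dfn.
Lemma dfn_Rel : Def3 Rel. Proof. defining Rel. Qed.
Hint Resolve dfn_Rel : dfn.
Lemma dfn_IsTriple : Def4 IsTriple. Proof. defining IsTriple. Qed.
Hint Resolve dfn_IsTriple : dfn.
Lemma dfn_Rel3 : Def4 Rel3. Proof. defining Rel3. Qed.
Lemma dfn_IsFun : Def3 IsFun. Proof. defining IsFun. Qed.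
Lemma dfn_Injective : Def1 Injective. Proof. defining Injective. Qed.
Lemma dfn_Onto : Def2 Onto. Proof. defining Onto. Qed.
Lemma dfn_IsSucc : Def2 IsSucc. Proof. defining IsSucc. Qed.
Hint Resolve dfn_Rel3 dfn_IsFun dfn_Injective dfn_Onto dfn_IsSucc : dfn.
Lemma dfn_Inductive : Def1 Inductive_. Proof. defining Inductive_. Qed.
Hint Resolve dfn_Inductive : dfn.
Lemma dfn_IsOmega : Def1 IsOmega. Proof. defining IsOmega. Qed.
Lemma dfn_Transitive : Def1 Transitive. Proof. defining Transitive. Qed.
Hint Resolve dfn_IsOmega dfn_Transitive : dfn.
Lemma dfn_Ordinal : Def1 Ordinal. Proof. defining Ordinal. Qed.
Lemma dfn_Countable : Def1 Countable. Proof. defining Countable. Qed.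
Lemma dfn_Lt : Def3 Lt. Proof. defining Lt. Qed.
Lemma dfn_NameClosed : Def2 NameClosed. Proof. defining NameClosed. Qed.
Hint Resolve dfn_Ordinal dfn_Countable dfn_Lt dfn_NameClosed : dfn.
Lemma dfn_IsName : Def2 IsName. Proof. defining IsName. Qed.
Lemma dfn_OpenDense : Def3 OpenDense. Proof. defining OpenDense. Qed.
Lemma dfn_PredenseBelow : Def4 PredenseBelow. Proof. defining PredenseBelow. Qed.
Lemma dfn_IsInter : Def3 IsInter. Proof. defining IsInter. Qed.
Hint Resolve dfn_IsName dfn_OpenDense dfn_PredenseBelow dfn_IsInter : dfn.
Lemma dfn_GenericFor : Def4 GenericFor. Proof. defining GenericFor. Qed.
End DefnNotions.
#[global] Hint Resolve dfn_IsEmpty dfn_Sub dfn_Rel dfn_IsTriple dfn_Rel3 dfn_IsFun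
  dfn_Injective dfn_Onto dfn_Inductive dfn_Transitive dfn_Ordinal dfn_Countable
  dfn_Lt dfn_NameClosed dfn_IsName dfn_GenericFor : dfn.

(** * Pairs, functions and natural numbers *)

Section Zermelo.
Context {V : Type} {E : MemRel V} {Z : Zax V E}.

Lemma set_ext (x y : V) : (forall z, z ∊ x <-> z ∊ y) -> x = y.
Proof. apply zx_ext. Qed.

Definition om : V := proj1_sig (constructive_indefinite_description _ zx_omega).
Lemma om_IsOmega : IsOmega om.
Proof. exact (proj2_sig (constructive_indefinite_description _ zx_omega)). Qed.

(** Metatheoretic choice as a naming device. A term built with it may enter separation or
    replacement only after [dterm] has been proved for it; the [dterm] lemmas below obtain this from
    the uniqueness of the chosen set. *)
Definition pick (P : V -> Prop) : V := epsilon (inhabits om) P.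
Lemma pickP (P : V -> Prop) : (exists x, P x) -> P (pick P).
Proof. apply epsilon_spec. Qed.

Definition sep (x : V) (P : V -> Prop) : V := pick (fun y => forall z, z ∊ y <-> z ∊ x /\ P z).
Lemma in_sep x P : defn 1 (fun g => P (hd g)) -> forall z, z ∊ sep x P <-> z ∊ x /\ P z.
Proof.
  intros H. unfold sep. apply (pickP (fun y => forall z, z ∊ y <-> z ∊ x /\ P z)).
  destruct (H x) as (a & e & Ha). destruct (zx_sep a e x) as [y Hy]. exists y.
  intros z. rewrite Hy. specialize (Ha (cs (n := 0) tt z)).
  unfold hd, cs in Ha; simpl in Ha. rewrite Ha. reflexivity.
Qed.
Lemma dterm_sep n (a : ctx n -> V) (P : ctx n -> V -> Prop) : dterm n a ->
  defn (S n) (fun g => P (tl g) (hd g)) -> dterm n (fun g => sep (a g) (P g)).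
Proof.
  intros Ha HP. unfold dterm.
  apply defn_ext with (fun g => forall z, z ∊ hd g <-> z ∊ a (tl g) /\ P (tl g) z).
  - intros g. split.
    + intros ->. apply in_sep. now apply (defn_at n P).
    + intros H. apply set_ext. intros z. rewrite H, in_sep; [reflexivity|]. now apply (defn_at n P).
  - dfn.
Qed.

Definition emp : V := sep om (fun _ => False).
Lemma in_emp x : ~ x ∊ emp.
Proof. unfold emp. rewrite in_sep by dfn. tauto. Qed.
Lemma empE (x : V) : IsEmpty x <-> x = emp.
Proof.
  split; [|intros ->; intros z; apply in_emp]. intros H. apply set_ext. intros z.
  generalize (H z) (in_emp z). tauto.
Qed.
Lemma not_emp (x : V) : x <> emp <-> exists y, y ∊ x.
Proof.
  split.
  - intros H. apply NNPP. intros N. apply H, empE. intros z h. apply N. now exists z.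
  - intros [y h] ->. now apply in_emp in h.
Qed.

Definition upair (x y : V) : V := pick (fun z => forall w, w ∊ z <-> w = x \/ w = y).
Lemma in_upair x y w : w ∊ upair x y <-> w = x \/ w = y.
Proof. revert w. apply (pickP (fun z => forall w, w ∊ z <-> w = x \/ w = y)), zx_pair. Qed.
Definition bun (x y : V) : V := pick (fun z => forall w, w ∊ z <-> w ∊ x \/ w ∊ y).
Lemma in_bun x y w : w ∊ bun x y <-> w ∊ x \/ w ∊ y.
Proof. revert w. apply (pickP (fun z => forall w, w ∊ z <-> w ∊ x \/ w ∊ y)), zx_union. Qed.
Definition sing x := upair x x.
Lemma in_sing x w : w ∊ sing x <-> w = x.
Proof. unfold sing. rewrite in_upair. tauto. Qed.
Definition succ x := bun x (sing x).
Lemma in_succ x w : w ∊ succ x <-> w ∊ x \/ w = x.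
Proof. unfold succ. rewrite in_bun, in_sing. tauto. Qed.
Definition opair x y := upair (sing x) (upair x y).

Lemma dterm_upair : DefF2 upair.
Proof.
  intros n a b Ha Hb. unfold dterm.
  apply defn_ext with (fun g => forall w, w ∊ hd g <-> w = a (tl g) \/ w = b (tl g)); [|dfn].
  intros g. split; [intros -> w; apply in_upair|]. intros H. apply set_ext. intros w. now rewrite H, in_upair.
Qed.
Lemma dterm_bun : DefF2 bun.
Proof.
  intros n a b Ha Hb. unfold dterm.
  apply defn_ext with (fun g => forall w, w ∊ hd g <-> w ∊ a (tl g) \/ w ∊ b (tl g)); [|dfn].
  intros g. split; [intros -> w; apply in_bun|]. intros H. apply set_ext. intros w. now rewrite H, in_bun.
Qed.
Hint Resolve dterm_sep dterm_upair dterm_bun : dfn.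
Lemma dterm_sing : DefF1 sing. Proof. defining sing. Qed.
Hint Resolve dterm_sing : dfn.
Lemma dterm_succ : DefF1 succ. Proof. defining succ. Qed.
Lemma dterm_opair : DefF2 opair. Proof. defining opair. Qed.
Hint Resolve dterm_succ dterm_opair : dfn.

Lemma upairE z x y : IsUpair z x y <-> z = upair x y.
Proof.
  split.
  - intros H. apply set_ext. intros w. now rewrite (H w), in_upair.
  - intros -> w. apply in_upair.
Qed.
Lemma pairE z x y : IsPair z x y <-> z = opair x y.
Proof.
  unfold IsPair, opair. split.
  - intros (a & b & H1 & H2 & H3). apply upairE in H1, H2, H3. now subst.
  - intros ->. exists (sing x), (upair x y). rewrite !upairE. auto.
Qed.
Lemma sing_inj x y : sing x = sing y -> x = y.
Proof. intros H. apply in_sing. rewrite <- H. now apply in_sing. Qed.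
Lemma opair_inj x y x' y' : opair x y = opair x' y' -> x = x' /\ y = y'.
Proof.
  intros H. unfold opair in H.
  assert (Hx : x = x').
  { assert (h : sing x ∊ upair (sing x') (upair x' y')) by (rewrite <- H; apply in_upair; auto).
    apply in_upair in h. destruct h as [h|h]; [now apply sing_inj|].
    symmetry. apply in_sing. rewrite h. apply in_upair; auto. }
  subst x'. split; auto.
  assert (h : upair x y ∊ upair (sing x) (upair x y')) by (rewrite <- H; apply in_upair; auto).
  assert (h' : upair x y' ∊ upair (sing x) (upair x y)) by (rewrite H; apply in_upair; auto).
  assert (hy : y ∊ upair x y) by (apply in_upair; auto).
  assert (hy' : y' ∊ upair x y') by (apply in_upair; auto).
  apply in_upair in h, h'.
  destruct h as [h|h].
  - rewrite h in hy. apply in_sing in hy. subst y. destruct h' as [h'|h']; rewrite h' in hy'.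
    + now apply in_sing in hy'.
    + apply in_upair in hy'. destruct hy'; auto.
  - rewrite h in hy. apply in_upair in hy. destruct hy as [->|]; auto.
    destruct h' as [h'|h']; rewrite h' in hy'.
    + now apply in_sing in hy'.
    + apply in_upair in hy'. destruct hy'; auto.
Qed.
Lemma tripleE z x y w : IsTriple z x y w <-> z = opair x (opair y w).
Proof.
  unfold IsTriple. split.
  - intros (u & H1 & H2). apply pairE in H1, H2. now subst.
  - intros ->. exists (opair y w). now rewrite !pairE.
Qed.
Lemma relE R x y : Rel R x y <-> opair x y ∊ R.
Proof.
  unfold Rel. split.
  - intros (z & H & H'). apply pairE in H'. now subst.
  - intros H. exists (opair x y). split; [exact H|now apply pairE].
Qed.
Lemma rel3E R x y w : Rel3 R x y w <-> opair x (opair y w) ∊ R.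
Proof.
  unfold Rel3. split.
  - intros (z & H & H'). apply tripleE in H'. now subst.
  - intros H. eexists. split; [exact H|now apply tripleE].
Qed.

Definition Fun (f a b : V) :=
  (forall z, z ∊ f -> exists x y, x ∊ a /\ y ∊ b /\ z = opair x y) /\
  (forall x, x ∊ a -> exists y, opair x y ∊ f) /\
  (forall x y y', opair x y ∊ f -> opair x y' ∊ f -> y = y').
Lemma dfn_Fun : Def3 Fun. Proof. defining Fun. Qed.
Lemma funE f a b : IsFun f a b <-> Fun f a b.
Proof.
  unfold IsFun, Fun. split.
  - intros [H1 H2].
    assert (D : forall x y, opair x y ∊ f -> x ∊ a).
    { intros x y h. destruct (H1 _ h) as (x' & hx & y' & hy & e). apply pairE, opair_inj in e.
      destruct e; now subst. }
    split; [|split].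
    + intros z h. destruct (H1 _ h) as (x' & hx & y' & hy & e). apply pairE in e. eauto.
    + intros x h. destruct (H2 _ h) as (y & hy & _). apply relE in hy. eauto.
    + intros x y y' h h'. destruct (H2 x) as (u & hu & U); [eauto|].
      rewrite (U y), (U y'); auto; now apply relE.
  - intros (H1 & H2 & H3). split.
    + intros z h. destruct (H1 z h) as (x & y & hx & hy & ->). exists x. split; auto. exists y.
      split; auto. now apply pairE.
    + intros x h. destruct (H2 x h) as [y hy]. exists y. rewrite relE. split; auto.
      intros y'. rewrite relE. intros; eauto.
Qed.

(* A definite description, with the junk value [emp]. *)
Definition the (P : V -> Prop) : V :=
  pick (fun y => (P y /\ forall y', P y' -> y' = y) \/ (~ (exists y, P y /\ forall y', P y' -> y' = y) /\ y = emp)).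
(** Exactly one set satisfies the disjunction, so equality with [the P] is given by a formula
    whenever [P] is; [dterm_the] rests on this. *)
Lemma the_spec P y : (P y /\ forall y', P y' -> y' = y) \/
   (~ (exists y, P y /\ forall y', P y' -> y' = y) /\ y = emp) <-> y = the P.
Proof.
  assert (H := pickP (fun y => (P y /\ forall y', P y' -> y' = y) \/
    (~ (exists y, P y /\ forall y', P y' -> y' = y) /\ y = emp))). fold (the P) in H.
  lapply H; clear H.
  - intros [[H1 H2]|[H1 H2]]; split.
    + intros [[H3 H4]|[H3 H4]]; auto. exfalso; eauto.
    + intros ->; auto.
    + intros [[H3 H4]|[H3 H4]]; [exfalso; eauto|congruence].
    + intros ->; auto.
  - destruct (classic (exists y, P y /\ forall y', P y' -> y' = y)) as [[u h]|h]; [exists u|exists emp]; auto.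
Qed.
Lemma theP P y : P y -> (forall y', P y' -> y' = y) -> the P = y.
Proof. intros. symmetry. apply the_spec. auto. Qed.
Lemma dterm_the n (P : ctx n -> V -> Prop) : defn (S n) (fun g => P (tl g) (hd g)) ->
  dterm n (fun g => the (P g)).
Proof.
  intros HP. unfold dterm. eapply defn_ext; [intros g; symmetry; apply the_spec|]. dfn.
Qed.

Hint Resolve dterm_the dfn_Fun : dfn.

Definition app (f x : V) : V := the (fun y => opair x y ∊ f).
Lemma fun_dom f a b x y : Fun f a b -> opair x y ∊ f -> x ∊ a.
Proof.
  intros (H1 & _) h. destruct (H1 _ h) as (x' & y' & hx & hy & e). apply opair_inj in e.
  destruct e; now subst.
Qed.
Lemma fun_cod f a b x y : Fun f a b -> opair x y ∊ f -> y ∊ b.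
Proof.
  intros (H1 & _) h. destruct (H1 _ h) as (x' & y' & hx & hy & e). apply opair_inj in e.
  destruct e; now subst.
Qed.
Lemma app_in f a b x : Fun f a b -> x ∊ a -> opair x (app f x) ∊ f.
Proof.
  intros (_ & H & U) h. destruct (H x h) as [y hy]. unfold app.
  rewrite theP with (y := y); eauto.
Qed.
Lemma fun_emp b : Fun emp emp b.
Proof. split; [|split]; intros z; [|intros hz|intros y y' hz]; try intros hz; now apply in_emp in hz. Qed.
Lemma fun_weaken f a b c : Sub b c -> Fun f a b -> Fun f a c.
Proof.
  intros S (h1 & h2 & h3). split; auto. intros z hz. destruct (h1 z hz) as (x & y & hx & hy & ->).
  exists x, y. auto.
Qed.
Lemma appE f a b x y : Fun f a b -> opair x y ∊ f -> app f x = y.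
Proof.
  intros F h. pose proof (app_in _ _ _ x F (fun_dom _ _ _ _ _ F h)). destruct F as (_ & _ & U). eauto.
Qed.
Lemma app_cod f a b x : Fun f a b -> x ∊ a -> app f x ∊ b.
Proof. intros F h. eapply fun_cod; eauto. eapply app_in; eauto. Qed.
Lemma fun_ext f g a b c : Fun f a b -> Fun g a c -> (forall x, x ∊ a -> app f x = app g x) -> f = g.
Proof.
  intros F G H. apply set_ext. intros z. split; intros h.
  - destruct (proj1 F _ h) as (x & y & hx & hy & ->). rewrite <- (appE _ _ _ _ _ F h), H by auto.
    eapply app_in; eauto.
  - destruct (proj1 G _ h) as (x & y & hx & hy & ->). rewrite <- (appE _ _ _ _ _ G h), <- H by auto.
    eapply app_in; eauto.
Qed.

Lemma dterm_app : DefF2 app. Proof. defining app. Qed.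
Hint Resolve dterm_app : dfn.

Lemma in_om0 : emp ∊ om.
Proof. apply (proj1 (proj1 om_IsOmega)). now apply empE. Qed.
Lemma succE y x : IsSucc y x <-> y = succ x.
Proof.
  split.
  - intros H. apply set_ext. intros z. now rewrite (H z), in_succ.
  - intros -> z. apply in_succ.
Qed.
Lemma in_omS n : n ∊ om -> succ n ∊ om.
Proof. intros h. apply (proj2 (proj1 om_IsOmega)) with n; auto. now apply succE. Qed.
Lemma isomegaE w : IsOmega w <-> w = om.
Proof.
  split; [|intros ->; apply om_IsOmega]. intros [H1 H2]. apply set_ext. intros z. split.
  - apply H2, om_IsOmega.
  - now apply (proj2 om_IsOmega).
Qed.
(** The minimality of [om] is applied to the inductive set that [P] separates from it; for an
    external predicate on possibly nonstandard numbers induction may fail. *)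
Lemma om_ind (P : V -> Prop) : defn 1 (fun g => P (hd g)) -> P emp ->
  (forall n, n ∊ om -> P n -> P (succ n)) -> forall n, n ∊ om -> P n.
Proof.
  intros D P0 PS n hn. apply (in_sep om P D). revert n hn. apply (proj2 om_IsOmega). split.
  - intros z hz. apply empE in hz. subst. apply in_sep; auto using in_om0.
  - intros x hx y hy. apply succE in hy. subst. apply in_sep in hx; auto. apply in_sep; auto.
    destruct hx; auto using in_omS.
Qed.
Lemma nat_trans n : n ∊ om -> forall m, m ∊ n -> forall k, k ∊ m -> k ∊ n.
Proof.
  revert n. apply (om_ind (fun n => forall m, m ∊ n -> forall k, k ∊ m -> k ∊ n)); [dfn| |].
  - intros m h. now apply in_emp in h.
  - intros n hn IH m hm k hk. rewrite in_succ in *. destruct hm as [hm| ->]; eauto.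
Qed.
Lemma om_trans n : n ∊ om -> forall m, m ∊ n -> m ∊ om.
Proof.
  revert n. apply (om_ind (fun n => forall m, m ∊ n -> m ∊ om)); [dfn| |].
  - intros m h. now apply in_emp in h.
  - intros n hn IH m hm. rewrite in_succ in *. destruct hm as [hm| ->]; eauto.
Qed.
Lemma nat_irrefl n : n ∊ om -> ~ n ∊ n.
Proof.
  revert n. apply (om_ind (fun n => ~ n ∊ n)); [dfn|apply in_emp|].
  intros n hn IH h. apply in_succ in h. apply IH. destruct h as [h|h].
  - apply nat_trans with (succ n); auto. apply in_succ; auto.
  - rewrite <- h at 2. apply in_succ; auto.
Qed.
Lemma nat_cases n : n ∊ om -> n = emp \/ exists m, m ∊ om /\ n = succ m.
Proof.
  revert n. apply (om_ind (fun n => n = emp \/ exists m, m ∊ om /\ n = succ m)); [dfn|auto|eauto].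
Qed.
Lemma in_succ0 n : n ∊ om -> emp ∊ succ n.
Proof.
  revert n. apply (om_ind (fun n => emp ∊ succ n)); [dfn| |]; intros; rewrite in_succ; auto.
Qed.
Lemma succ_mono n : n ∊ om -> forall m, m ∊ n -> succ m ∊ succ n.
Proof.
  revert n. apply (om_ind (fun n => forall m, m ∊ n -> succ m ∊ succ n)); [dfn| |].
  - intros m h. now apply in_emp in h.
  - intros n hn IH m hm. apply in_succ in hm. rewrite in_succ. destruct hm as [hm| ->]; auto.
Qed.
Lemma nat_total m n : m ∊ om -> n ∊ om -> m ∊ n \/ m = n \/ n ∊ m.
Proof.
  intros hm hn. revert m hm. apply (om_ind (fun m => m ∊ n \/ m = n \/ n ∊ m)); [dfn| |].
  - destruct (nat_cases n hn) as [->|(k & hk & ->)]; auto. left. now apply in_succ0.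
  - intros m hm [h|[->|h]].
    + apply succ_mono in h; auto. apply in_succ in h. destruct h; auto.
    + right. right. apply in_succ; auto.
    + right. right. apply in_succ; auto.
Qed.
Lemma nat_asym m n : n ∊ om -> m ∊ n -> ~ n ∊ m.
Proof. intros hn h h'. apply (nat_irrefl n hn). eapply nat_trans; eauto. Qed.
Lemma om_strong_ind (P : V -> Prop) : defn 1 (fun g => P (hd g)) ->
  (forall n, n ∊ om -> (forall m, m ∊ n -> P m) -> P n) -> forall n, n ∊ om -> P n.
Proof.
  intros D H n hn. apply H; auto. revert n hn.
  apply (om_ind (fun n => forall m, m ∊ n -> P m)); [dfn| |].
  - intros m h. now apply in_emp in h.
  - intros n hn IH m hm. apply in_succ in hm. destruct hm as [hm| ->]; auto.
Qed.

Lemma succ_inj m n : m ∊ om -> n ∊ om -> succ m = succ n -> m = n.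
Proof.
  intros hm hn e.
  assert (h : m ∊ succ n) by (rewrite <- e; apply in_succ; auto).
  assert (h' : n ∊ succ m) by (rewrite e; apply in_succ; auto).
  apply in_succ in h, h'. destruct h as [h|]; auto. destruct h' as [h'|]; auto.
  now apply nat_asym in h.
Qed.

Definition least (P : V -> Prop) : V := the (fun n => n ∊ om /\ P n /\ forall m, m ∊ n -> ~ P m).
Lemma leastP (P : V -> Prop) : defn 1 (fun g => P (hd g)) -> (exists n, n ∊ om /\ P n) ->
  least P ∊ om /\ P (least P) /\ forall m, m ∊ least P -> ~ P m.
Proof.
  intros D [n [hn Pn]].
  assert (H : exists n, n ∊ om /\ P n /\ forall m, m ∊ n -> ~ P m).
  { apply NNPP. intros N. revert n hn Pn. apply (om_strong_ind (fun n => ~ P n)); [dfn|].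
    intros n hn IH Pn. apply N. eauto. }
  destruct H as (k & hk & Pk & L). unfold least. rewrite theP with (y := k); auto.
  intros k' (hk' & Pk' & L'). destruct (nat_total k k') as [h|[h|h]]; auto; exfalso.
  - now apply (L' k).
  - now apply (L k').
Qed.
Lemma dterm_least n (P : ctx n -> V -> Prop) : defn (S n) (fun g => P (tl g) (hd g)) ->
  dterm n (fun g => least (P g)).
Proof. intros. unfold least. dfn. Qed.

(** * Recursion on the natural numbers *)

Section OmegaRecursion.
Variables (x0 : V) (G : V -> V -> V).
Hypothesis HG : DefF2 G.

(** An approximation is any set of pairs each of which is initial or obtained from another pair of
    the set. Functionality is a consequence, by induction, and an approximation is prolonged by
    adjoining a single pair, so the recursion theorem holds in the weak fragment. *)
Definition justified (h : V) := forall z, z ∊ h -> z = opair emp x0 \/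
  exists k u, k ∊ om /\ opair k u ∊ h /\ z = opair (succ k) (G k u).
Definition orec (n : V) : V := the (fun v => exists h, justified h /\ opair n v ∊ h).
Lemma dfn_justified : Def1 justified. Proof. defining justified. Qed.
Hint Resolve dfn_justified : dfn.
Lemma dterm_orec : DefF1 orec. Proof. defining orec. Qed.

Lemma justified_0 h v : justified h -> opair emp v ∊ h -> v = x0.
Proof.
  intros J hv. destruct (J _ hv) as [e|(k & u & hk & _ & e)]; apply opair_inj in e; destruct e as [e e'].
  - auto.
  - exfalso. apply (in_emp k). rewrite e. apply in_succ; auto.
Qed.
Lemma justified_S h n v : n ∊ om -> justified h -> opair (succ n) v ∊ h ->
  exists u, opair n u ∊ h /\ v = G n u.
Proof.
  intros hn J hv. destruct (J _ hv) as [e|(k & u & hk & hu & e)]; apply opair_inj in e; destruct e as [e e'].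
  - exfalso. apply (in_emp n). rewrite <- e. apply in_succ; auto.
  - apply succ_inj in e; auto. subst k. eauto.
Qed.
Lemma justified_unique n : n ∊ om -> forall h h' v v', justified h -> justified h' ->
  opair n v ∊ h -> opair n v' ∊ h' -> v = v'.
Proof.
  revert n. apply (om_ind (fun n => forall h h' v v', justified h -> justified h' ->
    opair n v ∊ h -> opair n v' ∊ h' -> v = v')); [dfn| |].
  - intros. rewrite (justified_0 h v), (justified_0 h' v'); auto.
  - intros n hn IH h h' v v' J J' hv hv'.
    destruct (justified_S h n v) as (u & hu & ->), (justified_S h' n v') as (u' & hu' & ->); auto.
    f_equal. eauto.
Qed.
Lemma justified_ex n : n ∊ om -> exists v h, justified h /\ opair n v ∊ h.
Proof.
  revert n. apply (om_ind (fun n => exists v h, justified h /\ opair n v ∊ h)); [dfn| |].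
  - exists x0, (sing (opair emp x0)). split; [|now apply in_sing]. intros z hz. apply in_sing in hz; auto.
  - intros n hn (v & h & J & hv). exists (G n v), (bun h (sing (opair (succ n) (G n v)))). split.
    + intros z hz. apply in_bun in hz. destruct hz as [hz|hz].
      * destruct (J z hz) as [e|(k & u & hk & hu & e)]; auto. right. exists k, u.
        rewrite in_bun; auto.
      * apply in_sing in hz. right. exists n, v. rewrite in_bun; auto.
    + rewrite in_bun, in_sing; auto.
Qed.
Lemma orec_spec n h v : n ∊ om -> justified h -> opair n v ∊ h -> orec n = v.
Proof.
  intros hn J hv. apply theP; [eauto|]. intros v' (h' & J' & hv').
  now apply (justified_unique n hn h' h).
Qed.
Lemma orec_0 : orec emp = x0.
Proof.
  destruct (justified_ex emp in_om0) as (v & h & J & hv). rewrite (orec_spec _ _ _ in_om0 J hv).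
  eapply justified_0; eauto.
Qed.
Lemma orec_S n : n ∊ om -> orec (succ n) = G n (orec n).
Proof.
  intros hn. destruct (justified_ex _ (in_omS _ hn)) as (v & h & J & hv).
  rewrite (orec_spec _ _ _ (in_omS _ hn) J hv).
  destruct (justified_S h n v) as (u & hu & ->); auto. now rewrite (orec_spec _ _ _ hn J hu).
Qed.
End OmegaRecursion.

End Zermelo.
#[global] Hint Resolve dterm_sep dterm_upair dterm_bun dterm_sing dterm_succ dterm_opair dterm_the dfn_Fun
  dterm_app dterm_least dterm_orec : dfn.

(** * A chain of type ω from a partial enumeration *)

Section GreedyChain.
Context {V : Type} {E : MemRel V} {Z : Zax V E}.

(* Along the partial enumeration [N] of part of [t], always step to the least
   index of a strictly larger element. *)
Lemma chain_of_enumeration (t r N Q : V) :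
  Poset t r ->
  (forall k x, k ∊ om -> x ∊ t -> opair k x ∊ Q) ->
  (forall k x, opair k x ∊ N -> k ∊ om) ->
  (forall k x x', opair k x ∊ N -> opair k x' ∊ N -> x = x') ->
  (exists k x, opair k x ∊ N /\ x ∊ t) ->
  (forall k x, opair k x ∊ N -> x ∊ t -> exists k' x', opair k' x' ∊ N /\ x' ∊ t /\ Lt r x x') ->
  HasChainOfType om t r.
Proof.
  intros (_ & Prefl & Pasym & Ptr) HQ HN1 HN2 (k0 & x0 & h0 & ht0) Hstep.
  pose (next := fun n n' => exists x x', opair n x ∊ N /\ opair n' x' ∊ N /\ x ∊ t /\ x' ∊ t /\ Lt r x x').
  assert (Dnext : Def2 next) by (intros; unfold next; dfn).
  (* The recursion runs through indices, among which a least one can be taken; the nodes are then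
     read off from [N]. *)
  pose (step := fun (_ n : V) => least (next n)).
  assert (Dstep : DefF2 step) by (intros; unfold step; dfn).
  pose (nu := orec k0 step).
  assert (Dnu : DefF1 nu) by (intros; unfold nu; dfn).
  assert (Hnu : forall k, k ∊ om -> exists x, x ∊ t /\ opair (nu k) x ∊ N).
  { apply om_ind; [dfn| |].
    - unfold nu. rewrite orec_0 by auto. eauto.
    - intros k hk (x & hx & hN). destruct (Hstep _ _ hN hx) as (k' & x' & hN' & hx' & hlt).
      unfold nu. rewrite orec_S by auto. fold nu.
      destruct (leastP (next (nu k))) as (_ & (y & y' & H1 & H2 & H3 & H4 & H5) & _).
      + dfn.
      + exists k'. split; eauto. unfold next. eauto 10.
      + exists y'. split; auto. }
  pose (y := fun k => the (fun x => opair (nu k) x ∊ N)).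
  assert (Dy : DefF1 y) by (intros; unfold y; dfn).
  assert (Hy : forall k, k ∊ om -> y k ∊ t /\ opair (nu k) (y k) ∊ N).
  { intros k hk. destruct (Hnu k hk) as (x & hx & hN). unfold y.
    rewrite theP with (y := x); auto. intros; eauto. }
  assert (Hs : forall k, k ∊ om -> Lt r (y k) (y (succ k))).
  { intros k hk. destruct (Hy k hk) as [h1 h2], (Hy _ (in_omS _ hk)) as [h3 h4].
    destruct (Hstep _ _ h2 h1) as (k' & x' & hN' & hx' & hlt).
    unfold nu in h4. rewrite orec_S in h4 by auto. fold nu in h4.
    destruct (leastP (next (nu k))) as (_ & (z & z' & H1 & H2 & H3 & H4 & H5) & _).
    + dfn.
    + exists k'. split; eauto. unfold next. eauto 10.
    + now rewrite (HN2 _ _ _ h4 H2), (HN2 _ _ _ h2 H1). }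
  assert (Hlt : forall j, j ∊ om -> forall i, i ∊ j -> Lt r (y i) (y j)).
  { apply (om_ind (fun j => forall i, i ∊ j -> Lt r (y i) (y j))); [unfold y; dfn| |].
    - intros i h. now apply in_emp in h.
    - intros j hj IH i hi. apply in_succ in hi. destruct hi as [hi| ->]; auto.
      specialize (IH i hi). pose proof (om_trans _ hj _ hi) as hi'.
      destruct (Hy _ hj), (Hy _ hi'), (Hy _ (in_omS _ hj)), (Hs _ hj) as [s1 s2], IH as [s3 s4].
      split; [eapply Ptr; [| |eauto..]; eauto|]. intros e. rewrite e in s3. apply s2.
      apply Pasym; auto. }
  exists (sep t (fun x => exists k, k ∊ om /\ x = y k)).
  assert (Dc : defn 1 (fun g => exists k, k ∊ om /\ hd g = y k)) by (unfold y; dfn).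
  assert (Df : defn 1 (fun g => exists k, k ∊ om /\ hd g = opair k (y k))) by (unfold y; dfn).
  (* The fragment provides neither products nor replacement: the graph of the chain is separated
     from the given set [Q], and its range from [t]. *)
  assert (Hf : forall k x, opair k x ∊ sep Q (fun z => exists k, k ∊ om /\ z = opair k (y k)) <-> k ∊ om /\ x = y k).
  { intros k x. rewrite in_sep by auto. split.
    - intros [_ (k' & hk & e)]. apply opair_inj in e. destruct e; now subst.
    - intros [hk ->]. split; eauto. apply HQ; auto. now apply Hy. }
  split; [|split].
  - intros x h. now apply in_sep in h.
  - intros x hx x' hx'. apply in_sep in hx, hx'; auto.
    destruct hx as [_ (i & hi & ->)], hx' as [_ (j & hj & ->)].
    destruct (nat_total i j) as [h|[->|h]]; auto.
    + left. now apply Hlt.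
    + left. apply Prefl. now apply Hy.
    + right. now apply Hlt.
  - exists (sep Q (fun z => exists k, k ∊ om /\ z = opair k (y k))). split; [|split].
    + apply funE. split; [|split].
      * intros z hz. apply in_sep in hz; auto. destruct hz as [_ (k & hk & ->)]. exists k, (y k).
        split; auto. split; auto. apply in_sep; auto. split; eauto. now apply Hy.
      * intros k hk. exists (y k). now apply Hf.
      * intros k x x' h h'. apply Hf in h, h'. destruct h, h'; now subst.
    + intros x hx. apply in_sep in hx; auto. destruct hx as [_ (k & hk & ->)]. exists k. apply relE. now apply Hf.
    + intros i hi j hj hij x x' h h'. apply relE in h, h'. apply Hf in h, h'.
      destruct h as [_ ->], h' as [_ ->]. now apply Hlt.
Qed.
End GreedyChain.

Existing Class ZF.

#[global] Instance ZF_Zax (V : Type) (E : MemRel V) (H : @ZF V E) : Zax V E.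
Proof.
  assert (U : forall x y : V, exists z, forall w, w ∊ z <-> w ∊ x \/ w ∊ y).
  { intros x y. destruct (zf_pairing H x y) as [p hp], (zf_union H p) as [u hu].
    exists u. intros w. unfold memV. rewrite hu. split.
    - intros (z & hz & hw). apply hp in hz. destruct hz; subst; auto.
    - intros [h|h]; [exists x|exists y]; rewrite hp; auto. }
  constructor.
  - exact (zf_extensionality H).
  - exact (zf_pairing H).
  - exact U.
  - exact (zf_separation H).
  - destruct (zf_infinity H) as (w & (z0 & hz0 & ez0) & hw).
    (* ω is the part of the given inductive set [w] common to all inductive sets. The operation
       [sep] already presupposes [om], so the defining formula is unpacked by hand. *)
    assert (D : defn 1 (fun g => forall y : V, Inductive_ y -> hd g ∊ y)) by dfn.
    destruct (D w) as (a & r & Ha), (zf_separation H a r w) as [o Ho].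
    assert (Hin : forall z, z ∊ o <-> z ∊ w /\ forall y, Inductive_ y -> z ∊ y).
    { intros z. specialize (Ha (cs (n := 0) tt z)). specialize (Ho z).
      unfold hd, cs in Ha; simpl in Ha. unfold memV in *. tauto. }
    exists o. split.
    + split.
      * intros z hz. apply Hin. replace z with z0; [split; auto; intros y hy; now apply hy|].
        apply (zf_extensionality H). intros u. split; intros hu; exfalso; [now apply (ez0 u)|now apply (hz u)].
      * intros x hx y hy. apply Hin in hx. apply Hin. destruct hx as [hx1 hx2]. split.
        -- destruct (hw x hx1) as (y' & hy' & h'). replace y with y'; auto.
           apply (zf_extensionality H). intros u. rewrite h'. symmetry. apply hy.
        -- intros s hs. apply (proj2 hs x); auto.
    + intros y hy z hz. apply Hin in hz. now apply hz.
Qed.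

(** * Recursion along membership *)

Section SetTheory.
Context {V : Type} {E : MemRel V} {H : ZF E}.

Definition Un (x : V) : V := pick (fun u => forall w, w ∊ u <-> exists y, y ∊ x /\ w ∊ y).
Lemma in_Un x w : w ∊ Un x <-> exists y, y ∊ x /\ w ∊ y.
Proof. revert w. apply (pickP (fun u => forall w, w ∊ u <-> exists y, y ∊ x /\ w ∊ y)), (zf_union H). Qed.
Definition pow (x : V) : V := pick (fun p => forall y, y ∊ p <-> forall z, z ∊ y -> z ∊ x).
Lemma in_pow x y : y ∊ pow x <-> Sub y x.
Proof. revert y. apply (pickP (fun p => forall y, y ∊ p <-> forall z, z ∊ y -> z ∊ x)), (zf_powerset H). Qed.
Definition repl (x : V) (F : V -> V) : V := pick (fun y => forall u, u ∊ y <-> exists z, z ∊ x /\ u = F z).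
Lemma in_repl x F : dterm 1 (fun g => F (hd g)) -> forall u, u ∊ repl x F <-> exists z, z ∊ x /\ u = F z.
Proof.
  intros D. apply (pickP (fun y => forall u, u ∊ y <-> exists z, z ∊ x /\ u = F z)).
  destruct (D x) as (a & r & Ha).
  assert (Ha' : forall z u, u = F z <-> sat E (upd (upd r 0 z) 1 u) a).
  { intros z u. apply (Ha (cs (cs (n := 0) tt z) u)). }
  destruct (@zf_replacement V E H a r x) as [y Hy].
  - intros z hz. exists (F z). split; [now apply Ha'|]. intros u hu. symmetry. now apply Ha'.
  - exists y. intros u. unfold memV in *. rewrite Hy. split; intros (z & hz & h); exists z; split; auto; now apply Ha'.
Qed.
Lemma dterm_Un : DefF1 Un.
Proof.
  intros n a Ha. unfold dterm.
  apply defn_ext with (fun g => forall w, w ∊ hd g <-> exists y, y ∊ a (tl g) /\ w ∊ y); [|dfn].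
  intros g. split; [intros -> w; apply in_Un|]. intros K. apply set_ext. intros w. now rewrite K, in_Un.
Qed.
Lemma dterm_pow : DefF1 pow.
Proof.
  intros n a Ha. unfold dterm.
  apply defn_ext with (fun g => forall w, w ∊ hd g <-> Sub w (a (tl g))); [|dfn].
  intros g. split; [intros -> w; apply in_pow|]. intros K. apply set_ext. intros w. now rewrite K, in_pow.
Qed.
Lemma dterm_repl n (a : ctx n -> V) (F : ctx n -> V -> V) : dterm n a ->
  dterm (S n) (fun g => F (tl g) (hd g)) -> dterm n (fun g => repl (a g) (F g)).
Proof.
  intros Ha HF. unfold dterm.
  apply defn_ext with (fun g => forall u, u ∊ hd g <-> exists z, z ∊ a (tl g) /\ u = F (tl g) z); [|dfn].
  intros g. split.
  - intros ->. apply in_repl. now apply (dterm_at n F).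
  - intros K. apply set_ext. intros w. rewrite K, in_repl; [reflexivity|]. now apply (dterm_at n F).
Qed.
Hint Resolve dterm_Un dterm_pow dterm_repl : dfn.

Definition prod (a b : V) : V := Un (repl a (fun x => repl b (fun y => opair x y))).
Lemma in_prod a b z : z ∊ prod a b <-> exists x y, x ∊ a /\ y ∊ b /\ z = opair x y.
Proof.
  unfold prod. rewrite in_Un. split.
  - intros (s & hs & hz). apply in_repl in hs; [|dfn]. destruct hs as (x & hx & ->).
    apply in_repl in hz; [|dfn]. destruct hz as (y & hy & ->). eauto.
  - intros (x & y & hx & hy & ->). exists (repl b (opair x)). split.
    + apply in_repl; [dfn|]. eauto.
    + apply in_repl; [dfn|]. eauto.
Qed.
Lemma opair_in_prod a b x y : opair x y ∊ prod a b <-> x ∊ a /\ y ∊ b.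
Proof.
  rewrite in_prod. split.
  - intros (x' & y' & hx & hy & e). apply opair_inj in e. destruct e; now subst.
  - intros []; eauto.
Qed.

Definition lam (a : V) (F : V -> V) : V := repl a (fun x => opair x (F x)).
Lemma in_lam a F : dterm 1 (fun g => F (hd g)) -> forall x y, opair x y ∊ lam a F <-> x ∊ a /\ y = F x.
Proof.
  intros D x y. unfold lam. rewrite in_repl by dfn. split.
  - intros (z & hz & e). apply opair_inj in e. destruct e; now subst.
  - intros [h ->]. eauto.
Qed.
Lemma lam_fun a b F : dterm 1 (fun g => F (hd g)) -> (forall x, x ∊ a -> F x ∊ b) -> Fun (lam a F) a b.
Proof.
  intros D K. split; [|split].
  - intros z hz. unfold lam in hz. apply in_repl in hz; [|dfn]. destruct hz as (x & hx & ->). exists x, (F x); auto.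
  - intros x hx. exists (F x). now apply in_lam.
  - intros x y y' h h'. apply in_lam in h, h'; auto. now destruct h as [_ ->], h' as [_ ->].
Qed.
Lemma app_lam a F x : dterm 1 (fun g => F (hd g)) -> x ∊ a -> app (lam a F) x = F x.
Proof.
  intros D hx. apply (appE _ a (repl a F)).
  - apply lam_fun; auto. intros y hy. apply in_repl; eauto.
  - now apply in_lam.
Qed.

Lemma tcl_ex (x : V) : exists t, IsTcl t x.
Proof.
  pose (T := orec x (fun _ u => Un u)).
  assert (DT : DefF1 T) by (intros; unfold T; dfn).
  assert (DG : DefF2 (fun _ u : V => Un u)) by (intros; dfn).
  exists (Un (repl om T)).
  assert (K : forall z, z ∊ Un (repl om T) <-> exists n, n ∊ om /\ z ∊ T n).
  { intros z. rewrite in_Un. split.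
    - intros (y & hy & hz). apply in_repl in hy; [|dfn]. destruct hy as (n & hn & ->). eauto.
    - intros (n & hn & hz). exists (T n). split; auto. apply in_repl; [dfn|]. eauto. }
  split; [|split].
  - intros z hz. apply K. exists emp. split; [apply in_om0|]. unfold T. now rewrite orec_0.
  - intros y hy z hz. apply K in hy. destruct hy as (n & hn & hy). apply K. exists (succ n).
    split; [now apply in_omS|]. unfold T. rewrite orec_S by auto. apply in_Un. eauto.
  - intros s hs hs' z hz. apply K in hz. destruct hz as (n & hn & hz). revert n hn z hz.
    apply (om_ind (fun n => forall z, z ∊ T n -> z ∊ s)); [dfn| |].
    + unfold T. rewrite orec_0 by auto. exact hs.
    + intros n hn IH z hz. unfold T in hz. rewrite orec_S in hz by auto. apply in_Un in hz.
      destruct hz as (y & hy & hz). apply (hs' y); auto. 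
Qed.
Definition tcl (x : V) : V := the (fun t => IsTcl t x).
Lemma istclE t x : IsTcl t x <-> t = tcl x.
Proof.
  assert (U : forall t t', IsTcl t x -> IsTcl t' x -> t = t').
  { intros u u' (h1 & h2 & h3) (h1' & h2' & h3'). apply set_ext. intros z. split; [apply h3|apply h3']; auto. }
  destruct (tcl_ex x) as [u hu]. assert (e : tcl x = u) by (apply theP; eauto).
  split; [intros; rewrite e; eauto|]. intros ->. now rewrite e.
Qed.
Lemma tcl_spec x : IsTcl (tcl x) x. Proof. now apply istclE. Qed.
Lemma dfn_IsTcl : Def2 IsTcl. Proof. defining IsTcl. Qed.
Hint Resolve dfn_IsTcl : dfn.
Lemma dterm_tcl : DefF1 tcl. Proof. defining tcl. Qed.
Hint Resolve dterm_tcl : dfn.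
Lemma tcl_sub x y : y ∊ x -> y ∊ tcl x. Proof. exact (proj1 (tcl_spec x) y). Qed.
Lemma tcl_trans x y z : y ∊ tcl x -> z ∊ y -> z ∊ tcl x.
Proof. intros h h'. exact (proj1 (proj2 (tcl_spec x)) y h z h'). Qed.
Lemma tcl_min x s : Sub x s -> Transitive s -> Sub (tcl x) s.
Proof. exact (proj2 (proj2 (tcl_spec x)) s). Qed.
Lemma tcl_mono x y : y ∊ tcl x -> Sub (tcl y) (tcl x).
Proof. intros h. apply tcl_min; [|exact (proj1 (proj2 (tcl_spec x)))]. intros z. now apply tcl_trans. Qed.
Lemma tclE x z : z ∊ tcl x <-> z ∊ x \/ exists y, y ∊ x /\ z ∊ tcl y.
Proof.
  split.
  - assert (K : Sub (tcl x) (sep (tcl x) (fun z => z ∊ x \/ exists y, y ∊ x /\ z ∊ tcl y))).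
    { apply tcl_min.
      - intros w hw. apply in_sep; [dfn|]. split; auto. now apply tcl_sub.
      - intros w hw v hv. apply in_sep in hw; [|dfn]. apply in_sep; [dfn|]. destruct hw as [hw h].
        split; [now apply tcl_trans with w|]. right. destruct h as [h|(y & hy & h)].
        + exists w. split; auto. now apply tcl_sub.
        + exists y. split; auto. now apply tcl_trans with w. }
    intros hz. apply K in hz. apply in_sep in hz; [|dfn]. tauto.
  - intros [h|(y & hy & h)]; [now apply tcl_sub|]. apply (tcl_mono x y); auto. now apply tcl_sub.
Qed.

Lemma mem_min (x : V) : x <> emp -> exists y, y ∊ x /\ forall z, z ∊ y -> ~ z ∊ x.
Proof. intros h. apply not_emp in h. exact (@zf_foundation V E H x h). Qed.

Lemma mem_ind (P : V -> Prop) : defn 1 (fun g => P (hd g)) ->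
  (forall x, (forall y, y ∊ x -> P y) -> P x) -> forall x, P x.
Proof.
  intros D K x. apply NNPP. intros N.
  assert (hx : sep (tcl (sing x)) (fun y => ~ P y) <> emp).
  { apply not_emp. exists x. apply in_sep; [dfn|]. split; auto. apply tcl_sub. now apply in_sing. }
  destruct (mem_min _ hx) as (y & hy & M). apply in_sep in hy; [|dfn]. destruct hy as [hy Ny].
  apply Ny, K. intros z hz. apply NNPP. intros Nz. apply (M z hz). apply in_sep; [dfn|].
  split; auto. now apply tcl_trans with y.
Qed.
Lemma mem_irrefl (x : V) : ~ x ∊ x.
Proof.
  revert x. apply (mem_ind (fun x => ~ x ∊ x)); [dfn|]. intros x IH h. now apply (IH x h).
Qed.

(** The names inside a name and the subformulas inside a code are wrapped in ordered pairs, several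
    membership steps down; induction and recursion therefore run along the transitive closure. *)
Lemma tcl_ind (P : V -> Prop) : defn 1 (fun g => P (hd g)) ->
  (forall x, (forall y, y ∊ tcl x -> P y) -> P x) -> forall x, P x.
Proof.
  intros D K x. apply K. revert x. apply (mem_ind (fun x => forall y, y ∊ tcl x -> P y)); [dfn|].
  intros x IH y hy. apply tclE in hy. destruct hy as [hy|(z & hz & hy)]; [apply K|]; eauto.
Qed.
Lemma tcl_irrefl (x : V) : ~ x ∊ tcl x.
Proof.
  revert x. apply (mem_ind (fun x => ~ x ∊ tcl x)); [dfn|]. intros x IH h.
  assert (h' := h). apply tclE in h. destruct h as [h|(y & hy & h)].
  - now apply (mem_irrefl x).
  - apply (IH y hy). apply (tcl_mono y x); auto. now apply tcl_sub.
Qed.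

Section MemRecursion.
Variable G : V -> V -> V.
Hypothesis HG : DefF2 G.

Definition restrict (h x : V) : V := sep h (fun z => exists y u, y ∊ x /\ z = opair y u).
Lemma dterm_restrict : DefF2 restrict. Proof. defining restrict. Qed.
Hint Resolve dterm_restrict : dfn.
Lemma in_restrict h x y u : opair y u ∊ restrict h x <-> opair y u ∊ h /\ y ∊ x.
Proof.
  unfold restrict. rewrite in_sep by dfn. split.
  - intros [K (y' & u' & hy & e)]. apply opair_inj in e. destruct e; now subst.
  - intros []; eauto 6.
Qed.
Lemma restrict_ext h h' x : (forall y u, y ∊ x -> opair y u ∊ h <-> opair y u ∊ h') -> restrict h x = restrict h' x.
Proof.
  intros K. apply set_ext. intros z. unfold restrict. rewrite !in_sep by dfn.
  split; intros [L (y & u & hy & ->)]; split; eauto; now apply K.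
Qed.

(** An attempt at the recursion whose domain contains the transitive closure of each of its points.
    That it is a function, and that attempts agree, is [derivation_unique]. *)
Definition derivation (h : V) := forall x v, opair x v ∊ h ->
  v = G x (restrict h (tcl x)) /\ forall y, y ∊ tcl x -> exists u, opair y u ∊ h.
Definition derives x v := exists h, derivation h /\ opair x v ∊ h.
Definition mrec (x : V) : V := the (derives x).
Lemma dfn_derivation : Def1 derivation. Proof. defining derivation. Qed.
Hint Resolve dfn_derivation : dfn.
Lemma dfn_derives : Def2 derives. Proof. defining derives. Qed.
Hint Resolve dfn_derives : dfn.
Lemma dterm_mrec : DefF1 mrec. Proof. defining mrec. Qed.
Hint Resolve dterm_mrec : dfn.

Lemma derivation_unique x : forall h h' v v', derivation h -> derivation h' ->
  opair x v ∊ h -> opair x v' ∊ h' -> v = v'.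
Proof.
  revert x. apply (tcl_ind (fun x => forall h h' v v', derivation h -> derivation h' ->
  opair x v ∊ h -> opair x v' ∊ h' -> v = v')); [dfn|].
  intros x IH h h' v v' D D' hv hv'.
  destruct (D _ _ hv) as [-> K], (D' _ _ hv') as [-> K']. f_equal. apply restrict_ext.
  intros y u hy. split; intros hu.
  - destruct (K' y hy) as [u' hu']. now rewrite (IH y hy h h' u u').
  - destruct (K y hy) as [u' hu']. now rewrite (IH y hy h' h u u').
Qed.
Lemma mrec_spec x h v : derivation h -> opair x v ∊ h -> mrec x = v.
Proof.
  intros D hv. apply theP; [exists h; auto|]. intros v' (h' & D' & hv').
  now apply (derivation_unique x h' h).
Qed.
Lemma restrict_derivation x h v : derivation h -> opair x v ∊ h -> restrict h (tcl x) = lam (tcl x) mrec.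
Proof.
  intros D hv. apply set_ext. intros z. unfold restrict, lam. rewrite in_sep, in_repl by dfn. split.
  - intros [hz (y & u & hy & ->)]. exists y. split; auto. now rewrite (mrec_spec y h u).
  - intros (y & hy & ->). destruct (proj2 (D _ _ hv) y hy) as [u hu]. rewrite (mrec_spec y h u) by auto.
    split; eauto.
Qed.
Lemma derives_ex x : exists v, derives x v.
Proof.
  revert x. apply (tcl_ind (fun x => exists v, derives x v)); [dfn|]. intros x IH.
  (* On the transitive closure the values exist by the induction hypothesis and are unique;
     replacement collects them, and one more pair treats [x] itself. *)
  pose (h := lam (tcl x) mrec).
  assert (Hh : forall y u, opair y u ∊ h <-> y ∊ tcl x /\ u = mrec y) by (apply in_lam; dfn).
  assert (R : forall h', (forall y, y ∊ tcl x -> forall u, opair y u ∊ h' <-> u = mrec y) ->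
    forall y, y ∊ tcl x \/ y = x -> restrict h' (tcl y) = lam (tcl y) mrec).
  { intros h' K y hy. assert (S : Sub (tcl y) (tcl x)).
    { destruct hy as [hy| ->]; [now apply tcl_mono|intros z; auto]. }
    apply set_ext. intros z. unfold restrict, lam. rewrite in_sep, in_repl by dfn. split.
    - intros [hz (w & u & hw & ->)]. exists w. split; auto. apply K in hz; auto. now subst.
    - intros (w & hw & ->). split; eauto. apply K; auto. }
  exists (G x (lam (tcl x) mrec)), (bun h (sing (opair x (G x (lam (tcl x) mrec))))).
  assert (K : forall y, y ∊ tcl x -> forall u, opair y u ∊ bun h (sing (opair x (G x (lam (tcl x) mrec)))) <-> u = mrec y).
  { intros y hy u. rewrite in_bun, in_sing, Hh. split; [|tauto]. intros [K|K]; [tauto|].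
    apply opair_inj in K. destruct K as [-> _]. now apply tcl_irrefl in hy. }
  split.
  - intros y u hu. apply in_bun in hu. rewrite in_sing in hu. destruct hu as [hu|hu].
    + apply Hh in hu. destruct hu as [hy ->]. rewrite R by auto. split.
      * destruct (IH y hy) as (v & k & D & hv). rewrite (mrec_spec y k v) by auto.
        rewrite (proj1 (D _ _ hv)) at 1. f_equal. eapply restrict_derivation; eauto.
      * intros z hz. exists (mrec z). apply K; auto. now apply (tcl_mono x y).
    + apply opair_inj in hu. destruct hu as [-> ->]. split; [now rewrite R by auto|].
      intros z hz. exists (mrec z). now apply K.
  - apply in_bun. right. now apply in_sing.
Qed.
Lemma mrecE x : mrec x = G x (lam (tcl x) mrec).
Proof.
  destruct (derives_ex x) as (v & h & D & hv). rewrite (mrec_spec x h v) by auto.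
  rewrite (proj1 (D _ _ hv)) at 1. f_equal. eapply restrict_derivation; eauto.
Qed.
End MemRecursion.

End SetTheory.
#[global] Hint Resolve dterm_Un dterm_pow dterm_repl dterm_tcl dfn_IsTcl dterm_restrict dterm_mrec : dfn.

(** * Ordinals and the sets H(κ) *)

Section Hereditary.
Context {V : Type} {E : MemRel V} {H : ZF E}.

Lemma ordinal_in x y : Ordinal x -> y ∊ x -> Ordinal y.
Proof. intros [T1 T2] h. split; [auto|]. intros z hz. apply T2. now apply (T1 y h). Qed.

Lemma ordinal_total a : forall b, Ordinal a -> Ordinal b -> a ∊ b \/ a = b \/ b ∊ a.
Proof.
  revert a. apply (mem_ind (fun a => forall b, Ordinal a -> Ordinal b -> a ∊ b \/ a = b \/ b ∊ a)); [dfn|].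
  intros a IHa b. revert b.
  apply (mem_ind (fun b => Ordinal a -> Ordinal b -> a ∊ b \/ a = b \/ b ∊ a)); [dfn|].
  intros b IHb Oa Ob.
  destruct (classic (exists b', b' ∊ b /\ (a = b' \/ a ∊ b'))) as [(b' & hb & [->|h])|Nb]; auto.
  { left. now apply (proj1 Ob b'). }
  destruct (classic (exists a', a' ∊ a /\ (a' = b \/ b ∊ a'))) as [(a' & ha & [->|h])|Na]; auto.
  { right; right. now apply (proj1 Oa a'). }
  right; left. apply set_ext. intros z. split; intros hz.
  - destruct (IHa z hz b) as [K|K]; eauto using ordinal_in. exfalso. apply Na. exists z. tauto.
  - destruct (IHb z hz) as [K|K]; eauto using ordinal_in; [|destruct K as [K|K]; auto];
      exfalso; apply Nb; exists z; tauto.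
Qed.

Definition surjects (x b : V) := exists f, Fun f x b /\ Onto f b.
Lemma dfn_surjects : Def2 surjects. Proof. defining surjects. Qed.
Hint Resolve dfn_surjects : dfn.

(** [F] may take values outside [b]; those are redirected to [b0]. *)
Lemma surjects_intro x b b0 F : dterm 1 (fun g => F (hd g)) -> b0 ∊ b ->
  (forall y, y ∊ b -> exists z, z ∊ x /\ F z = y) -> surjects x b.
Proof.
  intros D h0 K.
  pose (F' := fun z => the (fun y => F z ∊ b /\ y = F z \/ ~ F z ∊ b /\ y = b0)).
  assert (D' : dterm 1 (fun g => F' (hd g))) by (unfold F'; dfn).
  assert (F1 : forall z, F z ∊ b -> F' z = F z).
  { intros z hz. apply theP; [auto|]. intros y [[]|[]]; [auto|tauto]. }
  assert (F2 : forall z, F' z ∊ b).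
  { intros z. destruct (classic (F z ∊ b)) as [hz|hz]; [now rewrite F1|].
    unfold F'. rewrite theP with (y := b0); auto. intros y [[]|[]]; [tauto|auto]. }
  exists (lam x F'). split; [apply lam_fun; auto|]. intros y hy. destruct (K y hy) as (z & hz & <-).
  exists z. apply relE, in_lam; auto. split; auto. symmetry; auto.
Qed.

Lemma surjects_app x b f : Fun f x b -> Onto f b -> forall y, y ∊ b -> exists z, z ∊ x /\ app f z = y.
Proof.
  intros F O y hy. destruct (O y hy) as [z hz]. apply relE in hz. exists z.
  split; [eapply fun_dom|eapply appE]; eauto.
Qed.

(** * Lindenbaum numbers, the surjective form of Hartogs numbers *)

Section Hartogs.
Variable X : V.

(* The order type of the prewellorder that a surjection of [X] onto an ordinal
   induces on [X]. *)
Definition order_type (R : V) : V := the (fun a => Ordinal a /\ exists f, Fun f X a /\ Onto f a /\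
  R = sep (prod X X) (fun z => exists x y, z = opair x y /\ app f x ∊ app f y)).
Lemma dterm_order_type : DefF1 order_type. Proof. defining order_type. Qed.
Hint Resolve dterm_order_type : dfn.

(** Since [f] is onto a transitive set, the value f(x) is the set of all f(y) with f(y) ∈ f(x). The
    relation on [X] thus determines [f], by induction on its values, and with it the range. *)
Lemma order_type_unique a a' f f' : Ordinal a -> Ordinal a' -> Fun f X a -> Fun f' X a' ->
  Onto f a -> Onto f' a' ->
  (forall x y, x ∊ X -> y ∊ X -> app f x ∊ app f y <-> app f' x ∊ app f' y) -> a = a'.
Proof.
  intros Oa Oa' F F' S S' K.
  assert (L : forall v x, x ∊ X -> app f x = v -> app f' x = v).
  { apply (mem_ind (fun v => forall x, x ∊ X -> app f x = v -> app f' x = v)); [dfn|].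
    intros v IH x hx <-. apply set_ext. intros w. split; intros hw.
    - destruct (surjects_app _ _ _ F' S' w) as (y & hy & <-).
      { apply (proj1 Oa' (app f' x)); auto. eapply app_cod; eauto. }
      apply K in hw; auto. now rewrite (IH _ hw y hy eq_refl).
    - destruct (surjects_app _ _ _ F S w) as (y & hy & <-).
      { apply (proj1 Oa (app f x)); auto. eapply app_cod; eauto. }
      rewrite <- (IH _ hw y hy eq_refl). now apply K. }
  apply set_ext. intros w. split; intros hw.
  - destruct (surjects_app _ _ _ F S w hw) as (y & hy & <-). rewrite <- (L _ y hy eq_refl).
    eapply app_cod; eauto.
  - destruct (surjects_app _ _ _ F' S' w hw) as (y & hy & <-). rewrite (L _ y hy eq_refl).
    eapply app_cod; eauto.
Qed.

(** A surjection of [X] onto an ordinal is recovered up to its order type from a subset of X × X, so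
    replacement over the power set of X × X reaches all these ordinals. Surjections are taken
    because H(κ) is defined through ≤*; zero is added by hand, as a nonempty [X] has no function
    into it. *)
Lemma hartogs_ex : exists k, forall a, a ∊ k <-> Ordinal a /\ (a = emp \/ surjects X a).
Proof.
  exists (sep (bun (sing emp) (repl (pow (prod X X)) order_type))
    (fun a => Ordinal a /\ (a = emp \/ surjects X a))).
  intros a. rewrite in_sep by dfn. split; [tauto|]. intros [O K]. split; auto.
  apply in_bun. destruct K as [->|(f & F & S)]; [left; now apply in_sing|]. right.
  apply in_repl; [dfn|].
  assert (D : forall f, defn 1 (fun g => exists x y, hd g = opair x y /\ app f x ∊ app f y)) by (intros; dfn).
  exists (sep (prod X X) (fun z => exists x y, z = opair x y /\ app f x ∊ app f y)).
  split; [apply in_pow; intros z hz; now apply in_sep in hz|].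
  symmetry. apply theP; [eauto|]. intros a' (O' & f' & F' & S' & e). symmetry.
  apply (order_type_unique a a' f f'); auto. intros x y hx hy.
  assert (h : forall g, app g x ∊ app g y <-> opair x y ∊ sep (prod X X) (fun z => exists x y, z = opair x y /\ app g x ∊ app g y)).
  { intros g. rewrite in_sep, opair_in_prod by auto. split.
    - intros h. split; eauto.
    - intros (_ & x' & y' & e' & h). apply opair_inj in e'. destruct e'; now subst. }
  now rewrite (h f), (h f'), e.
Qed.

Definition hartogs : V := pick (fun k => forall a, a ∊ k <-> Ordinal a /\ (a = emp \/ surjects X a)).
Lemma in_hartogs a : a ∊ hartogs <-> Ordinal a /\ (a = emp \/ surjects X a).
Proof. revert a. apply (pickP (fun k => forall a, a ∊ k <-> Ordinal a /\ (a = emp \/ surjects X a))), hartogs_ex. Qed.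
Lemma emp_ordinal : Ordinal emp.
Proof. split; intros y h; now apply in_emp in h. Qed.
Lemma emp_hartogs : emp ∊ hartogs.
Proof. apply in_hartogs. auto using emp_ordinal. Qed.
Lemma hartogs_ordinal : Ordinal hartogs.
Proof.
  split; [|intros y hy; apply in_hartogs in hy; exact (proj1 (proj1 hy))].
  intros a ha b hb. apply in_hartogs in ha. destruct ha as [O [->|(f & F & S)]]; [now apply in_emp in hb|].
  apply in_hartogs. split; [eapply ordinal_in; eauto|].
  destruct (classic (b = emp)) as [|N]; auto. right. apply not_emp in N. destruct N as [b0 h0].
  apply (surjects_intro _ _ b0 (app f)); [dfn|auto|].
  intros y hy. apply (surjects_app _ _ _ F S). now apply (proj1 O b).
Qed.
Lemma hartogs_not_surjects : ~ surjects X hartogs.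
Proof.
  intros S. apply (mem_irrefl hartogs). apply in_hartogs. auto using hartogs_ordinal.
Qed.
Lemma hartogs_cardinal : Cardinal hartogs.
Proof.
  split; [apply hartogs_ordinal|]. intros (a & ha & f & F & _ & S). apply funE in F.
  apply in_hartogs in ha. destruct ha as [_ [->|(g & G & T)]].
  - destruct (surjects_app _ _ _ F S emp emp_hartogs) as (z & hz & _). now apply in_emp in hz.
  - apply hartogs_not_surjects, (surjects_intro _ _ emp (fun x => app f (app g x))); [dfn|apply emp_hartogs|].
    intros y hy. destruct (surjects_app _ _ _ F S y hy) as (z & hz & <-).
    destruct (surjects_app _ _ _ G T z hz) as (x & hx & <-). eauto.
Qed.
Lemma sub_hartogs k : Ordinal k -> Sub k X -> Sub k hartogs.
Proof.
  intros O S a ha. apply in_hartogs. split; [eapply ordinal_in; eauto|].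
  destruct (classic (a = emp)) as [|N]; auto. right. apply not_emp in N. destruct N as [b0 h0].
  apply (surjects_intro _ _ b0 (fun x => x)); [dfn|auto|].
  intros y hy. exists y. split; auto. apply S. now apply (proj1 O a).
Qed.
Lemma sub_not_lestar y : Sub y X -> ~ LeStar hartogs y.
Proof.
  intros S [K|(f & F & O)].
  - apply (K emp), emp_hartogs.
  - apply funE in F. apply hartogs_not_surjects, (surjects_intro _ _ emp (app f)); [dfn|apply emp_hartogs|].
    intros z hz. destruct (surjects_app _ _ _ F O z hz) as (x & hx & <-). eauto.
Qed.
End Hartogs.

(** * Ranks, the cumulative hierarchy and the existence of H(κ) *)

Definition rank : V -> V := mrec (fun x h => Un (repl x (fun y => succ (app h y)))).
Definition hierarchy : V -> V := mrec (fun x h => Un (repl x (fun y => pow (app h y)))).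
Lemma dterm_rank : DefF1 rank. Proof. defining rank. Qed.
Lemma dterm_hierarchy : DefF1 hierarchy. Proof. defining hierarchy. Qed.
Hint Resolve dterm_rank dterm_hierarchy : dfn.

Lemma in_rank x z : z ∊ rank x <-> exists y, y ∊ x /\ z ∊ succ (rank y).
Proof.
  unfold rank at 1. rewrite mrecE by dfn. fold rank. rewrite in_Un. split.
  - intros (s & hs & hz). apply in_repl in hs; [|dfn]. destruct hs as (y & hy & ->).
    rewrite app_lam in hz by (dfn || auto using tcl_sub). eauto.
  - intros (y & hy & hz). exists (succ (rank y)). split; auto. apply in_repl; [dfn|].
    exists y. split; auto. now rewrite app_lam by (dfn || auto using tcl_sub).
Qed.
Lemma in_hierarchy x z : z ∊ hierarchy x <-> exists y, y ∊ x /\ Sub z (hierarchy y).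
Proof.
  unfold hierarchy at 1. rewrite mrecE by dfn. fold hierarchy. rewrite in_Un. split.
  - intros (s & hs & hz). apply in_repl in hs; [|dfn]. destruct hs as (y & hy & ->).
    rewrite app_lam, in_pow in hz by (dfn || auto using tcl_sub). eauto.
  - intros (y & hy & hz). exists (pow (hierarchy y)). split; [|now apply in_pow]. apply in_repl; [dfn|].
    exists y. split; auto. now rewrite app_lam by (dfn || auto using tcl_sub).
Qed.
Lemma rank_ordinal x : Ordinal (rank x).
Proof.
  revert x. apply (mem_ind (fun x => Ordinal (rank x))); [dfn|]. intros x IH. split.
  - intros a ha b hb. apply in_rank in ha. destruct ha as (y & hy & ha). apply in_rank. exists y.
    split; auto. apply in_succ in ha. apply in_succ. left. destruct ha as [ha| ->]; auto.
    now apply (proj1 (IH y hy) a).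
  - intros a ha. apply in_rank in ha. destruct ha as (y & hy & ha). apply in_succ in ha.
    destruct ha as [ha| ->]; [exact (proj2 (IH y hy) a ha)|exact (proj1 (IH y hy))].
Qed.
Lemma rank_onto x : forall a, a ∊ rank x -> exists y, y ∊ tcl x /\ rank y = a.
Proof.
  revert x. apply (mem_ind (fun x => forall a, a ∊ rank x -> exists y, y ∊ tcl x /\ rank y = a)); [dfn|].
  intros x IH a ha. apply in_rank in ha. destruct ha as (y & hy & ha). apply in_succ in ha.
  destruct ha as [ha| ->].
  - destruct (IH y hy a ha) as (z & hz & e). exists z. split; auto. apply tclE. eauto.
  - exists y. split; auto. now apply tcl_sub.
Qed.
Lemma sub_hierarchy x : Sub x (hierarchy (rank x)).
Proof.
  revert x. apply (mem_ind (fun x => Sub x (hierarchy (rank x)))); [dfn|].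
  intros x IH y hy. apply in_hierarchy. exists (rank y). split; auto.
  apply in_rank. exists y. split; auto. apply in_succ; auto.
Qed.

(** If the rank of [y] exceeded κ, then [rank] would map the transitive closure of [y] onto an
    ordinal above κ, and this would yield a surjection onto κ. Hence every [y] in H(κ) is a subset
    of V_κ, and H(κ) can be separated from the power set of V_κ. *)
Lemma H_ex k : Ordinal k -> exists h, IsH h k.
Proof.
  intros O.
  exists (sep (pow (hierarchy k)) (fun y => exists t, IsTcl t y /\ ~ LeStar k t)).
  assert (D : Def2 LeStar) by (intros; unfold LeStar; dfn).
  intros y. rewrite in_sep by dfn. split; [tauto|]. intros (t & Ht & N). split; [|eauto].
  assert (Ht' := Ht). apply istclE in Ht'. subst t. apply in_pow. intros z hz.
  assert (hr : Sub (rank y) k).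
  { destruct (ordinal_total (rank y) k) as [h|[->|h]]; auto using rank_ordinal.
    - exact (proj1 O _ h).
    - intros w; auto.
    - exfalso. apply N. destruct (classic (k = emp)) as [->|Nk]; [left; now apply empE|].
      right. apply not_emp in Nk. destruct Nk as [b0 h0].
      destruct (surjects_intro (tcl y) k b0 rank) as (f & F & S); [dfn|auto| |].
      + intros a ha. apply rank_onto. now apply (proj1 (rank_ordinal y) k).
      + exists f. split; auto. now apply funE. }
  apply sub_hierarchy in hz. apply in_hierarchy in hz. destruct hz as (a & ha & hz).
  apply in_hierarchy. eauto.
Qed.

(** κ is the Lindenbaum number of the transitive closure [X] of x ∪ k0: subsets of [x] have their
    transitive closure inside [X], which has no surjection onto κ. For a transitive [x] the elements
    of [x] are covered too, being subsets of it. *)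
Lemma large_H k0 x : Cardinal k0 -> exists k h, Cardinal k /\ Sub k0 k /\ IsH h k /\
  forall y, Sub y x -> y ∊ h.
Proof.
  intros [O _]. pose (X := tcl (bun x k0)). exists (hartogs X).
  destruct (H_ex (hartogs X) (hartogs_ordinal X)) as [h Hh]. exists h.
  split; [apply hartogs_cardinal|]. split; [|split; auto].
  - apply sub_hartogs; auto. intros z hz. apply tcl_sub, in_bun; auto.
  - intros y hy. apply Hh. exists (tcl y). split; [apply tcl_spec|]. apply sub_not_lestar.
    apply tcl_min; [|apply tcl_spec]. intros z hz. apply tcl_sub, in_bun; auto.
Qed.
End Hereditary.

(** * Sequences from dependent choice *)

Section Sequences.
Context {V : Type} {E : MemRel V} {H : ZF E}.

Lemma fun_sub_dom f g a a' b : Fun f a b -> Fun g a' b -> Sub f g -> Sub a a'.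
Proof. intros F G S x hx. exact (fun_dom _ _ _ _ _ G (S _ (app_in _ _ _ _ F hx))). Qed.
Lemma fun_sub_app f g a a' b x : Fun f a b -> Fun g a' b -> Sub f g -> x ∊ a -> app f x = app g x.
Proof. intros F G S hx. symmetry. exact (appE _ _ _ _ _ G (S _ (app_in _ _ _ _ F hx))). Qed.
Lemma fun_dom_unique f a a' b b' : Fun f a b -> Fun f a' b' -> a = a'.
Proof.
  intros F G. apply set_ext. intros x. split; intros hx.
  - exact (fun_dom _ _ _ _ _ G (app_in _ _ _ _ F hx)).
  - exact (fun_dom _ _ _ _ _ F (app_in _ _ _ _ G hx)).
Qed.

(** DC for trees is applied to the finite sequences all of whose terms satisfy [Phi], ordered by
    extension. Along a chain of type ω the lengths are unbounded, so its union is a sequence on all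
    of ω. *)
Lemma dependent_sequence (A : V) (Phi : V -> V -> V -> Prop) : DepChoice (V := V) -> Def3 Phi ->
  (forall n f, n ∊ om -> Fun f n A -> exists y, y ∊ A /\ Phi n f y) ->
  exists F, Fun F om A /\ forall n, n ∊ om -> Phi n (restrict F n) (app F n).
Proof.
  intros dc D K.
  pose (good := fun f => exists n, n ∊ om /\ Fun f n A /\ forall k, k ∊ n -> Phi k (restrict f k) (app f k)).
  assert (Dgood : Def1 good) by (intros; unfold good; dfn).
  pose (t := sep (pow (prod om A)) good).
  assert (Ht : forall f, f ∊ t <-> good f).
  { intros f. unfold t. rewrite in_sep by dfn. split; [tauto|]. intros G. split; auto.
    apply in_pow. destruct G as (n & hn & F & _). intros z hz.
    destruct (proj1 F z hz) as (x & y & hx & hy & ->). apply opair_in_prod. split; auto.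
    now apply (om_trans n). }
  pose (r := sep (prod t t) (fun z => exists f g, z = opair f g /\ Sub f g)).
  assert (Hr : forall f g, Rel r f g <-> f ∊ t /\ g ∊ t /\ Sub f g).
  { intros f g. rewrite relE. unfold r. rewrite in_sep, opair_in_prod by dfn. split.
    - intros (h & f' & g' & e & S). apply opair_inj in e. destruct e; subst. tauto.
    - intros (h1 & h2 & S). split; eauto. }
  assert (Hlt : forall f g, Lt r f g -> forall n n', n ∊ om -> n' ∊ om -> Fun f n A -> Fun g n' A -> n ∊ n').
  { intros f g [L N] n n' hn hn' F G. apply Hr in L. destruct L as (_ & _ & S).
    destruct (nat_total n n' hn hn') as [h|[->|h]]; auto; exfalso.
    - apply N. eapply fun_ext; eauto. intros x hx. eapply fun_sub_app; eauto.
    - apply (nat_irrefl n' hn'). exact (fun_sub_dom _ _ _ _ _ F G S _ h). }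
  assert (Hsub : forall f g z n n' N, n' ∊ om -> Fun f n A -> Fun g n' A -> Fun z N A ->
    Sub f z -> Sub g z -> n ∊ n' \/ n = n' -> Sub f g).
  { intros f g z n n' N hn' F G Z S S' h p hp. destruct (proj1 F p hp) as (x & y & hx & hy & ->).
    assert (hx' : x ∊ n').
    { destruct h as [h| ->]; auto. now apply (nat_trans n' hn' n). }
    replace y with (app g x); [eapply app_in; eauto|].
    rewrite (fun_sub_app g z n' N A x), <- (fun_sub_app f z n N A x); auto. eapply appE; eauto. }
  destruct (dc om om_IsOmega t r) as (c & Sc & Cc & f & F & O & I).
  - split; [|split].
    + split; [|split; [|split]].
      * intros z hz. apply in_sep in hz; [|dfn]. destruct hz as [hz _]. apply in_prod in hz.
        destruct hz as (x & y & hx & hy & ->). exists x. split; auto. exists y. split; auto. now apply pairE.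
      * intros x hx. apply Hr. split; auto. split; auto. intros z; auto.
      * intros x hx y hy h h'. apply Hr in h, h'. apply set_ext. intros z.
        split; [now apply h|now apply h'].
      * intros x hx y hy z hz h h'. apply Hr in h, h'. apply Hr. repeat split; auto.
        intros w hw. apply h'. now apply h.
    + intros x Sx [y0 hy0].
      (* A node of least length is minimal, since strictly smaller nodes are strictly shorter. *)
      destruct (leastP (fun n => exists f, f ∊ x /\ Fun f n A)) as (h1 & (g & hg & G) & h3).
      * dfn.
      * destruct (proj1 (Ht y0) (Sx _ hy0)) as (n & hn & Fy & _). eauto.
      * exists g. split; auto. intros y hy L. destruct (proj1 (Ht y) (Sx _ hy)) as (n & hn & Fy & _).
        apply (h3 n); eauto.
    + intros z hz x hx y hy Lx Ly. apply Hr in Lx, Ly.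
      destruct (proj1 (Ht z) hz) as (nz & hnz & Fz & _), (proj1 (Ht x) hx) as (nx & hnx & Fx & _),
        (proj1 (Ht y) hy) as (ny & hny & Fy & _).
      destruct (nat_total nx ny hnx hny) as [h|[h|h]].
      * left. apply Hr. split; [tauto|split; [tauto|]]. apply (Hsub x y z nx ny nz); auto; tauto.
      * left. apply Hr. split; [tauto|split; [tauto|]]. apply (Hsub x y z nx ny nz); auto; tauto.
      * right. apply Hr. split; [tauto|split; [tauto|]]. apply (Hsub y x z ny nx nz); auto; tauto.
  (* Only sequences of finite length need upper bounds: the last term serves, or the root [emp] for
     the sequence of length 0. *)
  - intros a ha f F I. apply funE in F. destruct (nat_cases a ha) as [->|(k & hk & ->)].
    + exists emp. split; [|intros i hi; now apply in_emp in hi]. apply Ht. exists emp.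
      split; [apply in_om0|]. split; [apply fun_emp|]. intros z hz. now apply in_emp in hz.
    + assert (hk' : k ∊ succ k) by (apply in_succ; auto).
      exists (app f k). split; [eapply app_cod; eauto|]. intros i hi x hx.
      destruct (proj1 (in_succ _ _) hi) as [h| ->].
      * destruct (I i hi k hk' h x (app f k)); auto. apply relE. eapply app_in; eauto.
      * apply relE in hx. rewrite (appE _ _ _ _ _ F hx). apply Hr.
        assert (x ∊ t) by (eapply fun_cod; eauto). split; auto. split; auto. intros z; auto.
  - intros x hx. destruct (proj1 (Ht x) hx) as (n & hn & Fx & Px).
    destruct (K n x hn Fx) as (y & hy & hP).
    pose (x' := bun x (sing (opair n y))).
    assert (nx : forall u, ~ opair n u ∊ x).
    { intros u hu. apply (nat_irrefl n hn). eapply fun_dom; eauto. }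
    assert (Hx' : forall u v, opair u v ∊ x' <-> opair u v ∊ x \/ u = n /\ v = y).
    { intros u v. unfold x'. rewrite in_bun, in_sing. split; intros [h|h]; auto.
      - apply opair_inj in h; auto.
      - right. now destruct h as [-> ->]. }
    assert (Fx' : Fun x' (succ n) A).
    { split; [|split].
      - intros z hz. apply in_bun in hz. rewrite in_sing in hz. destruct hz as [hz| ->].
        + destruct (proj1 Fx z hz) as (u & v & hu & hv & ->). exists u, v. rewrite in_succ; auto.
        + exists n, y. rewrite in_succ; auto.
      - intros u hu. apply in_succ in hu. destruct hu as [hu| ->].
        + exists (app x u). apply Hx'. left. eapply app_in; eauto.
        + exists y. apply Hx'. auto.
      - intros u v v' h h'. apply Hx' in h, h'. destruct h as [h|[-> ->]], h' as [h'|[e ->]]; auto.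
        + eapply (proj2 (proj2 Fx)); eauto.
        + subst. now apply nx in h.
        + now apply nx in h'. }
    assert (R : forall k, k ∊ succ n -> restrict x' k = restrict x k).
    { intros k hk. apply restrict_ext. intros u v hu. rewrite Hx'. split; auto. intros [h|[-> _]]; auto.
      exfalso. apply in_succ in hk. destruct hk as [hk| ->]; [|now apply (nat_irrefl n hn)].
      now apply (nat_asym k n hn hk). }
    assert (Sx : Sub x x') by (intros z hz; apply in_bun; auto).
    assert (hx' : x' ∊ t).
    { apply Ht. exists (succ n). split; [now apply in_omS|]. split; auto. intros k hk. rewrite R by auto.
      apply in_succ in hk. destruct hk as [hk| ->].
      - rewrite <- (fun_sub_app x x' n (succ n) A) by auto. auto.
      - rewrite (appE x' (succ n) A n y); auto; [|apply Hx'; auto]. replace (restrict x n) with x; auto.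
        apply set_ext. intros z. unfold restrict. rewrite in_sep by dfn. split; [|tauto].
        intros hz. split; auto. destruct (proj1 Fx z hz) as (u & v & hu & hv & ->). eauto. }
    exists x'. split; auto. split; [apply Hr; auto|]. intros e. apply (nx y). rewrite e. apply Hx'. auto.
  - apply funE in F.
    (* The i-th node of the chain has length m ≥ i, which is what [i ∊ succ m] says. *)
    assert (L : forall i, i ∊ om -> exists m, m ∊ om /\ i ∊ succ m /\ Fun (app f i) m A).
    { apply om_ind; [dfn| |].
      - destruct (proj1 (Ht (app f emp))) as (m & hm & Fm & _).
        { apply Sc. eapply app_cod; eauto. apply in_om0. }
        exists m. split; auto. split; auto. now apply in_succ0.
      - intros i hi (m & hm & him & Fm).
        destruct (proj1 (Ht (app f (succ i)))) as (m' & hm' & Fm' & _).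
        { apply Sc. eapply app_cod; eauto. now apply in_omS. }
        exists m'. split; auto. split; auto. apply succ_mono; auto.
        assert (h : m ∊ m').
        { apply (Hlt (app f i) (app f (succ i))); auto.
          apply (I i hi (succ i) (in_omS _ hi)); [apply in_succ; auto| |];
            apply relE; eapply app_in; eauto; now apply in_omS. }
        apply in_succ in him. destruct him as [him| ->]; auto. now apply (nat_trans m' hm' m). }
    assert (C : forall g g' x y y', g ∊ c -> g' ∊ c -> opair x y ∊ g -> opair x y' ∊ g' -> y = y').
    { assert (C' : forall g g' x y y', g' ∊ c -> Sub g g' -> opair x y ∊ g -> opair x y' ∊ g' -> y = y').
      { intros g g' x y y' hg' S h h'. destruct (proj1 (Ht g') (Sc _ hg')) as (m & hm & Fm & _).
        apply S in h. eapply (proj2 (proj2 Fm)); eauto. }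
      intros g g' x y y' hg hg' h h'. destruct (Cc g hg g' hg') as [S|S]; apply Hr in S.
      - apply (C' g g' x); auto. apply S.
      - symmetry. apply (C' g' g x); auto. apply S. }
    assert (FU : Fun (Un c) om A).
    { split; [|split].
      - intros z hz. apply in_Un in hz. destruct hz as (g & hg & hz).
        destruct (proj1 (Ht g) (Sc _ hg)) as (m & hm & Fm & _).
        destruct (proj1 Fm z hz) as (x & y & hx & hy & ->). exists x, y. split; auto. now apply (om_trans m).
      - intros n hn. destruct (L (succ n) (in_omS _ hn)) as (m & hm & h & Fm).
        exists (app (app f (succ n)) n). apply in_Un. exists (app f (succ n)).
        split; [eapply app_cod; eauto; now apply in_omS|]. eapply app_in; eauto.
        apply in_succ in h. assert (hn' : n ∊ succ n) by (apply in_succ; auto).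
        destruct h as [h|<-]; auto. now apply (nat_trans m hm (succ n)).
      - intros x y y' h h'. apply in_Un in h, h'. destruct h as (g & hg & h), h' as (g' & hg' & h').
        eapply (C g g'); eauto. }
    exists (Un c). split; auto. intros n hn.
    pose proof (app_in _ _ _ n FU hn) as h. apply in_Un in h. destruct h as (g & hg & h).
    destruct (proj1 (Ht g) (Sc _ hg)) as (m & hm & Fm & P).
    assert (hnm : n ∊ m) by (eapply fun_dom; eauto).
    replace (restrict (Un c) n) with (restrict g n).
    + rewrite <- (appE _ _ _ _ _ Fm h). auto.
    + apply restrict_ext. intros x y hx. split; intros h'.
      * apply in_Un. eauto.
      * apply in_Un in h'. destruct h' as (g' & hg' & h'). replace y with (app g x).
        { eapply app_in; eauto. now apply (nat_trans m hm n). }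
        apply (C g g' x); auto. eapply app_in; eauto. now apply (nat_trans m hm n).
Qed.

(** * Coding hereditarily finite sets by natural numbers *)

(* Binary counting: [inc x] replaces an initial segment [k] of [x] by its
   supremum, where [k] is the least number outside [x]. *)
Definition inc (x : V) : V :=
  bun (sep x (fun i => ~ i ∊ least (fun k => ~ k ∊ x))) (sing (least (fun k => ~ k ∊ x))).
Lemma dterm_inc : DefF1 inc. Proof. defining inc. Qed.
Hint Resolve dterm_inc : dfn.
(** The set of positions of the digit 1 in the binary expansion of n; counting up makes arithmetic
    in the model unnecessary. *)
Definition bits : V -> V := orec emp (fun _ x => inc x).
Lemma dterm_bits : DefF1 bits. Proof. defining bits. Qed.
Hint Resolve dterm_bits : dfn.
Lemma bits_0 : bits emp = emp.
Proof. apply orec_0. dfn. Qed.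
Lemma bits_S n : n ∊ om -> bits (succ n) = inc (bits n).
Proof. intros hn. unfold bits. rewrite orec_S by (dfn || auto). reflexivity. Qed.

Lemma incE x k : k ∊ om -> ~ k ∊ x -> (forall i, i ∊ k -> i ∊ x) ->
  forall z, z ∊ inc x <-> (z ∊ x /\ ~ z ∊ k) \/ z = k.
Proof.
  intros hk nk K. assert (e : least (fun k => ~ k ∊ x) = k).
  { destruct (leastP (fun k => ~ k ∊ x)) as (h1 & h2 & h3); [dfn|eauto|].
    destruct (nat_total _ _ h1 hk) as [h|[h|h]]; auto; exfalso.
    - apply h2, K, h.
    - now apply (h3 k). }
  intros z. unfold inc. rewrite e, in_bun, in_sing, in_sep by dfn. tauto.
Qed.

Lemma bits_sub n : n ∊ om -> Sub (bits n) n.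
Proof.
  revert n. apply (om_ind (fun n => Sub (bits n) n)); [dfn| |].
  - rewrite bits_0. intros z; auto.
  - intros n hn IH z. rewrite bits_S by auto. assert (nn : ~ n ∊ bits n) by (intros h; now apply (nat_irrefl n hn), IH).
    destruct (leastP (fun k => ~ k ∊ bits n)) as (h1 & h2 & h3); [dfn|eauto|].
    rewrite (incE (bits n) (least (fun k => ~ k ∊ bits n))); auto.
    2: { intros i hi. apply NNPP. intros N. exact (h3 i hi N). }
    rewrite in_succ. intros [[h _]| ->]; [left; auto|].
    destruct (nat_total _ _ h1 hn) as [h|[h|h]]; auto. exfalso. now apply (h3 n).
Qed.

(** Counting on from a number with k trailing zeros runs through all patterns in the last k digits
    while the higher digits stay fixed. *)
Lemma bits_fill k : k ∊ om -> forall n z, n ∊ om -> (forall i, i ∊ k -> ~ i ∊ bits n) -> Sub z k ->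
  exists m, m ∊ om /\ bits m = bun (bits n) z.
Proof.
  revert k. apply (om_ind (fun k => forall n z, n ∊ om -> (forall i, i ∊ k -> ~ i ∊ bits n) -> Sub z k ->
    exists m, m ∊ om /\ bits m = bun (bits n) z)); [dfn| |].
  - intros n z hn _ S. exists n. split; auto. apply set_ext. intros i. rewrite in_bun. split; auto.
    intros [h|h]; auto. apply S in h. now apply in_emp in h.
  - intros k hk IH n z hn N S.
    assert (N' : forall i, i ∊ k -> ~ i ∊ bits n) by (intros i hi; apply N, in_succ; auto).
    destruct (classic (k ∊ z)) as [hz|hz].
    (* If k ∈ z, counting first fills all positions below k; the next increment carries into
       position k and clears them, and then z ∩ k is filled in. *)
    + destruct (IH n k hn N') as (m & hm & em); [intros i; auto|].
      assert (em' : forall i, i ∊ bits (succ m) <-> i ∊ bits n \/ i = k).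
      { intros i. rewrite bits_S, em, (incE (bun (bits n) k) k hk), in_bun; auto.
        2: { rewrite in_bun. intros [h|h]; [|now apply (nat_irrefl k)]. apply (N k); auto. }
        2: { intros j hj. rewrite in_bun. auto. }
        split; [tauto|]. intros [h|h]; auto. left. split; auto. intros hi. now apply (N' i). }
      destruct (IH (succ m) (sep z (fun i => i ∊ k))) as (m' & hm' & e').
      * now apply in_omS.
      * intros i hi h. apply em' in h. destruct h as [h| ->]; [now apply (N' i)|now apply (nat_irrefl k)].
      * intros i hi. apply in_sep in hi; [tauto|dfn].
      * exists m'. split; auto. rewrite e'. apply set_ext. intros i. rewrite !in_bun, em', in_sep by dfn.
        split; [intros [[h|h]|h]; subst; tauto|].
        intros [h|h]; auto. destruct (proj1 (in_succ _ _) (S i h)); auto.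
    + apply (IH n z hn N'). intros i hi. destruct (proj1 (in_succ _ _) (S i hi)) as [h| ->]; auto. contradiction.
Qed.
Lemma bits_onto k z : k ∊ om -> Sub z k -> exists m, m ∊ om /\ bits m = z.
Proof.
  intros hk S. destruct (bits_fill k hk emp z in_om0) as (m & hm & e); auto.
  - rewrite bits_0. intros i _. apply in_emp.
  - exists m. split; auto. rewrite e, bits_0. apply set_ext. intros i. rewrite in_bun.
    generalize (in_emp i). tauto.
Qed.

(** The inverse of Ackermann's coding: the positions of the digit 1 in the code of [x] are the codes
    of its elements. *)
Definition code : V -> V := mrec (fun x h => least (fun n => bits n = repl x (app h))).
Lemma dterm_code : DefF1 code. Proof. defining code. Qed.
Hint Resolve dterm_code : dfn.
Lemma codeE x : code x = least (fun n => bits n = repl x code).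
Proof.
  unfold code at 1. rewrite mrecE by dfn. fold code. f_equal.
  apply functional_extensionality. intros n. f_equal. apply set_ext. intros z. rewrite !in_repl by dfn.
  split; intros (y & hy & ->); exists y; split; auto; [|symmetry]; apply app_lam; auto using tcl_sub; dfn.
Qed.

(** Finiteness is expressed through the codes: by [bits_onto] a set of codes bounded in ω is the set
    of digit positions of some number. Imposed hereditarily, as in [hf], it makes [code] total and
    injective. *)
Definition bounded (x : V) := exists k, k ∊ om /\ forall z, z ∊ x -> code z ∊ k.
Definition hf (x : V) := bounded x /\ forall y, y ∊ tcl x -> bounded y.
Lemma dfn_bounded : Def1 bounded. Proof. defining bounded. Qed.
Hint Resolve dfn_bounded : dfn.
Lemma dfn_hf : Def1 hf. Proof. defining hf. Qed.
Hint Resolve dfn_hf : dfn.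
Lemma hfE x : hf x <-> bounded x /\ forall y, y ∊ x -> hf y.
Proof.
  unfold hf. split.
  - intros [B K]. split; auto. intros y hy. split; [apply K, tcl_sub, hy|]. intros z hz. apply K, tclE. eauto.
  - intros [B K]. split; auto. intros y hy. apply tclE in hy. destruct hy as [hy|(z & hz & hy)].
    + now apply K.
    + now apply (K z).
Qed.
Lemma code_spec x : bounded x -> code x ∊ om /\ bits (code x) = repl x code.
Proof.
  intros (k & hk & K). rewrite codeE.
  destruct (leastP (fun n => bits n = repl x code)) as (h1 & h2 & _); [dfn| |auto].
  apply (bits_onto k); auto. intros z hz. apply in_repl in hz; [|dfn]. destruct hz as (y & hy & ->). auto.
Qed.
Lemma code_om x : hf x -> code x ∊ om. Proof. intros [B _]. now apply code_spec. Qed.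
Lemma code_inj x : forall y, hf x -> hf y -> code x = code y -> x = y.
Proof.
  revert x. apply (mem_ind (fun x => forall y, hf x -> hf y -> code x = code y -> x = y)); [dfn|].
  intros x IH y hx hy e. apply hfE in hx, hy. destruct hx as [Bx Kx], hy as [By Ky].
  destruct (code_spec x Bx) as [_ ex], (code_spec y By) as [_ ey]. rewrite e, ey in ex.
  apply set_ext. intros z. split; intros hz.
  - assert (h : code z ∊ repl y code) by (rewrite ex; apply in_repl; [dfn|eauto]).
    apply in_repl in h; [|dfn]. destruct h as (w & hw & e'). rewrite (IH z hz w); auto.
  - assert (h : code z ∊ repl x code) by (rewrite <- ex; apply in_repl; [dfn|eauto]).
    apply in_repl in h; [|dfn]. destruct h as (w & hw & e'). rewrite <- (IH w hw z); auto.
Qed.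
Lemma code_mono x y : hf x -> y ∊ x -> code y ∊ code x.
Proof.
  intros [B _] hy. destruct (code_spec x B) as [hx e]. apply (bits_sub _ hx). rewrite e.
  apply in_repl; [dfn|eauto].
Qed.
Lemma hf_in x y : hf x -> y ∊ x -> hf y. Proof. intros h. apply hfE in h. apply h. Qed.
Lemma hf_emp : hf emp.
Proof.
  apply hfE. split; [|intros y h; now apply in_emp in h]. exists emp. split; [apply in_om0|].
  intros z h. now apply in_emp in h.
Qed.
Lemma hf_adjoin x y : hf x -> hf y -> hf (bun x (sing y)).
Proof.
  intros hx hy. assert (hx' := hx). apply hfE in hx'. destruct hx' as [(k & hk & K) Kx]. apply hfE. split.
  - pose proof (code_om y hy) as hc. assert (hs : succ (code y) ∊ om) by now apply in_omS.
    destruct (nat_total k (succ (code y)) hk hs) as [h|[h|h]].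
    + exists (succ (code y)). split; auto. intros z hz. rewrite in_bun, in_sing in hz. destruct hz as [hz| ->].
      * apply (nat_trans _ hs k); auto.
      * apply in_succ; auto.
    + subst k. exists (succ (code y)). split; auto. intros z hz. rewrite in_bun, in_sing in hz. destruct hz as [hz| ->]; auto.
      apply in_succ; auto.
    + exists k. split; auto. intros z hz. rewrite in_bun, in_sing in hz. destruct hz as [hz| ->]; auto.
      apply (nat_trans _ hk _ h). apply in_succ; auto.
  - intros z hz. rewrite in_bun, in_sing in hz. destruct hz as [hz| ->]; auto.
Qed.
Lemma hf_upair x y : hf x -> hf y -> hf (upair x y).
Proof.
  intros hx hy. replace (upair x y) with (bun (bun emp (sing x)) (sing y)).
  - auto using hf_adjoin, hf_emp.
  - apply set_ext. intros z. rewrite !in_bun, !in_sing, in_upair. generalize (in_emp z). tauto.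
Qed.
Lemma hf_opair x y : hf x -> hf y -> hf (opair x y).
Proof. intros. unfold opair, sing. auto using hf_upair. Qed.
Lemma hf_nat n : n ∊ om -> hf n.
Proof.
  revert n. apply (om_ind (fun n => hf n)); [dfn|apply hf_emp|]. intros n hn IH. now apply hf_adjoin.
Qed.
Lemma hf_fun n s b : n ∊ om -> Fun s n b -> (forall y, y ∊ b -> hf y) -> hf s.
Proof.
  intros hn F K.
  assert (L : forall m, m ∊ om -> m ∊ succ n -> hf (restrict s m)).
  { apply (om_ind (fun m => m ∊ succ n -> hf (restrict s m))); [dfn| |].
    - intros _. replace (restrict s emp) with emp; [apply hf_emp|]. symmetry. apply empE.
      intros z hz. unfold restrict in hz. apply in_sep in hz; [|dfn].
      destruct hz as (_ & y & u & hy & _). now apply in_emp in hy.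
    - intros m hm IH hmn.
      assert (hmn' : m ∊ n).
      { assert (hm' : m ∊ succ m) by (apply in_succ; auto).
        apply in_succ in hmn. destruct hmn as [h|<-]; auto. now apply (nat_trans n hn (succ m)). }
      replace (restrict s (succ m)) with (bun (restrict s m) (sing (opair m (app s m)))).
      + apply hf_adjoin; [apply IH, in_succ; auto|]. apply hf_opair; [now apply hf_nat|].
        apply K. eapply app_cod; eauto.
      + apply set_ext. intros z. unfold restrict. rewrite in_bun, in_sing, !in_sep by dfn. split.
        * intros [(h & y & u & hy & ->)| ->].
          -- split; auto. exists y, u. rewrite in_succ; auto.
          -- split; [eapply app_in; eauto|]. exists m, (app s m). rewrite in_succ; auto.
        * intros (h & y & u & hy & ->). apply in_succ in hy. destruct hy as [hy| ->]; [left; eauto|].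
          right. now rewrite (appE _ _ _ _ _ F h). }
  replace s with (restrict s n); [apply L; auto; apply in_succ; auto|].
  apply set_ext. intros z. unfold restrict. rewrite in_sep by dfn. split; [tauto|]. intros hz.
  split; auto. destruct (proj1 F z hz) as (u & v & hu & hv & ->). eauto.
Qed.
(** Codes increase strictly along membership, hence along 0, 1, 2 and so on. The inequality n ≤
    [code n] turns bounds on codes of indices into bounds on the indices. *)
Lemma code_nat n : n ∊ om -> n ∊ succ (code n).
Proof.
  revert n. apply (om_ind (fun n => n ∊ succ (code n))); [dfn| |].
  - apply in_succ0. now apply code_om, hf_emp.
  - intros n hn IH. assert (hs : hf (succ n)) by now apply hf_nat, in_omS.
    apply succ_mono; [now apply code_om|].
    assert (h : code n ∊ code (succ n)) by (apply code_mono; auto; apply in_succ; auto).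
    apply in_succ in IH. destruct IH as [IH|e].
    + apply (nat_trans _ (code_om _ hs) (code n)); auto.
    + now rewrite <- e in h.
Qed.

(** * Countable hulls *)

Definition compose (f s n : V) : V := lam n (fun i => app f (app s i)).
Lemma dterm_compose n a b c : dterm n a -> dterm n b -> dterm n c -> dterm n (fun g => compose (a g) (b g) (c g)).
Proof. intros. unfold compose, lam. dfn. Qed.
Hint Resolve dterm_compose : dfn.

Lemma countable_image F A : Fun F om A -> Countable (repl om (app F)).
Proof.
  intros K. exists om. split; [apply om_IsOmega|].
  pose (j := fun x => least (fun n => app F n = x)).
  assert (Dj : DefF1 j) by (intros; unfold j; dfn).
  assert (Hj : forall x, x ∊ repl om (app F) -> j x ∊ om /\ app F (j x) = x).
  { intros x hx. apply in_repl in hx; [|dfn]. destruct hx as (n & hn & ->).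
    destruct (leastP (fun k => app F k = app F n)) as (h1 & h2 & _); [dfn|eauto|]. split; auto. }
  exists (lam (repl om (app F)) j). split.
  - apply funE, lam_fun; [dfn|]. intros x hx. now apply Hj.
  - intros x x' y h h'. apply relE, in_lam in h, h'; [|dfn|dfn]. destruct h as [h ->], h' as [h' e].
    rewrite <- (proj2 (Hj x h)), <- (proj2 (Hj x' h')). now rewrite e.
Qed.

(* [Phi a t] is a demand with hereditarily finite label [a] and finitely many
   parameters [t]; the n-th member of the hull answers the demand whose label and
   parameter indices have code [n].  Codes increase along membership, so that the
   parameters have been chosen before. *)
Lemma countable_hull (A a0 : V) (Phi : V -> V -> V -> Prop) : DepChoice (V := V) -> Def3 Phi -> a0 ∊ A ->
  exists m, Countable m /\ Sub m A /\ (exists x, x ∊ m) /\ forall a n t, hf a -> n ∊ om -> Fun t n m ->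
    (exists z, z ∊ A /\ Phi a t z) -> exists z, z ∊ m /\ Phi a t z.
Proof.
  intros dc D h0.
  (* Stage [k] is bound only by the demand with code [k], which is unique by injectivity of the
     coding, and only if that demand has an answer in [A]. *)
  pose (Psi := fun k f y => forall a s n, hf a -> n ∊ om -> Fun s n k -> code (opair a s) = k ->
    (exists z, z ∊ A /\ Phi a (compose f s n) z) -> Phi a (compose f s n) y).
  destruct (dependent_sequence A Psi dc) as (F & FF & HF).
  - intros. unfold Psi. dfn.
  - intros k f hk Ff.
    destruct (classic (exists a s n, hf a /\ n ∊ om /\ Fun s n k /\ code (opair a s) = k /\
      exists z, z ∊ A /\ Phi a (compose f s n) z)) as [(a & s & n & h1 & h2 & h3 & h4 & z & hz & hP)|N].
    + exists z. split; auto. intros a' s' n' h1' h2' h3' h4' _.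
      assert (L : forall y, y ∊ k -> hf y) by (intros y hy; apply hf_nat, (om_trans k); auto).
      assert (e : opair a s = opair a' s').
      { apply code_inj; [| |congruence]; apply hf_opair; auto; [apply (hf_fun n s k)|apply (hf_fun n' s' k)]; auto. }
      apply opair_inj in e. destruct e; subst a' s'. now rewrite (fun_dom_unique _ _ _ _ _ h3' h3).
    + exists a0. split; auto. intros a s n h1 h2 h3 h4 h5. exfalso. apply N. eauto 10.
  - exists (repl om (app F)). split; [eapply countable_image; eauto|]. split; [|split].
    + intros x hx. apply in_repl in hx; [|dfn]. destruct hx as (n & hn & ->). eapply app_cod; eauto.
    + exists (app F emp). apply in_repl; [dfn|]. exists emp. auto using in_om0.
    + intros a n t ha hn Ft Ht.
      (* The parameters are replaced by their least indices in the enumeration, which yields a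
         hereditarily finite sequence. *)
      pose (s := lam n (fun i => least (fun k => app F k = app t i))).
      assert (K : forall i, i ∊ n -> app s i ∊ om /\ app F (app s i) = app t i).
      { intros i hi. unfold s. rewrite app_lam by (dfn || auto).
        destruct (leastP (fun k => app F k = app t i)) as (h1 & h2 & _); [dfn| |auto].
        assert (h : app t i ∊ repl om (app F)) by (eapply app_cod; eauto).
        apply in_repl in h; [|dfn]. destruct h as (k & hk & e). eauto. }
      assert (Fs0 : Fun s n om).
      { apply lam_fun; [dfn|]. intros i hi. generalize (proj1 (K i hi)). unfold s.
        now rewrite app_lam by (dfn || auto). }
      assert (hs : hf s) by (eapply hf_fun; eauto using hf_nat).
      pose (k := code (opair a s)).
      assert (hk : k ∊ om) by now apply code_om, hf_opair.
      (* Each index lies in the transitive closure of the pair coded by [k]. Following the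
         membership steps through the two ordered pairs puts its code below [k], and the index is at
         most its code. *)
      assert (Ks : forall i, i ∊ n -> app s i ∊ k).
      { intros i hi. destruct (K i hi) as [h _]. pose proof (code_nat _ h) as h'.
        assert (P1 : hf (opair a s)) by now apply hf_opair.
        assert (P2 : hf (upair a s)) by now apply hf_upair.
        assert (P3 : hf (opair i (app s i))).
        { apply (hf_in s); auto. eapply app_in; eauto. }
        assert (P4 : upair i (app s i) ∊ opair i (app s i)) by (apply in_upair; auto).
        assert (P5 : hf (upair i (app s i))) by now apply (hf_in _ _ P3).
        assert (Q1 : code (upair a s) ∊ k) by (apply code_mono; auto; apply in_upair; auto).
        assert (Q2 : code s ∊ k).
        { apply (nat_trans k hk _ Q1), code_mono; auto. apply in_upair; auto. }
        assert (Q3 : code (opair i (app s i)) ∊ k).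
        { apply (nat_trans k hk _ Q2), code_mono; auto. eapply app_in; eauto. }
        assert (Q4 : code (upair i (app s i)) ∊ k).
        { apply (nat_trans k hk _ Q3), code_mono; auto. }
        assert (Q5 : code (app s i) ∊ k).
        { apply (nat_trans k hk _ Q4), code_mono; auto. apply in_upair; auto. }
        apply in_succ in h'. destruct h' as [h'|e]; [|congruence]. now apply (nat_trans k hk _ Q5). }
      assert (Fs : Fun s n k).
      { replace s with (lam n (app s)); [apply lam_fun; auto; dfn|].
        apply (fun_ext _ _ n om om); auto; [apply lam_fun; [dfn|]; intros i hi; now apply K|].
        intros i hi. now rewrite app_lam by (dfn || auto). }
      assert (e : compose (restrict F k) s n = t).
      { apply (fun_ext _ _ n (repl om (app F)) (repl om (app F))); auto.
        - apply lam_fun; [dfn|]. intros i hi. replace (app (restrict F k) (app s i)) with (app F (app s i)).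
          + apply in_repl; [dfn|]. exists (app s i). split; auto. now apply K.
          + symmetry. apply theP.
            * apply in_restrict; auto. split; auto. eapply app_in; eauto. now apply K.
            * intros y hy. apply in_restrict in hy; auto. symmetry. eapply appE; eauto. tauto.
        - intros i hi. unfold compose. rewrite app_lam by (dfn || auto). rewrite <- (proj2 (K i hi)).
          apply theP.
          + apply in_restrict; auto. split; auto. eapply app_in; eauto. now apply K.
          + intros y hy. apply in_restrict in hy; auto. symmetry. eapply appE; eauto. tauto. }
      exists (app F k). split; [apply in_repl; [dfn|eauto]|].
      rewrite <- e. apply (HF k hk); auto. now rewrite e.
Qed.
End Sequences.
#[global] Hint Resolve dterm_code dfn_hf : dfn.

(** * Satisfaction inside the model and countable elementary submodels *)

Section Satisfaction.
Context {V : Type} {E : MemRel V} {H : ZF E}.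

Fixpoint num (n : nat) : V := match n with 0 => emp | S m => succ (num m) end.
Definition tag (n : nat) (x : V) : V := opair (num n) x.
Lemma num_om n : num n ∊ om. Proof. induction n; simpl; auto using in_om0, in_omS. Qed.
Lemma num_lt n m : n < m -> num n ∊ num m.
Proof.
  intros h. induction h; simpl; apply in_succ; auto.
Qed.
Lemma tag_inj n m x y : tag n x = tag m y -> n = m /\ x = y.
Proof.
  intros e. apply opair_inj in e. destruct e as [e ->]. split; auto.
  destruct (lt_eq_lt_dec n m) as [[h| ]|h]; auto; apply num_lt in h; rewrite e in h; exfalso;
    now apply (nat_irrefl (num m)) in h; auto using num_om.
Qed.
Lemma dterm_tag k n (a : ctx n -> V) : dterm n a -> dterm n (fun g => tag k (a g)).
Proof. intros. unfold tag. dfn. Qed.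
Hint Resolve dterm_tag : dfn.
Lemma isnumE n x : IsNum n x <-> x = num n.
Proof.
  revert x. induction n; intros x; simpl; [apply empE|]. split.
  - intros (y & hy & hx). apply IHn in hy. apply succE in hx. now subst.
  - intros ->. exists (num n). rewrite IHn, succE. auto.
Qed.
Lemma code1E n z x : Code1 n z x <-> z = tag n x.
Proof.
  unfold Code1. split.
  - intros (t & h & h'). apply isnumE in h. apply pairE in h'. now subst.
  - intros ->. exists (num n). rewrite isnumE, pairE. auto.
Qed.
Lemma code2E n z x y : Code2 n z x y <-> z = tag n (opair x y).
Proof.
  unfold Code2. split.
  - intros (t & h & h'). apply isnumE in h. apply tripleE in h'. now subst.
  - intros ->. exists (num n). rewrite isnumE, tripleE. auto.
Qed.

Definition closed_codes (x : V) :=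
  (forall i j, i ∊ om -> j ∊ om -> tag 0 (opair i j) ∊ x) /\
  (forall i j, i ∊ om -> j ∊ om -> tag 1 (opair i j) ∊ x) /\
  (forall a, a ∊ x -> tag 2 a ∊ x) /\
  (forall a b, a ∊ x -> b ∊ x -> tag 3 (opair a b) ∊ x) /\
  (forall i a, i ∊ om -> a ∊ x -> tag 4 (opair i a) ∊ x).
Lemma codeclosedE x : CodeClosed om x <-> closed_codes x.
Proof.
  unfold CodeClosed, closed_codes. split; intros (h1 & h2 & h3 & h4 & h5); repeat split.
  - intros i j hi hj. apply (h1 i hi j hj). now apply code2E.
  - intros i j hi hj. apply (h2 i hi j hj). now apply code2E.
  - intros a ha. apply (h3 a ha). now apply code1E.
  - intros a b ha hb. apply (h4 a ha b hb). now apply code2E.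
  - intros i a hi ha. apply (h5 i hi a ha). now apply code2E.
  - intros i hi j hj z hz. apply code2E in hz. subst. auto.
  - intros i hi j hj z hz. apply code2E in hz. subst. auto.
  - intros a ha z hz. apply code1E in hz. subst. auto.
  - intros a ha b hb z hz. apply code2E in hz. subst. auto.
  - intros i hi a ha z hz. apply code2E in hz. subst. auto.
Qed.
Definition formula (a : V) := forall x, closed_codes x -> a ∊ x.
Lemma formulaE a : IsFormula om a <-> formula a.
Proof. unfold IsFormula, formula. split; intros h x hx; apply h; now apply codeclosedE. Qed.
Lemma dfn_closed_codes : Def1 closed_codes. Proof. defining closed_codes. Qed.
Hint Resolve dfn_closed_codes : dfn.
Lemma dfn_formula : Def1 formula. Proof. defining formula. Qed.
Hint Resolve dfn_formula : dfn.

Lemma formula_mem i j : i ∊ om -> j ∊ om -> formula (tag 0 (opair i j)).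
Proof. intros hi hj x hx. now apply hx. Qed.
Lemma formula_eq i j : i ∊ om -> j ∊ om -> formula (tag 1 (opair i j)).
Proof. intros hi hj x hx. now apply hx. Qed.
Lemma formula_neg a : formula a -> formula (tag 2 a).
Proof. intros ha x hx. apply hx. now apply ha. Qed.
Lemma formula_and a b : formula a -> formula b -> formula (tag 3 (opair a b)).
Proof. intros ha hb x hx. apply hx; [now apply ha|now apply hb]. Qed.
Lemma formula_ex i a : i ∊ om -> formula a -> formula (tag 4 (opair i a)).
Proof. intros hi ha x hx. apply hx; [|apply ha]; auto. Qed.

(** V_ω is obtained by decoding all natural numbers. It serves as the ambient set from which sets of
    formulas are separated. *)
Lemma hf_set_ex : exists X, forall x, x ∊ X <-> hf x.
Proof.
  exists (sep (repl om (fun n => the (fun x => hf x /\ code x = n))) hf). intros x. rewrite in_sep by dfn.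
  split; [tauto|]. intros hx. split; auto. apply in_repl; [dfn|]. exists (code x).
  split; [now apply code_om|]. symmetry. apply theP; auto. intros y [hy e]. now apply code_inj.
Qed.
Lemma hf_tag n x : hf x -> hf (tag n x).
Proof. intros. apply hf_opair; auto. apply hf_nat, num_om. Qed.

(** A formula belongs to every closed set of codes, so it suffices that the formulas in V_ω
    satisfying [P] form a closed set. *)
Lemma formula_ind (P : V -> Prop) : defn 1 (fun g => P (hd g)) ->
  (forall i j, i ∊ om -> j ∊ om -> P (tag 0 (opair i j))) ->
  (forall i j, i ∊ om -> j ∊ om -> P (tag 1 (opair i j))) ->
  (forall a, formula a -> P a -> P (tag 2 a)) ->
  (forall a b, formula a -> formula b -> P a -> P b -> P (tag 3 (opair a b))) ->
  (forall i a, i ∊ om -> formula a -> P a -> P (tag 4 (opair i a))) ->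
  forall a, formula a -> P a.
Proof.
  intros D h1 h2 h3 h4 h5 a ha. destruct hf_set_ex as [X HX].
  assert (K : forall z, z ∊ sep X (fun a => formula a /\ P a) <-> hf z /\ formula z /\ P z).
  { intros z. rewrite in_sep, HX by dfn. tauto. }
  apply (proj1 (K a)). apply ha. repeat split; intros; rewrite K in *.
  - auto 10 using hf_tag, hf_opair, hf_nat, formula_mem.
  - auto 10 using hf_tag, hf_opair, hf_nat, formula_eq.
  - destruct H0 as (? & ? & ?). auto using hf_tag, formula_neg.
  - destruct H0 as (? & ? & ?), H1 as (? & ? & ?). auto 10 using hf_tag, hf_opair, formula_and.
  - destruct H1 as (? & ? & ?). auto 10 using hf_tag, hf_opair, hf_nat, formula_ex.
Qed.
Lemma formula_hf a : formula a -> hf a.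
Proof.
  revert a. apply formula_ind; [dfn|..]; auto 10 using hf_tag, hf_opair, hf_nat.
Qed.

Definition update (e i u : V) : V := lam om (fun j => the (fun y => j = i /\ y = u \/ j <> i /\ y = app e j)).
Lemma dterm_update n a b c : dterm n a -> dterm n b -> dterm n c -> dterm n (fun g => update (a g) (b g) (c g)).
Proof. intros. unfold update, lam. dfn. Qed.
Hint Resolve dterm_update : dfn.
Lemma app_update e i u j : j ∊ om -> (j = i -> app (update e i u) j = u) /\ (j <> i -> app (update e i u) j = app e j).
Proof.
  intros hj. unfold update. rewrite app_lam by (dfn || auto). split; intros K; apply theP; auto; intros y [[]|[]]; auto; tauto.
Qed.
Lemma update_fun m e i u : Fun e om m -> u ∊ m -> Fun (update e i u) om m.
Proof.
  intros F hu. apply lam_fun; [dfn|]. intros j hj. destruct (app_update e i u j hj) as [K1 K2].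
  unfold update in K1, K2. rewrite app_lam in K1, K2 by (dfn || auto).
  destruct (classic (j = i)) as [h|h]; [rewrite K1|rewrite K2]; auto. eapply app_cod; eauto.
Qed.
Lemma updE m e' e i u : Fun e om m -> i ∊ om -> u ∊ m -> IsUpd om m e' e i u <-> e' = update e i u.
Proof.
  intros F hi hu. unfold IsUpd. rewrite funE, relE. split.
  - intros (F' & K & L). apply (fun_ext _ _ om m m); auto using update_fun. intros j hj.
    destruct (app_update e i u j hj) as [K1 K2]. destruct (classic (j = i)) as [->|h].
    + rewrite K1 by auto. eapply appE; eauto.
    + rewrite K2 by auto. eapply appE; [exact F'|]. apply relE, L; auto. apply relE. eapply app_in; eauto.
  - intros ->. assert (F' := update_fun m e i u F hu). split; auto. split.
    + pose proof (app_in _ _ _ i F' hi) as K. now rewrite (proj1 (app_update e i u i hi) eq_refl) in K.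
    + intros j hj N x. rewrite !relE. destruct (app_update e i u j hj) as [_ K]. specialize (K N). split; intros h.
      * rewrite <- (appE _ _ _ _ _ F' h), K. eapply app_in; eauto.
      * rewrite <- (appE _ _ _ _ _ F h), <- K. eapply app_in; eauto.
Qed.

(** Subformulas lie in the transitive closure of a code, so satisfaction is defined by recursion
    along membership; [h] assigns to a subformula the set of assignments that satisfy it. *)
Definition sat_clause (m a h e : V) :=
  (exists i j, a = tag 0 (opair i j) /\ app e i ∊ app e j) \/
  (exists i j, a = tag 1 (opair i j) /\ app e i = app e j) \/
  (exists b, a = tag 2 b /\ ~ e ∊ app h b) \/
  (exists b c, a = tag 3 (opair b c) /\ e ∊ app h b /\ e ∊ app h c) \/
  (exists i b, a = tag 4 (opair i b) /\ exists u, u ∊ m /\ update e i u ∊ app h b).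
Lemma dfn_sat_clause : Def4 sat_clause. Proof. defining sat_clause. Qed.
Hint Resolve dfn_sat_clause : dfn.

Section Structure.
Variable m : V.
Definition assignments : V := sep (pow (prod om m)) (fun e => Fun e om m).
Lemma in_assignments e : e ∊ assignments <-> Fun e om m.
Proof.
  unfold assignments. rewrite in_sep by dfn. split; [tauto|]. intros F. split; auto. apply in_pow.
  intros z hz. destruct (proj1 F z hz) as (x & y & hx & hy & ->). now apply opair_in_prod.
Qed.
Definition sat_set : V -> V := mrec (fun a h => sep assignments (sat_clause m a h)).
Lemma dterm_sat_set : DefF1 sat_set. Proof. defining sat_set. Qed.
Hint Resolve dterm_sat_set : dfn.
Lemma in_sat_set a e : e ∊ sat_set a <-> Fun e om m /\ sat_clause m a (lam (tcl a) sat_set) e.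
Proof. unfold sat_set at 1. rewrite mrecE, in_sep, in_assignments by dfn. reflexivity. Qed.

Lemma opair_tcl x y : x ∊ tcl (opair x y) /\ y ∊ tcl (opair x y).
Proof.
  assert (h : upair x y ∊ tcl (opair x y)) by (apply tcl_sub, in_upair; auto).
  split; apply (tcl_trans _ _ _ h), in_upair; auto.
Qed.
Lemma tag_tcl n x y : y ∊ tcl x \/ y = x -> y ∊ tcl (tag n x).
Proof.
  intros h. destruct (opair_tcl (num n) x) as [_ K]. destruct h as [h| ->]; auto.
  now apply (tcl_mono _ _ K).
Qed.

Ltac uncode := repeat match goal with
  | h : tag _ _ = tag _ _ |- _ => apply tag_inj in h; destruct h as [? ?]; try discriminate
  | h : opair _ _ = opair _ _ |- _ => apply opair_inj in h; destruct h as [? ?]; subst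
  end.

Lemma sat_mem i j e : Fun e om m -> e ∊ sat_set (tag 0 (opair i j)) <-> app e i ∊ app e j.
Proof.
  intros F. rewrite in_sat_set. unfold sat_clause. split; [|eauto 10].
  intros [_ [(i' & j' & h & K)|[(i' & j' & h & K)|[(b & h & K)|[(b & c & h & K)|(i' & b & h & K)]]]]]; uncode; auto.
Qed.
Lemma sat_eq i j e : Fun e om m -> e ∊ sat_set (tag 1 (opair i j)) <-> app e i = app e j.
Proof.
  intros F. rewrite in_sat_set. unfold sat_clause. split; [|eauto 10].
  intros [_ [(i' & j' & h & K)|[(i' & j' & h & K)|[(b & h & K)|[(b & c & h & K)|(i' & b & h & K)]]]]]; uncode; auto.
Qed.
Lemma sat_neg a e : Fun e om m -> e ∊ sat_set (tag 2 a) <-> ~ e ∊ sat_set a.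
Proof.
  intros F. rewrite in_sat_set. unfold sat_clause.
  assert (A : app (lam (tcl (tag 2 a)) sat_set) a = sat_set a) by (apply app_lam; [dfn|]; apply tag_tcl; auto).
  split.
  - intros [_ [(i' & j' & h & K)|[(i' & j' & h & K)|[(b & h & K)|[(b & c & h & K)|(i' & b & h & K)]]]]]; uncode; auto.
    subst b. now rewrite A in K.
  - intros K. split; auto. right; right; left. exists a. now rewrite A.
Qed.
Lemma sat_and a b e : Fun e om m -> e ∊ sat_set (tag 3 (opair a b)) <-> e ∊ sat_set a /\ e ∊ sat_set b.
Proof.
  intros F. rewrite in_sat_set. unfold sat_clause. destruct (opair_tcl a b).
  assert (A : app (lam (tcl (tag 3 (opair a b))) sat_set) a = sat_set a) by (apply app_lam; [dfn|]; apply tag_tcl; auto).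
  assert (B : app (lam (tcl (tag 3 (opair a b))) sat_set) b = sat_set b) by (apply app_lam; [dfn|]; apply tag_tcl; auto).
  split.
  - intros [_ [(i' & j' & h & K)|[(i' & j' & h & K)|[(c & h & K)|[(c & d & h & K)|(i' & c & h & K)]]]]]; uncode; auto.
    now rewrite A, B in K.
  - intros K. split; auto. right; right; right; left. exists a, b. now rewrite A, B.
Qed.
Lemma sat_ex i a e : Fun e om m ->
  e ∊ sat_set (tag 4 (opair i a)) <-> exists u, u ∊ m /\ update e i u ∊ sat_set a.
Proof.
  intros F. rewrite in_sat_set. unfold sat_clause. destruct (opair_tcl i a).
  assert (A : app (lam (tcl (tag 4 (opair i a))) sat_set) a = sat_set a) by (apply app_lam; [dfn|]; apply tag_tcl; auto).
  split.
  - intros [_ [(i' & j' & h & K)|[(i' & j' & h & K)|[(c & h & K)|[(c & d & h & K)|(i' & c & h & K)]]]]]; uncode; auto.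
    now rewrite A in K.
  - intros K. split; auto. right; right; right; right. exists i, a. now rewrite A.
Qed.

(** The statement quantifies over satisfaction relations. By induction on formulas each of them
    agrees with [sat_set], and the graph of [sat_set] over V_ω is itself such a relation. *)
Lemma satisfiesE a e : formula a -> Fun e om m -> Satisfies om m a e <-> e ∊ sat_set a.
Proof.
  assert (U : forall s, Tarski om m s -> forall a, formula a -> forall e, Fun e om m -> Rel s a e <-> e ∊ sat_set a).
  { intros s T. apply (formula_ind (fun a => forall e, Fun e om m -> Rel s a e <-> e ∊ sat_set a)); [dfn|..].
    - intros i j hi hj f F. rewrite sat_mem by auto.
      destruct (T f) as (T1 & _); [now apply funE|].
      rewrite (T1 i hi j hj) by now apply code2E. setoid_rewrite relE. split.
      + intros (x & y & hx & hy & h). now rewrite (appE _ _ _ _ _ F hx), (appE _ _ _ _ _ F hy).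
      + intros h. exists (app f i), (app f j). split; [|split; auto]; eapply app_in; eauto.
    - intros i j hi hj f F. rewrite sat_eq by auto.
      destruct (T f) as (_ & T1 & _); [now apply funE|].
      rewrite (T1 i hi j hj) by now apply code2E. setoid_rewrite relE. split.
      + intros (x & y & hx & hy & h). now rewrite (appE _ _ _ _ _ F hx), (appE _ _ _ _ _ F hy).
      + intros h. exists (app f i), (app f j). split; [|split; auto]; eapply app_in; eauto.
    - intros b hb IH f F. rewrite sat_neg, <- IH by auto.
      destruct (T f) as (_ & _ & T1 & _); [now apply funE|].
      apply T1; [now apply formulaE|now apply code1E].
    - intros b c hb hc IHb IHc f F. rewrite sat_and, <- IHb, <- IHc by auto.
      destruct (T f) as (_ & _ & _ & T1 & _); [now apply funE|].
      apply T1; [now apply formulaE|now apply formulaE|now apply code2E].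
    - intros i b hi hb IH f F. rewrite sat_ex by auto.
      destruct (T f) as (_ & _ & _ & _ & T1); [now apply funE|].
      rewrite (T1 i hi b) by (now apply formulaE || now apply code2E). split.
      + intros (u & hu & e' & he & h). exists u. split; auto. apply updE in he; auto. subst.
        apply IH; auto using update_fun.
      + intros (u & hu & h). exists u. split; auto. exists (update f i u). split; [now apply updE|].
        apply IH; auto using update_fun. }
  intros ha F. split.
  - intros (s & T & K). now apply (U s).
  - intros K. destruct hf_set_ex as [X HX].
    pose (s := sep (prod X assignments) (fun z => exists b f, z = opair b f /\ formula b /\ f ∊ sat_set b)).
    assert (Hs : forall b f, Rel s b f <-> formula b /\ f ∊ sat_set b).
    { intros b f. rewrite relE. unfold s. rewrite in_sep, opair_in_prod, HX, in_assignments by dfn. split.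
      - intros [_ (b' & f' & e' & h)]. apply opair_inj in e'. destruct e'; now subst.
      - intros [hb hf']. split; [split|]; eauto using formula_hf. now apply in_sat_set in hf'. }
    exists s. split; [|now apply Hs].
    intros f Ff. apply funE in Ff. repeat split.
    + intros h. apply code2E in H2. subst. apply Hs in h. exists (app f i), (app f j).
      rewrite !relE. split; [|split]; try (eapply app_in; eauto). apply sat_mem; tauto.
    + intros (x & y & hx & hy & h). apply code2E in H2. subst. rewrite relE in hx, hy. apply Hs.
      split; [now apply formula_mem|]. apply sat_mem; auto.
      now rewrite (appE _ _ _ _ _ Ff hx), (appE _ _ _ _ _ Ff hy).
    + intros h. apply code2E in H2. subst. apply Hs in h. exists (app f i), (app f j).
      rewrite !relE. split; [|split]; try (eapply app_in; eauto). apply sat_eq; tauto.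
    + intros (x & y & hx & hy & h). apply code2E in H2. subst. rewrite relE in hx, hy. apply Hs.
      split; [now apply formula_eq|]. apply sat_eq; auto.
      now rewrite (appE _ _ _ _ _ Ff hx), (appE _ _ _ _ _ Ff hy).
    + intros h h'. apply code1E in H1. subst. apply Hs in h, h'. destruct h as [_ h]. apply sat_neg in h; tauto.
    + intros h. apply code1E in H1. subst. apply formulaE in H0. apply Hs. split; [now apply formula_neg|].
      apply sat_neg; auto. intros h'. apply h, Hs. auto.
    + apply code2E in H2. subst. apply formulaE in H0, H1. apply Hs in H3. apply Hs. split; auto.
      destruct H3 as [_ h]. apply sat_and in h; tauto.
    + apply code2E in H2. subst. apply formulaE in H0, H1. apply Hs in H3. apply Hs. split; auto.
      destruct H3 as [_ h]. apply sat_and in h; tauto.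
    + intros [h h']. apply code2E in H2. subst. apply Hs in h, h'. apply Hs.
      split; [apply formula_and; tauto|]. apply sat_and; tauto.
    + intros h. apply code2E in H2. subst. apply formulaE in H1. apply Hs in h. destruct h as [_ h].
      apply sat_ex in h; auto. destruct h as (u & hu & h). exists u. split; auto. exists (update f i u).
      rewrite updE, Hs by auto. auto.
    + intros (u & hu & e' & he & h). apply code2E in H2. subst. apply formulaE in H1. apply updE in he; auto.
      subst. apply Hs in h. apply Hs. split; [now apply formula_ex|]. apply sat_ex; auto. exists u. tauto.
Qed.

(** Assignments are infinite sequences, whereas a demand on the hull has finitely many parameters;
    this lemma mediates between the two. *)
Lemma finite_support a : formula a -> exists n, n ∊ om /\ forall e e', Fun e om m -> Fun e' om m ->
  (forall i, i ∊ n -> app e i = app e' i) -> e ∊ sat_set a <-> e' ∊ sat_set a.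
Proof.
  revert a.
  assert (two : forall i j, i ∊ om -> j ∊ om -> exists n, n ∊ om /\ Sub i n /\ Sub j n).
  { intros i j hi hj. destruct (nat_total i j hi hj) as [h|[->|h]].
    - exists j. split; auto. split; [exact (nat_trans j hj i h)|intros z; auto].
    - exists j. split; auto. split; intros z; auto.
    - exists i. split; auto. split; [intros z; auto|exact (nat_trans i hi j h)]. }
  apply (formula_ind (fun a => exists n, n ∊ om /\ forall e e', Fun e om m -> Fun e' om m ->
    (forall i, i ∊ n -> app e i = app e' i) -> e ∊ sat_set a <-> e' ∊ sat_set a)); [dfn|..].
  - intros i j hi hj. destruct (two (succ i) (succ j)) as (n & hn & h1 & h2); auto using in_omS.
    exists n. split; auto. intros e e' F F' K. rewrite !sat_mem, (K i), (K j); auto; [reflexivity|apply h2|apply h1]; apply in_succ; auto.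
  - intros i j hi hj. destruct (two (succ i) (succ j)) as (n & hn & h1 & h2); auto using in_omS.
    exists n. split; auto. intros e e' F F' K. rewrite !sat_eq, (K i), (K j); auto; [reflexivity|apply h2|apply h1]; apply in_succ; auto.
  - intros a ha (n & hn & IH). exists n. split; auto. intros e e' F F' K. rewrite !sat_neg, (IH e e') by auto. reflexivity.
  - intros a b ha hb (i & hi & IHa) (j & hj & IHb). destruct (two i j hi hj) as (n & hn & h1 & h2).
    exists n. split; auto. intros e e' F F' K. rewrite !sat_and, (IHa e e'), (IHb e e') by auto. reflexivity.
  - intros i a hi ha (n & hn & IH). exists n. split; auto. intros e e' F F' K. rewrite !sat_ex by auto.
    assert (L : forall u, u ∊ m -> update e i u ∊ sat_set a <-> update e' i u ∊ sat_set a).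
    { intros u hu. apply IH; auto using update_fun. intros j hj.
      assert (hj' : j ∊ om) by now apply (om_trans n).
      destruct (app_update e i u j hj') as [A B], (app_update e' i u j hj') as [A' B'].
      destruct (classic (j = i)) as [h|h]; [now rewrite A, A'|rewrite B, B'; auto]. }
    split; intros (u & hu & h); exists u; split; auto; [exact (proj1 (L u hu) h)|exact (proj2 (L u hu) h)].
Qed.
End Structure.
Hint Resolve dterm_sat_set : dfn.

Lemma tarski_vaught m h : Sub m h ->
  (forall i a e, i ∊ om -> formula a -> Fun e om m -> (exists u, u ∊ h /\ update e i u ∊ sat_set h a) ->
    exists u, u ∊ m /\ update e i u ∊ sat_set h a) ->
  forall a, formula a -> forall e, Fun e om m -> e ∊ sat_set m a <-> e ∊ sat_set h a.
Proof.
  intros S K.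
  assert (up : forall e, Fun e om m -> Fun e om h).
  { intros e. now apply fun_weaken. }
  apply (formula_ind (fun a => forall e, Fun e om m -> e ∊ sat_set m a <-> e ∊ sat_set h a)); [dfn|..].
  - intros i j hi hj e F. rewrite !sat_mem by auto. reflexivity.
  - intros i j hi hj e F. rewrite !sat_eq by auto. reflexivity.
  - intros a ha IH e F. rewrite !sat_neg, IH by auto. reflexivity.
  - intros a b ha hb IHa IHb e F. rewrite !sat_and, IHa, IHb by auto. reflexivity.
  - intros i a hi ha IH e F. rewrite !sat_ex by auto. split.
    + intros (u & hu & hs). exists u. split; auto. apply IH; auto using update_fun.
    + intros hs. apply K in hs; auto. destruct hs as (u & hu & hs). exists u. split; auto.
      apply IH; auto using update_fun.
Qed.

(** The hull answers three kinds of demands, told apart by the tags of their labels: tag 4, the tag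
    of existential formulas, for the witnesses of the Tarski-Vaught test, tag 5 for the demands
    [Phi], and tag 6 for the element [p] itself. *)
Lemma countable_elementary (h p : V) (Phi : V -> V -> V -> Prop) : DepChoice (V := V) -> Def3 Phi -> p ∊ h ->
  exists m, Countable m /\ Elementary m h p /\ forall k n t, k ∊ om -> n ∊ om -> Fun t n m ->
    (exists z, z ∊ h /\ Phi k t z) -> exists z, z ∊ m /\ Phi k t z.
Proof.
  intros dc D hp.
  (* A finite tuple becomes an assignment with the default value [p]. *)
  pose (ext := fun t => lam om (fun j => the (fun y => opair j y ∊ t \/ (~ exists y', opair j y' ∊ t) /\ y = p))).
  assert (Dext : DefF1 ext) by (intros; unfold ext, lam; dfn).
  pose (Psi := fun a t z => (exists i b, a = tag 4 (opair i b) /\ update (ext t) i z ∊ sat_set h b) \/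
    (exists k, a = tag 5 k /\ Phi k t z) \/ (a = tag 6 emp /\ z = p)).
  destruct (countable_hull h p Psi dc) as (m & Cm & Sm & [x0 hx0] & Hm); [intros; unfold Psi; dfn|auto|].
  pose proof (fun_emp m) as Em.
  assert (hpm : p ∊ m).
  { destruct (Hm (tag 6 emp) emp emp) as (z & hz & [(i & b & e & _)|[(k & e & _)|[_ ->]]]);
      auto using hf_tag, hf_emp, in_om0; try (apply tag_inj in e; destruct e; discriminate).
    exists p. split; auto. right; right; auto. }
  exists m. split; auto. split.
  - split; auto. split; auto. intros w hw a ha e he. apply isomegaE in hw. subst w.
    apply formulaE in ha. apply funE in he. assert (he' : Fun e om h).
    { now apply fun_weaken with m. }
    rewrite !satisfiesE by auto. apply tarski_vaught; auto. clear a ha e he he'.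
    intros i a e hi ha F (u & hu & K).
    destruct (finite_support h a ha) as (n & hn & S).
    pose (t := restrict e n).
    assert (Ht : forall x y, opair x y ∊ t <-> opair x y ∊ e /\ x ∊ n).
    { intros x y. apply in_restrict. }
    assert (Ft : Fun t n m).
    { split; [|split].
      - intros z hz. unfold t, restrict in hz. apply in_sep in hz; [|dfn]. destruct hz as (hz & y & v & hy & ->).
        exists y, v. split; auto. split; auto. eapply fun_cod; eauto.
      - intros x hx. exists (app e x). apply Ht. split; auto. eapply app_in; eauto. now apply (om_trans n).
      - intros x y y' h1 h2. apply Ht in h1, h2. eapply (proj2 (proj2 F)); [apply h1|apply h2]. }
    assert (L : forall v, v ∊ h -> update (ext t) i v ∊ sat_set h a <-> update e i v ∊ sat_set h a).
    { intros v hv.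
      assert (Fe : Fun e om h).
      { now apply fun_weaken with m. }
      assert (Ee : forall j, j ∊ om -> app (ext t) j ∊ h /\ (j ∊ n -> app (ext t) j = app e j)).
      { intros j hj. unfold ext. rewrite app_lam by (dfn || auto).
        destruct (classic (j ∊ n)) as [hjn|hjn].
        - rewrite theP with (y := app e j).
          + split; auto. eapply app_cod; eauto.
          + left. apply Ht. split; auto. eapply app_in; eauto.
          + intros y [hy|[N _]].
            * apply Ht in hy. symmetry. eapply appE; [exact F|tauto].
            * exfalso. apply N. exists (app e j). apply Ht. split; auto. eapply app_in; eauto.
        - rewrite theP with (y := p); auto.
          + tauto.
          + right. split; auto. intros [y hy]. apply Ht in hy. tauto.
          + intros y [hy|[_ hy]]; auto. apply Ht in hy. tauto. }
      assert (Fx : Fun (ext t) om h).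
      { apply lam_fun; [dfn|]. intros j hj. generalize (proj1 (Ee j hj)). unfold ext. now rewrite app_lam by (dfn || auto). }
      apply S; auto using update_fun. intros j hj. assert (hj' : j ∊ om) by now apply (om_trans n).
      destruct (app_update e i v j hj') as [A B], (app_update (ext t) i v j hj') as [A' B'].
      destruct (classic (j = i)) as [k|k]; [now rewrite A, A'|rewrite B, B'; auto]. now apply Ee. }
    destruct (Hm (tag 4 (opair i a)) n t) as (z & hz & [(i' & b & e' & h')|[(k & e' & _)|[e' _]]]); auto.
    + auto using hf_tag, hf_opair, hf_nat, formula_hf.
    + exists u. split; auto. left. exists i, a. split; auto. now apply L.
    + apply tag_inj in e'. destruct e' as [_ e']. apply opair_inj in e'. destruct e'; subst.
      exists z. split; auto. exact (proj1 (L z (Sm z hz)) h').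
    + apply tag_inj in e'. destruct e'; discriminate.
    + apply tag_inj in e'. destruct e'; discriminate.
  - intros k n t hk hn Ft (z & hz & K).
    destruct (Hm (tag 5 k) n t) as (z' & hz' & [(i' & b & e' & h')|[(k' & e' & h')|[e' _]]]); auto.
    + auto using hf_tag, hf_nat.
    + exists z. split; auto. right; left. eauto.
    + apply tag_inj in e'. destruct e'; discriminate.
    + apply tag_inj in e'. destruct e' as [_ ->]. eauto.
    + apply tag_inj in e'. destruct e'; discriminate.
Qed.
End Satisfaction.

(** * The forcing relation *)

Section Forcing.
Context {V : Type} {E : MemRel V} {H : ZF E}.
Variables C R : V.
Hypothesis poset : Poset C R.

Lemma le_dom p q : Rel R p q -> p ∊ C /\ q ∊ C.
Proof.
  intros h. destruct poset as (K & _). apply relE in h. destruct (K _ h) as (x & hx & y & hy & e).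
  apply pairE, opair_inj in e. destruct e; now subst.
Qed.
Lemma le_refl p : p ∊ C -> Rel R p p. Proof. apply poset. Qed.
Lemma le_trans p q s : Rel R p q -> Rel R q s -> Rel R p s.
Proof.
  intros h h'. destruct (le_dom _ _ h), (le_dom _ _ h'). destruct poset as (_ & _ & _ & K). eauto.
Qed.

Lemma denseBelow_mono p q (P : V -> Prop) : Rel R q p -> DenseBelow C R p P -> DenseBelow C R q P.
Proof. intros h D s hs hsq. apply D; eauto using le_trans. Qed.
Lemma denseBelow_dense p (P : V -> Prop) :
  DenseBelow C R p (fun q => DenseBelow C R q P) -> DenseBelow C R p P.
Proof.
  intros D q hq hqp. destruct (D q hq hqp) as (s & hs & hsq & K).
  destruct (K s hs (le_refl _ hs)) as (t & ht & hts & hP). exists t. split; auto. split; eauto using le_trans.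
Qed.
Lemma denseBelow_impl p (P Q : V -> Prop) : (forall q, q ∊ C -> Rel R q p -> P q -> Q q) ->
  DenseBelow C R p P -> DenseBelow C R p Q.
Proof.
  intros K D q hq hqp. destruct (D q hq hqp) as (s & hs & hsq & h). exists s. split; auto. split; auto.
  apply K; auto. eauto using le_trans.
Qed.

Notation name := (IsName C).
Lemma nameClosedE n : NameClosed C n <-> forall x, x ∊ n -> forall z, z ∊ x -> exists y p, y ∊ n /\ p ∊ C /\ z = opair y p.
Proof.
  unfold NameClosed. split; intros K x hx z hz.
  - destruct (K x hx z hz) as (y & hy & p & hp & e). apply pairE in e. eauto.
  - destruct (K x hx z hz) as (y & p & hy & hp & ->). exists y. split; auto. exists p. split; auto. now apply pairE.
Qed.
Lemma nameE x : name x <-> forall z, z ∊ x -> exists y p, name y /\ p ∊ C /\ z = opair y p.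
Proof.
  split.
  - intros (n & hx & K) z hz. destruct (proj1 (nameClosedE n) K x hx z hz) as (y & p & hy & hp & e).
    exists y, p. split; auto. now exists n.
  (* The names in the transitive closure of [x], together with [x], form a closed set. *)
  - intros K. exists (bun (sep (tcl x) name) (sing x)). split; [rewrite in_bun, in_sing; auto|].
    apply nameClosedE. intros w hw z hz.
    assert (L : exists y p, name y /\ p ∊ C /\ z = opair y p /\ y ∊ tcl x).
    { rewrite in_bun, in_sing, in_sep in hw by dfn. destruct hw as [[hw (n & hn & Kn)]| ->].
      - destruct (proj1 (nameClosedE n) Kn w hn z hz) as (y & p & hy & hp & ->). exists y, p.
        split; [now exists n|]. split; auto. split; auto. apply (tcl_mono _ (opair y p)); [now apply tcl_trans with w|apply opair_tcl].
      - destruct (K z hz) as (y & p & hy & hp & ->). exists y, p. split; auto. split; auto. split; auto.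
        apply (tcl_mono _ (opair y p)); [now apply tcl_sub|apply opair_tcl]. }
    destruct L as (y & p & hy & hp & -> & hyt). exists y, p. split; auto. rewrite in_bun, in_sep by dfn. auto.
Qed.
Lemma name_elt x y p : name x -> opair y p ∊ x -> name y /\ p ∊ C.
Proof.
  intros hx h. destruct (proj1 (nameE x) hx _ h) as (y' & p' & hy & hp & e). apply opair_inj in e.
  destruct e; now subst.
Qed.
Lemma elt_tcl x y p : opair y p ∊ x -> y ∊ tcl x.
Proof. intros h. apply (tcl_mono _ (opair y p)); [now apply tcl_sub|apply opair_tcl]. Qed.

Lemma dfn_DenseBelow n (p : ctx n -> V) (P : ctx n -> V -> Prop) : dterm n p ->
  defn (S n) (fun g => P (tl g) (hd g)) -> defn n (fun g => DenseBelow C R (p g) (P g)).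
Proof. intros. unfold DenseBelow. dfn. Qed.
Hint Resolve dfn_DenseBelow : dfn.
Lemma dfn_ForcesSub n a b c d : dterm n a -> dterm n b -> dterm n c -> dterm n d ->
  defn n (fun g => ForcesSub C R (a g) (b g) (c g) (d g)).
Proof. defining ForcesSub. Qed.
Hint Resolve dfn_ForcesSub : dfn.
Lemma dfn_ForcesEq : Def3 (ForcesEq C R).
Proof. defining ForcesEq. Qed.
Hint Resolve dfn_ForcesEq : dfn.
Lemma dfn_ForcesMem : Def3 (ForcesMem C R).
Proof. defining ForcesMem. Qed.
Hint Resolve dfn_ForcesMem : dfn.
(** By induction on the external formula: each [a] has its own defining formula, and the names
    assigned to its variables may vary with the context. *)
Lemma dfn_Forces a : forall n (p : ctx n -> V) (rho : var -> ctx n -> V), dterm n p ->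
  (forall x, dterm n (rho x)) -> defn n (fun g => Forces C R (p g) a (fun x => rho x g)).
Proof.
  assert (U : forall n (rho : var -> ctx n -> V) x, (forall y, dterm n (rho y)) ->
    forall y, dterm (S n) (fun g => if Nat.eqb y x then hd g else rho y (tl g))).
  { intros n rho x K y. destruct (Nat.eqb y x); [apply dterm_v0|apply (dterm_w _ _ (K y))]. }
  induction a; intros n p rho Hp Hr; simpl.
  - pose proof (Hr x). pose proof (Hr y). dfn.
  - pose proof (Hr x). pose proof (Hr y). dfn.
  - dfn.
  - apply defn_all, defn_imp; [dfn|]. apply defn_imp; [dfn|]. apply defn_imp.
    + apply (IHa1 (S n) (fun g => hd g) (fun x g => rho x (tl g))); [dfn|]. intros x. exact (dterm_w _ _ (Hr x)).
    + apply (IHa2 (S n) (fun g => hd g) (fun x g => rho x (tl g))); [dfn|]. intros x. exact (dterm_w _ _ (Hr x)).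
  - apply defn_and; auto.
  - apply dfn_DenseBelow; auto. apply defn_or.
    + apply (IHa1 (S n) (fun g => hd g) (fun x g => rho x (tl g))); [dfn|]. intros x. exact (dterm_w _ _ (Hr x)).
    + apply (IHa2 (S n) (fun g => hd g) (fun x g => rho x (tl g))); [dfn|]. intros x. exact (dterm_w _ _ (Hr x)).
  - apply defn_all, defn_imp; [dfn|].
    exact (IHa (S n) (fun g => p (tl g)) _ (dterm_w _ _ Hp) (U n rho x Hr)).
  - apply dfn_DenseBelow; auto. apply defn_ex, defn_and; [dfn|].
    apply (IHa (S (S n)) (fun g => hd (tl g)) (fun y g => if Nat.eqb y x then hd g else rho y (tl (tl g)))); [dfn|].
    apply (U (S n) (fun y g => rho y (tl g)) x). intros y. exact (dterm_w _ _ (Hr y)).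
Qed.

(* The recursion equation for the forcing of equality is monotone in the
   relation sought, so a solution is a greatest fixed point; the solution is
   unique by induction along membership. *)
Definition eq_step (g q y y' : V) := ForcesSub C R g q y y' /\ ForcesSub C R g q y' y.
Definition solves (n g : V) := NameClosed C n /\
  forall q, q ∊ C -> forall y, y ∊ n -> forall y', y' ∊ n -> (Rel3 g q y y' <-> eq_step g q y y').
Lemma forcesEq_iff p x x' : ForcesEq C R p x x' <-> exists n g, solves n g /\ x ∊ n /\ x' ∊ n /\ Rel3 g p x x'.
Proof.
  unfold ForcesEq, solves, eq_step. split; intros (n & g & K); exists n, g; tauto.
Qed.
Lemma forcesSub_impl g g' q x x' :
  (forall s z z', s ∊ C -> (exists u, opair z u ∊ x) -> (exists u, opair z' u ∊ x') -> Rel3 g s z z' -> Rel3 g' s z z') ->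
  ForcesSub C R g q x x' -> ForcesSub C R g' q x x'.
Proof.
  intros K S y u hy s hs hsq hsu. eapply denseBelow_impl; [|exact (S y u hy s hs hsq hsu)].
  intros t ht _ (y' & u' & hy' & htu & h). exists y', u'. split; auto. split; auto.
  apply relE in hy, hy'. apply K; eauto.
Qed.
Lemma solves_ex n : NameClosed C n -> exists g, solves n g.
Proof.
  intros N.
  pose (T := prod C (prod n n)).
  pose (post := fun g => forall q y y', q ∊ C -> y ∊ n -> y' ∊ n -> Rel3 g q y y' -> eq_step g q y y').
  assert (D : Def1 post) by (intros; unfold post, eq_step; dfn).
  pose (g := sep T (fun z => exists g', post g' /\ z ∊ g')).
  assert (Hg : forall q y y', q ∊ C -> y ∊ n -> y' ∊ n -> Rel3 g q y y' <-> exists g', post g' /\ Rel3 g' q y y').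
  { intros q y y' hq hy hy'. rewrite rel3E. unfold g, T. rewrite in_sep, !opair_in_prod by dfn. split.
    - intros [_ (g' & h & h')]. exists g'. split; auto. now apply rel3E.
    - intros (g' & h & h'). split; auto. exists g'. split; auto. now apply rel3E. }
  assert (mono : forall g1 g2, (forall q y y', q ∊ C -> y ∊ n -> y' ∊ n -> Rel3 g1 q y y' -> Rel3 g2 q y y') ->
    forall q y y', y ∊ n -> y' ∊ n -> eq_step g1 q y y' -> eq_step g2 q y y').
  { intros g1 g2 K q y y' hy hy' [h h'].
    assert (L : forall w, w ∊ n -> forall z, (exists u, opair z u ∊ w) -> z ∊ n).
    { intros w hw z [u hu]. destruct (proj1 (nameClosedE n) N w hw _ hu) as (z' & p & hz & _ & e).
      apply opair_inj in e. now destruct e as [-> _]. }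
    split; (eapply forcesSub_impl; [|eassumption]); intros; apply K; eauto. }
  assert (pg : post g).
  { intros q y y' hq hy hy' h. apply Hg in h; auto. destruct h as (g' & hg' & h).
    apply (mono g' g); auto. intros s z z' hs hz hz' k. apply Hg; eauto. }
  exists g. split; auto. intros q hq y hy y' hy'. split; [now apply pg|]. intros h.
  (* [g] is the union of all post-fixed points. If the right-hand side holds at a triple, adjoining
     this triple to [g] gives another post-fixed point, which therefore lies inside [g]. *)
  apply Hg; auto. exists (bun g (sing (opair q (opair y y')))).
  assert (up : forall s z z', Rel3 g s z z' -> Rel3 (bun g (sing (opair q (opair y y')))) s z z').
  { intros s z z'. rewrite !rel3E, in_bun. auto. }
  split; [|rewrite rel3E, in_bun, in_sing; auto].
  intros s z z' hs hz hz' k. apply (mono g); auto.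
  rewrite rel3E, in_bun, in_sing, <- rel3E in k. destruct k as [k|k]; auto.
  apply opair_inj in k. destruct k as [-> k]. apply opair_inj in k. now destruct k as [-> ->].
Qed.
(** The clause for [y] and [y'] refers to elements of [y] on the left in one half and on the right
    in the other. Treating both orders at once lets the induction run along [y] alone, for arbitrary
    [y']. *)
Lemma solves_unique n g n' g' : solves n g -> solves n' g' -> forall y, forall y' q,
  y ∊ n -> y ∊ n' -> y' ∊ n -> y' ∊ n' -> q ∊ C ->
  (Rel3 g q y y' <-> Rel3 g' q y y') /\ (Rel3 g q y' y <-> Rel3 g' q y' y).
Proof.
  intros [N K] [N' K']. apply (tcl_ind (fun y => forall y' q,
  y ∊ n -> y ∊ n' -> y' ∊ n -> y' ∊ n' -> q ∊ C ->
  (Rel3 g q y y' <-> Rel3 g' q y y') /\ (Rel3 g q y' y <-> Rel3 g' q y' y))); [dfn|].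
  intros y IH y' q h1 h2 h3 h4 hq. rewrite !K, !K' by auto.
  assert (L : forall n, NameClosed C n -> forall w, w ∊ n -> forall z, (exists u, opair z u ∊ w) -> z ∊ n).
  { intros k Nk w hw z [u hu]. destruct (proj1 (nameClosedE k) Nk w hw _ hu) as (z' & p & hz & _ & e).
    apply opair_inj in e. now destruct e as [-> _]. }
  assert (T : forall z, (exists u, opair z u ∊ y) -> z ∊ tcl y).
  { intros z [u hu]. now apply elt_tcl with u. }
  assert (A : forall s z z', s ∊ C -> (exists u, opair z u ∊ y) -> (exists u, opair z' u ∊ y') ->
    (Rel3 g s z z' <-> Rel3 g' s z z') /\ (Rel3 g s z' z <-> Rel3 g' s z' z)).
  { intros s z z' hs hz hz'. apply IH; auto; eauto. }
  unfold eq_step. split; split; intros [B B'];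
    (split; (eapply forcesSub_impl; [|eassumption])); intros s z z' hs hz hz';
    first [pose proof (A s z z' hs hz hz') | pose proof (A s z' z hs hz' hz)]; tauto.
Qed.

Definition forces_incl p x x' := forall y u, opair y u ∊ x -> forall q, q ∊ C -> Rel R q p -> Rel R q u ->
  DenseBelow C R q (fun s => exists y' u', opair y' u' ∊ x' /\ Rel R s u' /\ ForcesEq C R s y y').
(** Two closed sets of names have a closed union, and by uniqueness one solution on this union
    decides every equality between its members. *)
Lemma forcesEqE p x x' : name x -> name x' -> p ∊ C ->
  ForcesEq C R p x x' <-> forces_incl p x x' /\ forces_incl p x' x.
Proof.
  intros (n1 & h1 & N1) (n2 & h2 & N2) hp.
  assert (N : NameClosed C (bun n1 n2)).
  { apply nameClosedE. intros w hw z hz. apply in_bun in hw. destruct hw as [hw|hw].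
    - destruct (proj1 (nameClosedE n1) N1 w hw z hz) as (y & p' & hy & hp' & e). exists y, p'. rewrite in_bun; auto.
    - destruct (proj1 (nameClosedE n2) N2 w hw z hz) as (y & p' & hy & hp' & e). exists y, p'. rewrite in_bun; auto. }
  destruct (solves_ex _ N) as [g Sg]. set (n := bun n1 n2) in *.
  assert (hx : x ∊ n) by (apply in_bun; auto). assert (hx' : x' ∊ n) by (apply in_bun; auto).
  assert (A : forall q y y', q ∊ C -> y ∊ n -> y' ∊ n -> ForcesEq C R q y y' <-> Rel3 g q y y').
  { intros q y y' hq hy hy'. rewrite forcesEq_iff. split.
    - intros (k & g' & Sg' & k1 & k2 & k3). now apply (solves_unique n g k g').
    - intros h. exists n, g. auto. }
  rewrite A by auto. rewrite (proj2 Sg) by auto. unfold eq_step.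
  assert (L : forall w, w ∊ n -> forall z u, opair z u ∊ w -> z ∊ n).
  { intros w hw z u hu. destruct (proj1 (nameClosedE n) N w hw _ hu) as (z' & p' & hz & _ & e).
    apply opair_inj in e. now destruct e as [-> _]. }
  assert (B : forall a b, a ∊ n -> b ∊ n -> ForcesSub C R g p a b <-> forces_incl p a b).
  { intros a b ha hb. unfold ForcesSub, forces_incl. split; intros K y u hy q hq hqp hqu.
    - apply relE in hy. eapply denseBelow_impl; [|exact (K y u hy q hq hqp hqu)].
      intros s hs _ (y' & u' & hy' & hsu & h). apply relE in hy, hy'. exists y', u'. split; auto. split; auto.
      apply A; eauto.
    - apply relE in hy. eapply denseBelow_impl; [|exact (K y u hy q hq hqp hqu)].
      intros s hs _ (y' & u' & hy' & hsu & h). exists y', u'. rewrite relE. split; auto. split; auto.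
      apply A; eauto. }
  now rewrite !B by auto.
Qed.
Lemma forcesMemE p x x' : ForcesMem C R p x x' <->
  DenseBelow C R p (fun s => exists y u, opair y u ∊ x' /\ Rel R s u /\ ForcesEq C R s x y).
Proof. unfold ForcesMem, DenseBelow. now setoid_rewrite relE. Qed.

Lemma forcesEq_mono p q x y : name x -> name y -> Rel R q p -> ForcesEq C R p x y -> ForcesEq C R q x y.
Proof.
  intros hx hy h. destruct (le_dom _ _ h). rewrite !forcesEqE by auto.
  intros [A B]; split; intros z u hz s hs hsq hsu; [eapply A|eapply B]; eauto using le_trans.
Qed.
Lemma forcesEq_dense p x y : name x -> name y -> p ∊ C ->
  DenseBelow C R p (fun q => ForcesEq C R q x y) -> ForcesEq C R p x y.
Proof.
  intros hx hy hp D. apply forcesEqE; auto. split; intros z u hz q hq hqp hqu; apply denseBelow_dense;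
    (eapply denseBelow_impl; [|exact (denseBelow_mono _ _ _ hqp D)]); intros s hs hsq K;
    apply forcesEqE in K; auto; eapply K; eauto using le_trans, le_refl.
Qed.
Lemma forcesEq_sym p x y : name x -> name y -> p ∊ C -> ForcesEq C R p x y -> ForcesEq C R p y x.
Proof. intros hx hy hp. rewrite !forcesEqE by auto. tauto. Qed.
Lemma forcesEq_refl x : name x -> forall p, p ∊ C -> ForcesEq C R p x x.
Proof.
  revert x. apply (tcl_ind (fun x => name x -> forall p, p ∊ C -> ForcesEq C R p x x)); [dfn|].
  intros x IH hx p hp. apply forcesEqE; auto.
  assert (K : forces_incl p x x); auto.
  intros y u hy q hq hqp hqu s hs hsq. exists s. split; auto. split; [now apply le_refl|].
  exists y, u. split; auto. split; [eauto using le_trans|]. apply IH; auto.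
  - now apply elt_tcl with u.
  - now apply (name_elt x y u).
Qed.
Lemma forcesEq_trans x : forall y z p, name x -> name y -> name z -> p ∊ C ->
  ForcesEq C R p x y -> ForcesEq C R p y z -> ForcesEq C R p x z.
Proof.
  revert x. apply (tcl_ind (fun x => forall y z p, name x -> name y -> name z -> p ∊ C ->
    ForcesEq C R p x y -> ForcesEq C R p y z -> ForcesEq C R p x z)); [dfn|].
  intros x IH y z p hx hy hz hp Exy Eyz. apply forcesEqE in Exy, Eyz; auto.
  destruct Exy as [xy yx], Eyz as [yz zy]. apply forcesEqE; auto. split.
  - intros a u ha q hq hqp hqu s hs hsq.
    destruct (xy a u ha q hq hqp hqu s hs hsq) as (s1 & hs1 & l1 & b & v & hb & lv & Eab).
    destruct (yz b v hb s1 hs1 ltac:(eauto using le_trans) lv s1 hs1 (le_refl _ hs1)) as (s2 & hs2 & l2 & c & w & hc & lw & Ebc).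
    exists s2. split; auto. split; [eauto using le_trans|]. exists c, w. split; auto. split; auto.
    destruct (name_elt _ _ _ hx ha), (name_elt _ _ _ hy hb), (name_elt _ _ _ hz hc).
    apply (IH a) with b; auto; [now apply elt_tcl with u|]. now apply forcesEq_mono with s1.
  - intros a u ha q hq hqp hqu s hs hsq.
    destruct (zy a u ha q hq hqp hqu s hs hsq) as (s1 & hs1 & l1 & b & v & hb & lv & Eab).
    destruct (yx b v hb s1 hs1 ltac:(eauto using le_trans) lv s1 hs1 (le_refl _ hs1)) as (s2 & hs2 & l2 & c & w & hc & lw & Ebc).
    exists s2. split; auto. split; [eauto using le_trans|]. exists c, w. split; auto. split; auto.
    destruct (name_elt _ _ _ hz ha), (name_elt _ _ _ hy hb), (name_elt _ _ _ hx hc).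
    apply forcesEq_sym; auto. apply (IH c) with b; auto; [now apply elt_tcl with w| |]; apply forcesEq_sym; auto.
    now apply forcesEq_mono with s1.
Qed.
Lemma forcesMem_eql p x x' y : name x -> name x' -> name y -> p ∊ C ->
  ForcesEq C R p x x' -> ForcesMem C R p x y -> ForcesMem C R p x' y.
Proof.
  intros hx hx' hy hp e. rewrite !forcesMemE. apply denseBelow_impl.
  intros q hq hqp (z & u & hz & hqu & K). exists z, u. split; auto. split; auto.
  destruct (name_elt _ _ _ hy hz). apply forcesEq_trans with x; auto. apply forcesEq_sym; auto.
  now apply forcesEq_mono with p.
Qed.
Lemma forcesMem_eqr p x y y' : name x -> name y -> name y' -> p ∊ C ->
  ForcesEq C R p y y' -> ForcesMem C R p x y -> ForcesMem C R p x y'.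
Proof.
  intros hx hy hy' hp e. rewrite !forcesMemE. apply forcesEqE in e; auto. destruct e as [e _].
  intros D. apply denseBelow_dense. eapply denseBelow_impl; [|exact D].
  intros q hq hqp (z & u & hz & hqu & K). eapply denseBelow_impl; [|exact (e z u hz q hq hqp hqu)].
  intros s hs hsq (z' & u' & hz' & hsu & K'). exists z', u'. split; auto. split; auto.
  destruct (name_elt _ _ _ hy hz), (name_elt _ _ _ hy' hz').
  apply forcesEq_trans with z; auto. now apply forcesEq_mono with q.
Qed.

Lemma names_upd rho x v : (forall i, name (rho i)) -> name v -> forall i, name (upd rho x v i).
Proof. intros K hv i. unfold upd. destruct (Nat.eqb i x); auto. Qed.

Lemma forces_mono a : forall p q rho, (forall i, name (rho i)) -> Rel R q p -> Forces C R p a rho -> Forces C R q a rho.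
Proof.
  induction a; intros p q rho K h; destruct (le_dom _ _ h); simpl.
  - apply denseBelow_mono; auto.
  - now apply forcesEq_mono.
  - auto.
  - intros F s hs hsq. apply F; eauto using le_trans.
  - intros []; split; eauto.
  - apply denseBelow_mono; auto.
  - intros F v hv. apply IHa with p; auto using names_upd.
  - apply denseBelow_mono; auto.
Qed.
(** Density is part of the clauses for atoms, disjunction and existence, and the other clauses
    inherit it. Through this lemma classical reasoning enters: if [p] does not force [a], some
    extension of [p] has no extension forcing [a]. *)
Lemma forces_dense a : forall p rho, (forall i, name (rho i)) -> p ∊ C ->
  DenseBelow C R p (fun q => Forces C R q a rho) -> Forces C R p a rho.
Proof.
  induction a; intros p rho K hp; simpl.
  - apply denseBelow_dense.
  - now apply forcesEq_dense.
  - intros D. destruct (D p hp (le_refl _ hp)) as (s & _ & _ & []).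
  - intros D q hq hqp F. apply IHa2; auto. eapply denseBelow_impl; [|exact (denseBelow_mono _ _ _ hqp D)].
    intros s hs hsq L. apply L; auto using le_refl. now apply forces_mono with q.
  - intros D. split; [apply IHa1|apply IHa2]; auto; (eapply denseBelow_impl; [|exact D]); simpl; intros; tauto.
  - apply denseBelow_dense.
  - intros D v hv. apply IHa; auto using names_upd. eapply denseBelow_impl; [|exact D]. simpl. auto.
  - apply denseBelow_dense.
Qed.
End Forcing.
#[global] Hint Resolve dfn_DenseBelow dfn_ForcesEq dfn_ForcesMem : dfn.

(** * Generic extensions of countable models *)

Section Extension.
Context {V : Type} {E : MemRel V} {H : ZF E}.
Variables C R one : V.
Hypothesis poset : Poset C R.
Hypothesis one_in : one ∊ C.
Hypothesis one_max : forall x, x ∊ C -> Rel R x one.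
Notation name := (IsName C).
Notation le p q := (Rel R p q).
Let le_dom := le_dom C R poset.
Let le_refl := le_refl C R poset.
Let le_trans := le_trans C R poset.

Record generic (G : V -> Prop) : Prop := {
  generic_sub : forall p, G p -> p ∊ C;
  generic_up : forall p q, G p -> le p q -> G q;
  generic_dir : forall p q, G p -> G q -> exists s, G s /\ le s p /\ le s q;
  generic_meets : forall D, Sub D C -> (forall x, x ∊ C -> exists y, y ∊ D /\ le y x) -> exists p, G p /\ p ∊ D
}.

(** The Rasiowa-Sikorski argument. The descending sequence is indexed by external numbers and chosen
    in the metatheory, so neither it nor [G] need belong to the model. *)
Lemma generic_ex (enum : nat -> V) : (forall x, exists n, enum n = x) ->
  forall p, p ∊ C -> exists G, generic G /\ G p.
Proof.
  intros sur p hp.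
  pose (next := fun D x => pick (fun y => y ∊ C /\ le y x /\ ((exists z, z ∊ D /\ le z x) -> y ∊ D))).
  assert (Hn : forall D x, Sub D C -> x ∊ C -> next D x ∊ C /\ le (next D x) x /\ ((exists z, z ∊ D /\ le z x) -> next D x ∊ D)).
  { intros D x S hx. apply (pickP (fun y => y ∊ C /\ le y x /\ ((exists z, z ∊ D /\ le z x) -> y ∊ D))).
    destruct (classic (exists z, z ∊ D /\ le z x)) as [(z & hz & h)|N].
    - exists z. auto.
    - exists x. split; auto. split; [now apply le_refl|tauto]. }
  (* [enum] lists all sets of the model; cutting down to [C] makes each of them a set of conditions,
     which [next] enters whenever it can. *)
  pose (f := fix f n := match n with 0 => p | S m => next (sep (enum m) (fun y => y ∊ C)) (f m) end).
  assert (SC : forall D, Sub (sep D (fun y => y ∊ C)) C).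
  { intros D z hz. apply in_sep in hz; [tauto|dfn]. }
  assert (Hf : forall n, f n ∊ C) by (induction n; simpl; auto; now apply Hn).
  assert (mono : forall m n, m <= n -> le (f n) (f m)).
  { intros m n h. induction h; [now apply le_refl|]. apply le_trans with (f m0); auto. now apply Hn. }
  exists (fun q => q ∊ C /\ exists n, le (f n) q). split; [constructor|].
  - tauto.
  - intros a b [ha [n hn]] h. split; [now apply (le_dom a b)|]. exists n. now apply le_trans with a.
  - intros a b [ha [n hn]] [hb [m hm]]. exists (f (max n m)). split; [split; auto; exists (max n m); now apply le_refl|].
    split; [apply le_trans with (f n)|apply le_trans with (f m)]; auto; apply mono; lia.
  - intros D SD dense. destruct (sur D) as [n en]. exists (f (S n)).
    assert (hD : f (S n) ∊ sep D (fun y => y ∊ C)).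
    { simpl. rewrite en. apply Hn; auto. destruct (dense (f n) (Hf n)) as (y & hy & l). exists y. split; auto.
      apply in_sep; [dfn|]. auto. }
    split; [split; auto; exists (S n); now apply le_refl|]. apply in_sep in hD; [tauto|dfn].
  - split; auto. exists 0. now apply le_refl.
Qed.

Section Filter.
Variable G : V -> Prop.
Hypothesis gen : generic G.

Lemma generic_one : G one.
Proof.
  destruct (generic_meets G gen C) as (p & hp & _).
  - intros z; auto.
  - intros x hx. exists x. auto.
  - apply (generic_up G gen p); auto. apply one_max, (generic_sub G gen p hp).
Qed.
Lemma generic_dense (P : V -> Prop) : defn 1 (fun g => P (hd g)) ->
  (forall x, x ∊ C -> exists y, y ∊ C /\ le y x /\ P y) -> exists p, G p /\ P p.
Proof.
  intros D K. destruct (generic_meets G gen (sep C P)) as (p & hp & h).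
  - intros z hz. apply in_sep in hz; tauto.
  - intros x hx. destruct (K x hx) as (y & hy & l & hP). exists y. rewrite in_sep by auto. auto.
  - exists p. apply in_sep in h; tauto.
Qed.
Lemma generic_dense_below (P : V -> Prop) p : defn 1 (fun g => P (hd g)) ->
  G p -> DenseBelow C R p P -> exists s, G s /\ P s.
Proof.
  intros D hp K.
  destruct (generic_dense (fun s => P s \/ ~ exists t, le t s /\ le t p)) as (s & hs & [h|h]); [dfn| | |].
  - intros x hx. destruct (classic (exists t, le t x /\ le t p)) as [(t & l & l')|N].
    + destruct (K t) as (s & hs & l2 & hP); auto; [now apply (le_dom t x)|]. exists s. split; auto. split; eauto.
    + exists x. auto using le_refl.
  - eauto.
  - exfalso. destruct (generic_dir G gen s p) as (t & _ & l & l'); auto. apply h. eauto.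
Qed.

Definition truth (a : form) (rho : var -> V) := exists p, G p /\ Forces C R p a rho.
Notation names rho := (forall i : var, name (rho i)).
Lemma generic_in p : G p -> p ∊ C. Proof. now apply generic_sub. Qed.
Hint Resolve generic_in : core.

Lemma dfn_forces a rho n (p : ctx n -> V) : dterm n p -> defn n (fun g => Forces C R (p g) a rho).
Proof. intros hp. apply (dfn_Forces C R a n p (fun x _ => rho x)); auto. intros; dfn. Qed.
Hint Resolve dfn_forces : dfn.

(** The converse is a density argument: a condition that does not force the implication has an
    extension that forces [a] and has no extension forcing [b]. A condition of this second kind in
    [G] would be compatible with one forcing [b]. *)
Lemma truth_imp a b rho : names rho -> truth (FImp a b) rho <-> (truth a rho -> truth b rho).
Proof.
  intros K. split.
  - intros (p & hp & F) (q & hq & A). destruct (generic_dir G gen p q) as (s & hs & l & l'); auto.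
    exists s. split; auto. apply F; eauto. now apply (forces_mono C R poset a q).
  - intros T.
    destruct (generic_dense (fun p => Forces C R p (FImp a b) rho \/
      (Forces C R p a rho /\ forall q, le q p -> ~ Forces C R q b rho))) as (p & hp & [h|[h N]]); [dfn| | |].
    + intros x hx. destruct (classic (Forces C R x (FImp a b) rho)) as [h|N]; [exists x; auto using le_refl|].
      apply NNPP. intros N'. apply N. intros q hq l A. apply (forces_dense C R poset b); auto.
      intros s hs ls. apply NNPP. intros N2. apply N'. exists s. split; auto.
      split; [eapply le_trans; eauto|]. right. split; [now apply (forces_mono C R poset a q)|].
      intros t lt B. apply N2. exists t. split; auto. now apply (le_dom t s).
    + exists p; auto.
    + exfalso. destruct T as (q & hq & B); [exists p; auto|].
      destruct (generic_dir G gen p q) as (s & hs & l & l'); auto. apply (N s l).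
      now apply (forces_mono C R poset b q).
Qed.
Lemma truth_and a b rho : names rho -> truth (FAnd a b) rho <-> truth a rho /\ truth b rho.
Proof.
  intros K. split.
  - intros (p & hp & A & B). split; exists p; auto.
  - intros [(p & hp & A) (q & hq & B)]. destruct (generic_dir G gen p q) as (s & hs & l & l'); auto.
    exists s. split; auto. split; [apply (forces_mono C R poset a p)|apply (forces_mono C R poset b q)]; auto.
Qed.
Lemma truth_or a b rho : names rho -> truth (FOr a b) rho <-> truth a rho \/ truth b rho.
Proof.
  intros K. split.
  - intros (p & hp & D). destruct (generic_dense_below (fun q => Forces C R q a rho \/ Forces C R q b rho) p) as (s & hs & [h|h]);
      [dfn|exact hp|exact D|left; exists s; auto|right; exists s; auto].
  - intros [(p & hp & A)|(p & hp & A)]; exists p; split; auto; intros q hq l; exists q; split; auto; split; auto using le_refl;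
      [left; apply (forces_mono C R poset a p)|right; apply (forces_mono C R poset b p)]; auto.
Qed.
Lemma dfn_forces_upd a rho x n p v : dterm n p -> dterm n v -> defn n (fun g => Forces C R (p g) a (upd rho x (v g))).
Proof.
  intros hp hv. apply (dfn_Forces C R a n p (fun y g => upd rho x (v g) y)); auto. intros y. unfold upd.
  destruct (Nat.eqb y x); dfn.
Qed.
Hint Resolve dfn_forces_upd : dfn.
(** Again by density: below every condition there is one that forces the universal formula, or one
    for which a single name [v] gives an instance that no extension forces. *)
Lemma truth_all x a rho : names rho -> truth (FAll x a) rho <-> forall v, name v -> truth a (upd rho x v).
Proof.
  intros K. split.
  - intros (p & hp & F) v hv. exists p. split; [exact hp|]. now apply F.
  - intros T.
    destruct (generic_dense (fun p => Forces C R p (FAll x a) rho \/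
      exists v, name v /\ forall q, le q p -> ~ Forces C R q a (upd rho x v))) as (p & hp & [h|(v & hv & N)]); [dfn| | |].
    + intros y hy. destruct (classic (Forces C R y (FAll x a) rho)) as [h|N]; [exists y; auto using le_refl|].
      apply NNPP. intros N'. apply N. intros v hv. apply (forces_dense C R poset a); auto using names_upd.
      intros s hs ls. apply NNPP. intros N2. apply N'. exists s. split; auto. split; auto. right. exists v. split; auto.
      intros t lt A. apply N2. exists t. split; auto. now apply (le_dom t s).
    + exists p; auto.
    + exfalso. destruct (T v hv) as (q & hq & B).
      destruct (generic_dir G gen p q) as (s & hs & l & l'); auto. apply (N s l).
      apply (forces_mono C R poset a q); auto using names_upd.
Qed.
Lemma truth_ex x a rho : names rho -> truth (FEx x a) rho <-> exists v, name v /\ truth a (upd rho x v).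
Proof.
  intros K. split.
  - intros (p & hp & D).
    destruct (generic_dense_below (fun q => exists v, name v /\ Forces C R q a (upd rho x v)) p) as (s & hs & v & hv & h);
      [dfn|auto|exact D|]. exists v. split; auto. exists s; auto.
  - intros (v & hv & p & hp & A). exists p. split; auto. intros q hq l. exists q. split; auto. split; auto using le_refl.
    exists v. split; auto. apply (forces_mono C R poset a p); auto using names_upd.
Qed.

Definition eqG (x y : V) := exists p, G p /\ ForcesEq C R p x y.
Definition memG (x y : V) := exists p, G p /\ ForcesMem C R p x y.
Lemma eqG_refl x : name x -> eqG x x.
Proof. intros hx. exists one. split; [apply generic_one|]. apply forcesEq_refl; auto. Qed.
Lemma eqG_sym x y : name x -> name y -> eqG x y -> eqG y x.
Proof. intros hx hy (p & hp & h). exists p. split; auto. apply (forcesEq_sym C R poset); eauto. Qed.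
Lemma eqG_trans x y z : name x -> name y -> name z -> eqG x y -> eqG y z -> eqG x z.
Proof.
  intros hx hy hz (p & hp & h) (q & hq & h'). destruct (generic_dir G gen p q) as (s & hs & l & l'); auto.
  exists s. split; auto. apply (forcesEq_trans C R poset x y z); auto; [apply (forcesEq_mono C R poset p)|apply (forcesEq_mono C R poset q)]; auto.
Qed.
Lemma forcesMem_mono p q x y : le q p -> ForcesMem C R p x y -> ForcesMem C R q x y.
Proof. apply denseBelow_mono; auto. Qed.
Lemma memG_eq x x' y y' : name x -> name x' -> name y -> name y' -> eqG x x' -> eqG y y' -> memG x y -> memG x' y'.
Proof.
  intros hx hx' hy hy' (p & hp & h) (q & hq & h') (s & hs & k).
  destruct (generic_dir G gen p q) as (t & ht & l1 & l2); auto.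
  destruct (generic_dir G gen t s) as (u & hu & l3 & l4); auto.
  exists u. split; auto. apply (forcesMem_eqr C R poset u x' y); auto.
  { apply (forcesEq_mono C R poset q); eauto. }
  apply (forcesMem_eql C R poset u x); auto.
  { apply (forcesEq_mono C R poset p); eauto. }
  now apply forcesMem_mono with s.
Qed.
Lemma memG_iff x y : name x -> name y -> memG x y <-> exists w u, opair w u ∊ y /\ G u /\ eqG x w.
Proof.
  intros hx hy. split.
  - intros (p & hp & h). apply forcesMemE in h; auto.
    destruct (generic_dense_below (fun s => exists w u, opair w u ∊ y /\ le s u /\ ForcesEq C R s x w) p) as (s & hs & w & u & h1 & h2 & h3);
      [dfn|auto|exact h|]. exists w, u. split; auto. split; [now apply (generic_up G gen s)|]. exists s; auto.
  - intros (w & u & hw & hu & q & hq & e). destruct (generic_dir G gen u q) as (s & hs & l & l'); auto.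
    exists s. split; auto. apply forcesMemE; auto. intros t ht lt. exists t. split; auto. split; auto using le_refl.
    exists w, u. split; auto. split; eauto. destruct (name_elt C y w u hy hw).
    apply (forcesEq_mono C R poset q); eauto.
Qed.
(** Densely often a condition forces equality or is [bad]: it puts an element of one name into that
    name while no extension equates it with an element of the other. A bad condition in [G] exhibits
    a set on which the two values differ. *)
Lemma eqG_ext x y : name x -> name y -> (forall z, name z -> memG z x <-> memG z y) -> eqG x y.
Proof.
  intros hx hy K.
  pose (bad := fun p x y => exists w u, opair w u ∊ x /\ le p u /\
    forall s, le s p -> ~ exists w' u', opair w' u' ∊ y /\ le s u' /\ ForcesEq C R s w w').
  assert (Dbad : Def3 bad) by (intros; unfold bad; dfn).
  assert (B : forall p x y, G p -> name x -> name y -> bad p x y -> exists z, name z /\ memG z x /\ ~ memG z y).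
  { intros p a b hp ha hb (w & u & hw & l & N). destruct (name_elt C a w u ha hw) as [nw _]. exists w. split; auto. split.
    - apply memG_iff; auto. exists w, u. split; auto. split; [now apply (generic_up G gen p)|now apply eqG_refl].
    - intros M. apply memG_iff in M; auto. destruct M as (w' & u' & hw' & hu' & q & hq & e).
      destruct (name_elt C b w' u' hb hw') as [nw' _].
      destruct (generic_dir G gen p q) as (s & hs & l1 & l2); auto.
      destruct (generic_dir G gen s u') as (t & ht & l3 & l4); auto.
      apply (N t); eauto. exists w', u'. split; auto. split; auto. apply (forcesEq_mono C R poset q); eauto. }
  destruct (generic_dense (fun p => ForcesEq C R p x y \/ bad p x y \/ bad p y x)) as (p & hp & [h|[h|h]]); [dfn| | | |].
  - intros p hp. destruct (classic (ForcesEq C R p x y)) as [h|N]; [exists p; auto using le_refl|].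
    assert (I : forall x y, ~ forces_incl C R p x y -> exists q, q ∊ C /\ le q p /\ bad q x y).
    { clear - poset le_dom le_trans. intros x y N. apply NNPP. intros N'. apply N. intros w u hw q hq l1 l2 s hs l3.
      apply NNPP. intros N2. apply N'. exists s. split; auto. split; eauto. exists w, u. split; auto. split; eauto.
      intros t lt (w' & u' & h1 & h2 & h3). apply N2. exists t. split; [now apply (le_dom t s)|]. eauto 10. }
    rewrite forcesEqE in N by auto. apply not_and_or in N. destruct N as [N|N]; apply I in N;
      destruct N as (q & hq & l & b); exists q; auto.
  - exists p; auto.
  - destruct (B p x y) as (z & hz & h1 & h2); auto. exfalso. apply h2, K; auto.
  - destruct (B p y x) as (z & hz & h1 & h2); auto. exfalso. apply h2, K; auto.
Qed.

Lemma name_emp : name emp.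
Proof. apply nameE. intros z h. now apply in_emp in h. Qed.
(** The extension is the quotient of the names by equality forced in [G], presented by canonical
    representatives; over an ill-founded model names cannot be evaluated by external recursion. *)
Definition rep (x : V) : V := epsilon (inhabits emp) (fun y => name y /\ eqG x y).
Lemma rep_spec x : name x -> name (rep x) /\ eqG x (rep x).
Proof. intros hx. apply (epsilon_spec (inhabits emp) (fun y => name y /\ eqG x y)). exists x. auto using eqG_refl. Qed.
Lemma rep_eq x y : name x -> name y -> rep x = rep y <-> eqG x y.
Proof.
  intros hx hy. destruct (rep_spec x hx) as [n1 e1], (rep_spec y hy) as [n2 e2]. split.
  - intros e. rewrite <- e in e2. apply eqG_trans with (rep x); auto. apply eqG_sym; auto.
  - intros e. unfold rep. f_equal. apply functional_extensionality. intros z. apply propositional_extensionality.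
    split; intros [hz K]; split; auto.
    + apply eqG_trans with x; auto. now apply eqG_sym.
    + now apply eqG_trans with y.
Qed.

Definition ext : Type := {x : V | name x /\ rep x = x}.
#[local] Instance ext_mem : MemRel ext := fun x y => memG (proj1_sig x) (proj1_sig y).

Lemma val_proof x : name (if excluded_middle_informative (name x) then rep x else rep emp) /\
  rep (if excluded_middle_informative (name x) then rep x else rep emp) =
  (if excluded_middle_informative (name x) then rep x else rep emp).
Proof.
  destruct (excluded_middle_informative (name x)) as [h|_];
    [destruct (rep_spec x h) as [n e]|destruct (rep_spec emp name_emp) as [n e]]; split; auto;
    symmetry; apply rep_eq; auto using name_emp.
Qed.
Definition val (x : V) : ext := exist _ _ (val_proof x).
Lemma val_rep x : name x -> proj1_sig (val x) = rep x.
Proof. intros h. simpl. destruct (excluded_middle_informative (name x)); auto. contradiction. Qed.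
Lemma ext_eq (x y : ext) : proj1_sig x = proj1_sig y -> x = y.
Proof. destruct x as [x hx], y as [y hy]. simpl. intros ->. f_equal. apply proof_irrelevance. Qed.
Lemma val_eq x y : name x -> name y -> val x = val y <-> eqG x y.
Proof.
  intros hx hy. rewrite <- rep_eq by auto. rewrite <- !val_rep by auto. split; [now intros ->|apply ext_eq].
Qed.
Lemma val_mem x y : name x -> name y -> val x ∊ val y <-> memG x y.
Proof.
  intros hx hy. unfold memV, ext_mem. rewrite !val_rep by auto.
  destruct (rep_spec x hx), (rep_spec y hy). split; apply memG_eq; auto using eqG_sym.
Qed.
Lemma val_onto (v : ext) : exists x, name x /\ v = val x.
Proof.
  exists (proj1_sig v). destruct (proj2_sig v) as [n e]. split; auto. apply ext_eq. now rewrite val_rep.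
Qed.
Lemma in_val v y : name y -> v ∊ val y <-> exists w u, opair w u ∊ y /\ G u /\ v = val w.
Proof.
  intros hy. destruct (val_onto v) as (x & hx & ->). rewrite val_mem, memG_iff by auto.
  split; intros (w & u & hw & hu & e); exists w, u; destruct (name_elt C y w u hy hw); split; auto; split; auto; now apply val_eq.
Qed.

Lemma truth_lemma a : forall rho, names rho -> sat memV (fun i => val (rho i)) a <-> truth a rho.
Proof.
  assert (U : forall rho x v, (fun i => val (upd rho x v i)) = upd (fun i => val (rho i)) x (val v)).
  { intros rho x v. apply functional_extensionality. intros i. unfold upd. now destruct (Nat.eqb i x). }
  induction a; intros rho K; simpl.
  - apply val_mem; auto.
  - apply val_eq; auto.
  - split; [tauto|]. now intros (p & _ & []).
  - rewrite truth_imp, IHa1, IHa2 by auto. reflexivity.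
  - rewrite truth_and, IHa1, IHa2 by auto. reflexivity.
  - rewrite truth_or, IHa1, IHa2 by auto. reflexivity.
  - rewrite truth_all by auto. split.
    + intros L v hv. apply IHa; auto using names_upd. now rewrite U.
    + intros L v. destruct (val_onto v) as (y & hy & ->). rewrite <- U. apply IHa; auto using names_upd.
  - rewrite truth_ex by auto. split.
    + intros [v L]. destruct (val_onto v) as (y & hy & ->). exists y. split; auto. apply IHa; auto using names_upd. now rewrite U.
    + intros (v & hv & L). exists (val v). rewrite <- U. apply IHa; auto using names_upd.
Qed.
End Filter.

(** If [a] were not forced densely below [p], a generic filter through some extension without
    extensions forcing [a] would make [a] fail. This is where generic filters through arbitrary
    conditions are required. *)
Lemma forcing_theorem (enum : nat -> V) (sur : forall x, exists n, enum n = x) p a rho :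
  (forall i, name (rho i)) -> p ∊ C ->
  (forall G, generic G -> G p -> truth G a rho) -> Forces C R p a rho.
Proof.
  intros K hp T. apply (forces_dense C R poset a); auto. intros q hq l. apply NNPP. intros N.
  destruct (generic_ex enum sur q hq) as (G & gen & hG).
  destruct (T G gen (generic_up G gen q p hG l)) as (s & hs & F).
  destruct (generic_dir G gen q s hG hs) as (t & ht & l1 & l2). apply N. exists t.
  split; [now apply (le_dom t q)|]. split; auto. now apply (forces_mono C R poset a s).
Qed.

(** * Names for sets of names, pairs and natural numbers *)

(** With the weakest condition attached to every element, the value is the set of the values of the
    members of [X] for every generic filter. *)
Definition bullet (X : V) : V := repl X (fun x => opair x one).
Lemma dterm_bullet : DefF1 bullet. Proof. defining bullet. Qed.
Hint Resolve dterm_bullet : dfn.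
Lemma in_bullet X y u : opair y u ∊ bullet X <-> y ∊ X /\ u = one.
Proof.
  unfold bullet. rewrite in_repl by dfn. split.
  - intros (z & hz & e). apply opair_inj in e. destruct e; now subst.
  - intros [h ->]. eauto.
Qed.
Lemma name_bullet X : (forall x, x ∊ X -> name x) -> name (bullet X).
Proof.
  intros K. apply nameE. intros z hz. unfold bullet in hz. apply in_repl in hz; [|dfn].
  destruct hz as (x & hx & ->). exists x, one. auto.
Qed.
Definition op (x y : V) : V := bullet (upair (bullet (sing x)) (bullet (upair x y))).
Lemma dterm_op : DefF2 op. Proof. defining op. Qed.
Hint Resolve dterm_op : dfn.
Lemma name_sing x : name x -> name (bullet (sing x)).
Proof. intros hx. apply name_bullet. intros z hz. apply in_sing in hz. now subst. Qed.
Lemma name_upair x y : name x -> name y -> name (bullet (upair x y)).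
Proof. intros hx hy. apply name_bullet. intros z hz. apply in_upair in hz. destruct hz; now subst. Qed.
Lemma name_op x y : name x -> name y -> name (op x y).
Proof. intros hx hy. apply name_upair; auto using name_sing, name_upair. Qed.
Definition check : V -> V := mrec (fun x h => bullet (repl x (app h))).
Lemma dterm_check : DefF1 check. Proof. defining check. Qed.
Hint Resolve dterm_check : dfn.
Lemma checkE x : check x = bullet (repl x check).
Proof.
  unfold check at 1. rewrite mrecE by dfn. fold check. f_equal. apply set_ext. intros z. rewrite !in_repl by dfn.
  split; intros (y & hy & ->); exists y; split; auto; [|symmetry]; apply app_lam; auto using tcl_sub; dfn.
Qed.
Lemma name_check x : name (check x).
Proof.
  revert x. apply (mem_ind (fun x => name (check x))); [dfn|]. intros x IH. rewrite checkE.
  apply name_bullet. intros z hz. apply in_repl in hz; [|dfn]. destruct hz as (y & hy & ->). auto.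
Qed.

Section Structure.
Variable G : V -> Prop.
Hypothesis gen : generic G.
#[local] Existing Instance ext_mem.
Notation val := (val G gen).

Lemma val_bullet X v : (forall x, x ∊ X -> name x) -> v ∊ val (bullet X) <-> exists x, x ∊ X /\ v = val x.
Proof.
  intros K. rewrite in_val by now apply name_bullet. split.
  - intros (w & u & hw & hu & ->). apply in_bullet in hw. exists w. tauto.
  - intros (x & hx & ->). exists x, one. rewrite in_bullet. split; auto. split; auto. now apply generic_one.
Qed.
Lemma val_check x v : v ∊ val (check x) <-> exists y, y ∊ x /\ v = val (check y).
Proof.
  rewrite checkE, val_bullet.
  - split.
    + intros (z & hz & ->). apply in_repl in hz; [|dfn]. destruct hz as (y & hy & ->). eauto.
    + intros (y & hy & ->). exists (check y). split; auto. apply in_repl; [dfn|eauto].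
  - intros z hz. apply in_repl in hz; [|dfn]. destruct hz as (y & hy & ->). apply name_check.
Qed.
Lemma ext_ext (x y : ext G) : (forall z : ext G, z ∊ x <-> z ∊ y) -> x = y.
Proof.
  intros K. destruct (val_onto G gen x) as (a & ha & ->), (val_onto G gen y) as (b & hb & ->).
  apply val_eq; auto. apply eqG_ext; auto. intros z hz. rewrite <- !(val_mem G gen) by auto. apply K.
Qed.
Lemma ext_upair (x y : V) v : name x -> name y -> v ∊ val (bullet (upair x y)) <-> v = val x \/ v = val y.
Proof.
  intros hx hy. rewrite val_bullet.
  - split.
    + intros (z & hz & ->). apply in_upair in hz. destruct hz; subst; auto.
    + intros [->| ->]; [exists x|exists y]; rewrite in_upair; auto.
  - intros z hz. apply in_upair in hz. destruct hz; subst; auto.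
Qed.
Lemma ext_union (x y : V) v : name x -> name y -> name (bun x y) /\ (v ∊ val (bun x y) <-> v ∊ val x \/ v ∊ val y).
Proof.
  intros hx hy. assert (n : name (bun x y)).
  { apply nameE. intros z hz. apply in_bun in hz. destruct hz as [hz|hz];
      [exact (proj1 (nameE C x) hx z hz)|exact (proj1 (nameE C y) hy z hz)]. }
  split; auto. rewrite !in_val by auto. split.
  - intros (w & u & hw & K). apply in_bun in hw. destruct hw; [left|right]; eauto.
  - intros [(w & u & hw & K)|(w & u & hw & K)]; exists w, u; rewrite in_bun; auto.
Qed.
Lemma names_ex (e : var -> ext G) : exists rho, (forall i, name (rho i)) /\ e = fun i => val (rho i).
Proof.
  exists (fun i => proj1_sig (e i)). split; [intros i; apply (proj2_sig (e i))|].
  apply functional_extensionality. intros i. destruct (proj2_sig (e i)) as [n r].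
  apply ext_eq. rewrite val_rep; auto.
Qed.
Lemma ext_sep (a : form) (e : var -> ext G) (x : ext G) : exists y : ext G, forall z, z ∊ y <-> z ∊ x /\ sat memV (upd e 0 z) a.
Proof.
  destruct (names_ex e) as (rho & nr & ->), (val_onto G gen x) as (b & hb & ->).
  (* A name for the separated set: [w] is listed with each condition that puts it into [b] and
     forces [a] of it. *)
  pose (Y := sep (prod (tcl b) C) (fun z => exists w p u, z = opair w p /\ opair w u ∊ b /\ le p u /\ Forces C R p a (upd rho 0 w))).
  assert (D : defn 1 (fun g => exists w p u, hd g = opair w p /\ opair w u ∊ b /\ le p u /\ Forces C R p a (upd rho 0 w))).
  { pose proof (dfn_forces_upd a rho 0). dfn. }
  assert (HY : forall w p, opair w p ∊ Y <-> p ∊ C /\ exists u, opair w u ∊ b /\ le p u /\ Forces C R p a (upd rho 0 w)).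
  { intros w p. unfold Y. rewrite in_sep, opair_in_prod by auto. split.
    - intros [[h1 h2] (w' & p' & u & e & K)]. apply opair_inj in e. destruct e; subst. eauto.
    - intros [hp (u & hu & K)]. split; [split; auto; now apply elt_tcl with u|]. exists w, p, u. auto. }
  assert (nY : name Y).
  { apply nameE. intros z hz. assert (hz' := hz). unfold Y in hz. apply in_sep in hz; auto.
    destruct hz as [_ (w & p & u & -> & hu & l & F)]. exists w, p. destruct (name_elt C b w u hb hu).
    split; auto. split; auto. now apply (le_dom p u). }
  assert (U : forall w, (fun i => val (upd rho 0 w i)) = upd (fun i => val (rho i)) 0 (val w)).
  { intros w. apply functional_extensionality. intros i. unfold upd. now destruct (Nat.eqb i 0). }
  exists (val Y). intros z. rewrite !in_val by auto. split.
  - intros (w & p & hw & hp & ->). apply HY in hw. destruct hw as [_ (u & hu & l & F)].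
    destruct (name_elt C b w u hb hu) as [nw _].
    split; [exists w, u; split; auto; split; auto; now apply (generic_up G gen p)|].
    rewrite <- U. apply truth_lemma; auto using names_upd. exists p; auto.
  - intros [(w & u & hw & hu & ->) S]. destruct (name_elt C b w u hb hw) as [nw _].
    rewrite <- U in S. apply truth_lemma in S; auto using names_upd. destruct S as (q & hq & F).
    destruct (generic_dir G gen u q) as (p & hp & l & l'); auto. exists w, p. split; auto. apply HY.
    split; [now apply (generic_sub G gen)|]. exists u. split; auto. split; auto.
    apply (forces_mono C R poset a q); auto using names_upd.
Qed.
Lemma check_empty : IsEmpty (val (check emp)).
Proof. intros w hw. apply val_check in hw. destruct hw as (y & hy & _). now apply in_emp in hy. Qed.
Lemma check_succ n : IsSucc (val (check (succ n))) (val (check n)).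
Proof.
  intros w. rewrite !val_check. split.
  - intros (m & hm & ->). apply in_succ in hm. destruct hm as [hm| ->]; eauto.
  - intros [(m & hm & ->)| ->]; [exists m|exists n]; rewrite in_succ; auto.
Qed.
Lemma ext_inductive : Inductive_ (val (check om)).
Proof.
  split.
  - intros z hz. apply val_check. exists emp. split; [apply in_om0|]. apply ext_ext. intros w.
    generalize (hz w) (check_empty w). tauto.
  - intros x hx y hy. apply val_check in hx. destruct hx as (n & hn & ->). apply val_check. exists (succ n).
    split; [now apply in_omS|]. apply ext_ext. intros w. now rewrite (hy w), (check_succ n w).
Qed.
End Structure.

Section Countable.
Variable enum : nat -> V.
Hypothesis sur : forall x, exists n, enum n = x.
#[local] Existing Instance ext_mem.

(* If p forces that b is inductive, then by induction in the ground model p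
   forces every check n into b. *)
Lemma ext_omega G (gen : generic G) : IsOmega (val G gen (check om)).
Proof.
  split; [apply ext_inductive|]. intros y hy. destruct (val_onto G gen y) as (b & hb & ->).
  pose (rho := fun (x : V) (i : var) => match i with 0 => b | _ => x end).
  assert (nr : forall x, name x -> forall i, name (rho x i)) by (intros x hx [|i]; auto).
  assert (K : truth G (inductive 0 1) (rho b)) by (apply (truth_lemma G gen); auto; exact hy).
  destruct K as (p & hp & F).
  assert (L : forall G', generic G' -> G' p -> forall g' : generic G', Inductive_ (val G' g' b)).
  { intros G' _ hp' g'. apply (proj2 (truth_lemma G' g' (inductive 0 1) (rho b) (nr b hb))). exists p; auto. }
  (* Induction in the ground model needs a definable predicate: being forced by [p] is one, while
     membership in the value of [b] refers to [G]. Each step returns from truth to forcing through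
     all generic filters containing [p]. *)
  assert (M : forall n, n ∊ om -> ForcesMem C R p (check n) b).
  { apply om_ind; [dfn| |].
    - apply (forcing_theorem enum sur p (FMem 1 0) (rho (check emp))); [apply nr, name_check|eapply generic_sub; eauto|].
      intros G' g' hp'. apply (truth_lemma G' g'); [apply nr, name_check|]. simpl.
      apply (proj1 (L G' g' hp' g')), check_empty.
    - intros n hn IH.
      apply (forcing_theorem enum sur p (FMem 1 0) (rho (check (succ n)))); [apply nr, name_check|eapply generic_sub; eauto|].
      intros G' g' hp'. apply (truth_lemma G' g'); [apply nr, name_check|]. simpl.
      apply (proj2 (L G' g' hp' g') (val G' g' (check n))); [|apply check_succ].
      apply val_mem; auto using name_check. exists p; auto. }
  intros z hz. apply val_check in hz. destruct hz as (n & hn & ->). apply val_mem; auto using name_check. exists p; auto.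
Qed.

Lemma ext_Zax G (gen : generic G) : Zax (ext G) (ext_mem G).
Proof.
  constructor.
  - apply (ext_ext G gen).
  - intros x y. destruct (val_onto G gen x) as (a & ha & ->), (val_onto G gen y) as (b & hb & ->).
    exists (val G gen (bullet (upair a b))). intros w. now apply ext_upair.
  - intros x y. destruct (val_onto G gen x) as (a & ha & ->), (val_onto G gen y) as (b & hb & ->).
    exists (val G gen (bun a b)). intros w. now apply ext_union.
  - apply (ext_sep G gen).
  - exists (val G gen (check om)). apply ext_omega.
Qed.

(** * Dependent Choice in the generic extension *)

Section Choice.
Variable G : V -> Prop.
Hypothesis gen : generic G.
#[local] Instance ext_Z : Zax (ext G) (ext_mem G) := ext_Zax G gen.
Notation val := (val G gen).

Lemma val_om : om = val (check om).
Proof. symmetry. apply isomegaE, ext_omega. Qed.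
Lemma val_upair x y : name x -> name y -> val (bullet (upair x y)) = upair (val x) (val y).
Proof. intros hx hy. apply set_ext. intros z. now rewrite ext_upair, in_upair. Qed.
Lemma val_op x y : name x -> name y -> val (op x y) = opair (val x) (val y).
Proof.
  intros hx hy. unfold op. rewrite val_upair by auto using name_sing, name_upair.
  unfold sing. rewrite !val_upair by auto. reflexivity.
Qed.
Lemma check_inj m n : m ∊ om -> n ∊ om -> val (check m) = val (check n) -> m = n.
Proof.
  assert (K : forall m n, m ∊ om -> n ∊ om -> m ∊ n -> val (check m) <> val (check n)).
  { intros a b ha hb h e. apply (nat_irrefl (val (check b))).
    - rewrite val_om. apply val_check. eauto.
    - rewrite <- e at 1. apply val_check. eauto. }
  intros hm hn e. destruct (nat_total m n hm hn) as [h|[h|h]]; auto; exfalso.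
  - now apply (K m n).
  - now apply (K n m).
Qed.

Variable P : V.
Hypothesis triple : IsTriple P C R one.
Hypothesis proper : Proper P C R.
Hypothesis dc : DepChoice (V := V).

Section Tree.
Variables tau rho : V.
Hypothesis name_tau : name tau.
Hypothesis name_rho : name rho.

Definition dom : V := sep (tcl tau) (fun x => exists u, opair x u ∊ tau).
Lemma in_dom x : x ∊ dom <-> exists u, opair x u ∊ tau.
Proof.
  unfold dom. rewrite in_sep by dfn. split; [tauto|]. intros [u hu]. split; eauto. now apply elt_tcl with u.
Qed.
Lemma name_dom x : x ∊ dom -> name x.
Proof. intros hx. apply in_dom in hx. destruct hx as [u hu]. now apply (name_elt C tau x u). Qed.

(* Variables 0 to 3 stand for x, y, tau and rho: y is in tau, and above x if x is
   in tau. *)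
Definition above : form := FAnd (FMem 1 2) (FImp (FMem 0 2) (lt 3 0 1 4)).
Definition above_env (x y : V) : var -> V := fun i => match i with 0 => x | 1 => y | 2 => tau | _ => rho end.
Definition forces_above (s x y : V) := Forces C R s above (above_env x y).
Lemma dfn_forces_above : Def3 forces_above.
Proof.
  intros n a b c ha hb hc. unfold forces_above.
  apply (dfn_Forces C R above n a (fun i g => above_env (b g) (c g) i)); auto.
  intros [|[|[|i]]]; simpl; dfn.
Qed.
Hint Resolve dfn_forces_above : dfn.
Lemma names_above x y : name x -> name y -> forall i, name (above_env x y i).
Proof. intros hx hy [|[|[|i]]]; simpl; auto. Qed.
Lemma truth_above x y : name x -> name y -> (exists s, G s /\ forces_above s x y) <->
  val y ∊ val tau /\ (val x ∊ val tau -> Lt (val rho) (val x) (val y)).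
Proof. intros hx hy. symmetry. exact (truth_lemma G gen above (above_env x y) (names_above x y hx hy)). Qed.

Definition decide (x : V) : V := sep C (fun s => (exists y, y ∊ dom /\ forces_above s x y) \/
  forall s', le s' s -> forall y, y ∊ dom -> ~ forces_above s' x y).
Lemma dterm_decide : DefF1 decide. Proof. defining decide. Qed.
Hint Resolve dterm_decide : dfn.
Lemma in_decide x s : s ∊ decide x <-> s ∊ C /\ ((exists y, y ∊ dom /\ forces_above s x y) \/
  forall s', le s' s -> forall y, y ∊ dom -> ~ forces_above s' x y).
Proof. unfold decide. rewrite in_sep by dfn. reflexivity. Qed.
Lemma decide_dense x : name x -> OpenDense C R (decide x).
Proof.
  intros hx. split; [|split].
  - intros s hs. now apply in_decide in hs.
  - intros s hs. destruct (classic (exists s' y, le s' s /\ y ∊ dom /\ forces_above s' x y)) as [(s' & y & l & hy & F)|N].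
    + exists s'. split; auto. apply in_decide. split; [now apply (le_dom s' s)|eauto].
    + exists s. split; auto. apply in_decide. split; auto. right. intros s' l y hy F. apply N. eauto.
  - intros s hs s' hs' l. apply in_decide in hs. apply in_decide. split; auto. destruct hs as [hs [(y & hy & F)|N]].
    + left. exists y. split; auto. apply (forces_mono C R poset above s); auto. apply names_above; auto using name_dom.
    + right. intros s2 l2. apply N. now apply le_trans with s'.
Qed.

(** The properties of M used in V[G], collected in a definable class: this lets [G] meet the dense
    set of conditions that are generic for some good set. *)
Definition good (m : V) := Countable m /\ (exists x, x ∊ m /\ x ∊ dom) /\
  (forall x, x ∊ m -> x ∊ dom -> decide x ∊ m) /\
  (forall x s, x ∊ m -> x ∊ dom -> s ∊ m -> s ∊ C -> (exists y, y ∊ dom /\ forces_above s x y) ->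
    exists y, y ∊ m /\ y ∊ dom /\ forces_above s x y).
Lemma dfn_good : Def1 good. Proof. defining good. Qed.
Hint Resolve dfn_good : dfn.

Lemma num_inj n m : num n = num m -> n = m.
Proof. intros e. apply (tag_inj n m emp emp). unfold tag. now rewrite e. Qed.

(** The transitive set [X] contains the forcing, its conditions and the elements of [dom]. All of
    these, and the sets [decide x] as subsets of [C], are subsets of [X] and hence elements of
    H(κ). *)
Lemma good_generic : (exists x, x ∊ dom) ->
  forall p, p ∊ C -> exists q, q ∊ C /\ le q p /\ exists m, good m /\ GenericFor C R m q.
Proof.
  intros [x0 hx0] p hp. destruct proper as (k0 & Ck0 & Hk).
  pose (X := tcl (upair P tau)).
  destruct (large_H k0 X Ck0) as (k & h & Ck & Sk & Hh & Xh).
  assert (TX : forall y, y ∊ X -> Sub y X) by (intros y hy z; now apply tcl_trans).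
  assert (PX : P ∊ X) by (apply tcl_sub, in_upair; auto).
  assert (CX : C ∊ X).
  { apply tripleE in triple. apply (tcl_mono _ _ PX). rewrite triple. apply opair_tcl. }
  assert (DX : Sub dom X).
  { intros y hy. apply in_dom in hy. destruct hy as [u hu]. apply (tcl_mono _ tau); [apply tcl_sub, in_upair; auto|].
    now apply elt_tcl with u. }
  (* Demand 0 puts [p] into M, as properness requires; demand 1 makes M meet [dom]; demands 2 and 3
     add [decide x] and a forced larger node. In [t], entry 0 is [x] and entry 1 the condition. *)
  pose (Phi := fun k t z => (k = num 0 /\ z = p) \/ (k = num 1 /\ z ∊ dom) \/
    (k = num 2 /\ app t (num 0) ∊ dom /\ z = decide (app t (num 0))) \/
    (k = num 3 /\ z ∊ dom /\ forces_above (app t (num 1)) (app t (num 0)) z)).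
  destruct (countable_elementary h P Phi dc) as (m & Cm & Em & Hm); [intros; unfold Phi; dfn|auto|].
  pose (two := fun x s : V => lam (num 2) (fun i => the (fun y => i = emp /\ y = x \/ i <> emp /\ y = s))).
  assert (Htwo : forall x s, x ∊ m -> s ∊ m -> Fun (two x s) (num 2) m /\ app (two x s) (num 0) = x /\ app (two x s) (num 1) = s).
  { intros x s hx hs. assert (N : num 1 <> emp) by (intros e; apply (num_inj 1 0) in e; discriminate).
    assert (A : forall i : V, (i = emp -> the (fun y => i = emp /\ y = x \/ i <> emp /\ y = s) = x) /\
      (i <> emp -> the (fun y => i = emp /\ y = x \/ i <> emp /\ y = s) = s)).
    { intros i. split; intros e; apply theP; auto; intros y [[]|[]]; auto; tauto. }
    split; [|split].
    - apply lam_fun; [dfn|]. intros i hi. destruct (classic (i = emp)) as [e|e]; [rewrite (proj1 (A i))|rewrite (proj2 (A i))]; auto.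
    - unfold two. rewrite app_lam; [now apply A|dfn|apply num_lt; lia].
    - unfold two. rewrite app_lam; [now apply A|dfn|apply num_lt; lia]. }
  pose proof (fun_emp m : Fun emp (num 0) m) as Ef.
  assert (inj : forall i j, num i = num j -> i = j) by apply num_inj.
  assert (hpm : p ∊ m).
  { destruct (Hm (num 0) (num 0) emp) as (z & hz & K); auto using num_om.
    - exists p. split; [exact (Xh p (TX p (TX C CX p hp)))|]. left. auto.
    - destruct K as [[_ ->]|[[e _]|[[e _]|[e _]]]]; auto; apply inj in e; discriminate. }
  destruct (Hk k Ck Sk h Hh m Cm Em p hp hpm) as (q & hq & l & gq).
  exists q. split; auto. split; auto. exists m. split; auto. split; auto. split; [|split].
  - destruct (Hm (num 1) (num 0) emp) as (z & hz & K); auto using num_om.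
    + exists x0. split; [exact (Xh x0 (TX x0 (DX x0 hx0)))|]. right; left. auto.
    + exists z. split; auto. destruct K as [[e _]|[[_ K]|[[e _]|[e _]]]]; auto; apply inj in e; discriminate.
  - intros x hx hxd. destruct (Htwo x x hx hx) as (F & a0 & a1).
    destruct (Hm (num 2) (num 2) (two x x)) as (z & hz & K); auto using num_om.
    + exists (decide x). split.
      * apply Xh. intros s hs. apply in_decide in hs. apply (TX C CX). tauto.
      * right; right; left. rewrite a0. auto.
    + destruct K as [[e _]|[[e _]|[(_ & _ & ->)|[e _]]]]; try (apply inj in e; discriminate). now rewrite a0 in hz.
  - intros x s hx hxd hs hsC (y & hy & Fy). destruct (Htwo x s hx hs) as (F & a0 & a1).
    destruct (Hm (num 3) (num 2) (two x s)) as (z & hz & K); auto using num_om.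
    + exists y. split; [exact (Xh y (TX y (DX y hy)))|]. right; right; right. rewrite a0, a1. auto.
    + destruct K as [[e _]|[[e _]|[[e _]|(_ & K1 & K2)]]]; try (apply inj in e; discriminate).
      rewrite a0, a1 in K2. eauto.
Qed.

Lemma good_step m q : good m -> G q -> GenericFor C R m q ->
  (forall v, exists y, y ∊ val tau /\ (v ∊ val tau -> Lt (val rho) v y)) ->
  forall x, x ∊ m -> x ∊ dom -> exists y, y ∊ m /\ y ∊ dom /\
    val y ∊ val tau /\ (val x ∊ val tau -> Lt (val rho) (val x) (val y)).
Proof.
  intros (_ & _ & M1 & M2) hq gq NM x hx hxd.
  assert (nx : name x) by now apply name_dom.
  pose (a := sep (decide x) (fun s => s ∊ m)).
  assert (Ha : forall s, s ∊ a <-> s ∊ decide x /\ s ∊ m) by (intros s; unfold a; rewrite in_sep by dfn; reflexivity).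
  pose proof (gq (decide x) (M1 x hx hxd) (decide_dense x nx) a Ha) as PD.
  (* Predensity of [a] below [q] is density below [q] of the conditions that extend a member of
     [a]. *)
  destruct (generic_dense_below G gen (fun z => exists s, s ∊ a /\ le z s) q) as (z & hz & s & hs & l); [dfn|auto| |].
  { intros z hz lz. destruct (PD z hz lz) as (s & hs & z' & hz' & l1 & l2). exists z'. eauto. }
  assert (Gs : G s) by (apply (generic_up G gen z); auto).
  apply Ha in hs. destruct hs as [hs hsm]. apply in_decide in hs. destruct hs as [hsC [K|K]].
  - destruct (M2 x s hx hxd hsm hsC K) as (y & hy & hyd & F). exists y. split; auto. split; auto.
    apply truth_above; auto using name_dom. eauto.
  (* In V[G] a suitable node exists and has a name in [dom]; a condition in [G] forcing this is
     compatible with [s], contrary to the second alternative of [decide]. *)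
  - exfalso. destruct (NM (val x)) as (v & hv & hl). assert (hv' := hv). apply in_val in hv'; auto.
    destruct hv' as (y & u & hy & hu & ->). assert (hyd : y ∊ dom) by (apply in_dom; eauto).
    assert (T : exists s, G s /\ forces_above s x y) by (apply truth_above; auto using name_dom).
    destruct T as (s2 & hs2 & F). destruct (generic_dir G gen s s2) as (s3 & hs3 & l1 & l2); auto.
    apply (K s3 l1 y hyd). apply (forces_mono C R poset above s2); auto. apply names_above; auto using name_dom.
Qed.
End Tree.

Lemma ext_DC : DepChoice (V := ext G).
Proof.
  intros w hw t r T TC NM. apply isomegaE in hw. subst w.
  destruct (val_onto G gen t) as (tau & nt & ->), (val_onto G gen r) as (rho & nr & ->).
  destruct T as [Po _].
  assert (NE : exists v, v ∊ val tau).
  (* Closure of the tree at length 0 supplies a node. *)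
  { destruct (TC emp (in_om0) emp) as (u & hu & _); [|intros i hi; now apply in_emp in hi|eauto].
    apply funE, fun_emp. }
  assert (NM' : forall v, exists y, y ∊ val tau /\ (v ∊ val tau -> Lt (val rho) v y)).
  { intros v. destruct (classic (v ∊ val tau)) as [h|h].
    - destruct (NM v h) as (y & hy & l). eauto.
    - destruct NE as [y hy]. exists y. tauto. }
  assert (ND : exists x, x ∊ dom tau).
  { destruct NE as [v hv]. apply in_val in hv; auto. destruct hv as (x & u & hx & _). exists x. apply in_dom. eauto. }
  (* M depends on the condition to be extended, so [G] itself selects a pair of a good set and a
     condition generic for it. *)
  destruct (generic_dense G gen (fun q => exists m, good tau rho m /\ GenericFor C R m q)) as (q & hq & m & gm & gq).
  - pose proof (dfn_good tau rho). dfn.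
  - now apply good_generic.
  - destruct gm as (Cm & (x0 & hx0 & hx0d) & M) eqn:egm. clear egm.
    assert (step := good_step tau rho nt nr m q (Logic.conj Cm (Logic.conj (ex_intro _ x0 (Logic.conj hx0 hx0d)) M)) hq gq NM').
    destruct Cm as (w & hw & f & F & I). apply isomegaE in hw. subst w. apply funE in F.
    assert (nd := fun x => name_dom tau nt x).
    (* [f] injects M into ω in the ground model. The name lists the pairs of f(x) and the value of
       [x]; some of these values may lie outside the tree. *)
    pose (N := repl (sep m (fun x => x ∊ dom tau)) (fun x => op (check (app f x)) x)).
    (* A name for the product of ω with the values of all members of [dom tau], the ambient set for
       the graph of the chain. *)
    pose (Q := Un (repl om (fun n => repl (dom tau) (fun x => op (check n) x)))).
    assert (nN : forall z, z ∊ N -> name z).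
    { intros z hz. unfold N in hz. apply in_repl in hz; [|dfn]. destruct hz as (x & hx & ->).
      apply in_sep in hx; [|dfn]. apply name_op; [apply name_check|]. now apply nd. }
    assert (nQ : forall z, z ∊ Q -> name z).
    { intros z hz. unfold Q in hz. apply in_Un in hz. destruct hz as (s & hs & hz).
      apply in_repl in hs; [|dfn]. destruct hs as (n & hn & ->). apply in_repl in hz; [|dfn].
      destruct hz as (x & hx & ->). apply name_op; [apply name_check|]. now apply nd. }
    assert (HN : forall k v, opair k v ∊ val (bullet N) <->
      exists x, x ∊ m /\ x ∊ dom tau /\ k = val (check (app f x)) /\ v = val x).
    { intros k v. rewrite val_bullet by auto. split.
      - intros (z & hz & e). unfold N in hz. apply in_repl in hz; [|dfn]. destruct hz as (x & hx & ->).
        apply in_sep in hx; [|dfn]. destruct hx as [hx hxd]. rewrite val_op in e by auto using name_check.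
        apply opair_inj in e. exists x. tauto.
      - intros (x & hx & hxd & -> & ->). exists (op (check (app f x)) x). split.
        + apply in_repl; [dfn|]. exists x. split; auto. apply in_sep; [dfn|]. auto.
        + rewrite val_op; auto using name_check. }
    apply (chain_of_enumeration (val tau) (val rho) (val (bullet N)) (val (bullet Q))); auto.
    + intros k v hk hv. rewrite val_om in hk. apply val_check in hk. destruct hk as (n & hn & ->).
      apply in_val in hv; auto. destruct hv as (x & u & hx & _ & ->).
      assert (hxd : x ∊ dom tau) by (apply in_dom; eauto).
      apply val_bullet; auto. exists (op (check n) x). split.
      * apply in_Un. exists (repl (dom tau) (fun x => op (check n) x)). split; apply in_repl; try dfn; eauto.
      * rewrite val_op; auto using name_check.
    + intros k v h. apply HN in h. destruct h as (x & hx & _ & -> & _). rewrite val_om. apply val_check.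
      exists (app f x). split; auto. eapply app_cod; eauto.
    + intros k v v' h h'. apply HN in h, h'. destruct h as (x & hx & _ & -> & ->), h' as (x' & hx' & _ & e & ->).
      apply check_inj in e; try (eapply app_cod; eauto). f_equal. apply (I x x' (app f x)); apply relE; [|rewrite e]; eapply app_in; eauto.
    (* The conditions attached to [x0] may all miss [G], leaving its value outside the tree; the
       node provided for [x0] is in the tree in any case. *)
    + destruct (step x0 hx0 hx0d) as (y & hy & hyd & h & _). exists (val (check (app f y))), (val y).
      split; auto. apply HN. exists y. auto.
    + intros k v h hv. apply HN in h. destruct h as (x & hx & hxd & -> & ->).
      destruct (step x hx hxd) as (y & hy & hyd & h1 & h2). exists (val (check (app f y))), (val y).
      split; auto. apply HN. exists y. auto.
Qed.
End Choice.
End Countable.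
End Extension.

(** * Reduction to countable models *)

Section Skolem.

(** [d] bounds the nesting depth and makes the decoding structurally recursive; the numbering
    restarts at each depth. *)
Fixpoint nth_form (d n : nat) : form :=
  match d with
  | 0 => FBot
  | S d =>
    let (c, m) := Cantor.of_nat n in let (x, y) := Cantor.of_nat m in
    match c with
    | 0 => FMem x y
    | 1 => FEq x y
    | 2 => FBot
    | 3 => FImp (nth_form d x) (nth_form d y)
    | 4 => FAnd (nth_form d x) (nth_form d y)
    | 5 => FOr (nth_form d x) (nth_form d y)
    | 6 => FAll x (nth_form d y)
    | _ => FEx x (nth_form d y)
    end
  end.
Lemma nth_form_onto a : exists d0, forall d, d0 <= d -> exists n, nth_form d n = a.
Proof.
  assert (L : forall d c x y, exists n, nth_form (S d) n = match c with
    | 0 => FMem x y | 1 => FEq x y | 2 => FBot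
    | 3 => FImp (nth_form d x) (nth_form d y) | 4 => FAnd (nth_form d x) (nth_form d y)
    | 5 => FOr (nth_form d x) (nth_form d y) | 6 => FAll x (nth_form d y) | _ => FEx x (nth_form d y) end).
  { intros d c x y. exists (Cantor.to_nat (c, Cantor.to_nat (x, y))). cbn [nth_form]. now rewrite !Cantor.cancel_of_to. }
  induction a.
  - exists 1. intros [|d] h; [lia|]. apply (L d 0 x y).
  - exists 1. intros [|d] h; [lia|]. apply (L d 1 x y).
  - exists 1. intros [|d] h; [lia|]. apply (L d 2 0 0).
  - destruct IHa1 as [d1 h1], IHa2 as [d2 h2]. exists (S (max d1 d2)). intros [|d] h; [lia|].
    destruct (h1 d) as [n1 <-], (h2 d) as [n2 <-]; try lia. apply (L d 3 n1 n2).
  - destruct IHa1 as [d1 h1], IHa2 as [d2 h2]. exists (S (max d1 d2)). intros [|d] h; [lia|].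
    destruct (h1 d) as [n1 <-], (h2 d) as [n2 <-]; try lia. apply (L d 4 n1 n2).
  - destruct IHa1 as [d1 h1], IHa2 as [d2 h2]. exists (S (max d1 d2)). intros [|d] h; [lia|].
    destruct (h1 d) as [n1 <-], (h2 d) as [n2 <-]; try lia. apply (L d 5 n1 n2).
  - destruct IHa as [d1 h1]. exists (S d1). intros [|d] h; [lia|].
    destruct (h1 d) as [n1 <-]; try lia. apply (L d 6 x n1).
  - destruct IHa as [d1 h1]. exists (S d1). intros [|d] h; [lia|].
    destruct (h1 d) as [n1 <-]; try lia. apply (L d 7 x n1).
Qed.

Fixpoint nth_list (d n : nat) : list nat :=
  match d with
  | 0 => nil
  | S d => let (x, y) := Cantor.of_nat n in x :: nth_list d y
  end.
Lemma nth_list_onto l : exists n, nth_list (length l) n = l.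
Proof.
  induction l as [|x l [n IH]]; [now exists 0|]. exists (Cantor.to_nat (x, n)). cbn [length nth_list].
  now rewrite Cantor.cancel_of_to, IH.
Qed.

Lemma sat_fvs {V : Type} (E : V -> V -> Prop) a : forall e e' : var -> V, (forall x, In x (fvs a) -> e x = e' x) ->
  sat E e a <-> sat E e' a.
Proof.
  assert (U : forall a x (e e' : var -> V) v, (forall y, In y (fvs (FAll x a)) -> e y = e' y) ->
    forall y, In y (fvs a) -> upd e x v y = upd e' x v y).
  { intros b x e e' v K y hy. unfold upd. destruct (Nat.eqb_spec y x); auto. apply K. simpl.
    apply filter_In. split; auto. now apply Bool.negb_true_iff, Nat.eqb_neq. }
  induction a; intros e e' K; simpl in *.
  - rewrite (K x), (K y) by auto. reflexivity.
  - rewrite (K x), (K y) by auto. reflexivity.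
  - reflexivity.
  - rewrite (IHa1 e e'), (IHa2 e e') by (intros; apply K, in_app_iff; auto). reflexivity.
  - rewrite (IHa1 e e'), (IHa2 e e') by (intros; apply K, in_app_iff; auto). reflexivity.
  - rewrite (IHa1 e e'), (IHa2 e e') by (intros; apply K, in_app_iff; auto). reflexivity.
  - apply iff_all. intros v. apply IHa. now apply U.
  - apply iff_ex. intros v. apply IHa. now apply U.
Qed.

Section Hull.
Variables (V : Type) (E : V -> V -> Prop) (e : var -> V).

Definition witness (a : form) (x : var) (r : var -> V) : V :=
  epsilon (inhabits (e 0)) (fun v => sat E (upd r x v) a).

(* The (k+1)-st stage lists the k-th stage together with witnesses for all
   existential formulas with parameters in the k-th stage. *)
Fixpoint stage (k n : nat) : V :=
  match k with
  | 0 => e n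
  | S k =>
    match Cantor.of_nat n with
    | (0, m) => stage k m
    | (_, m) =>
      let (c, p) := Cantor.of_nat m in let (d, i) := Cantor.of_nat c in
      let (x, q) := Cantor.of_nat p in let (b, l) := Cantor.of_nat q in
      witness (nth_form d i) x (fun y => stage k (nth y (nth_list b l) 0))
    end
  end.
Lemma stage_next k n : exists m, stage (S k) m = stage k n.
Proof. exists (Cantor.to_nat (0, n)). cbn [stage]. now rewrite Cantor.cancel_of_to. Qed.
Lemma stage_mono k k' n : k <= k' -> exists m, stage k' m = stage k n.
Proof.
  intros h. induction h as [|k' h [m IH]]; [now exists n|]. rewrite <- IH. apply stage_next.
Qed.
Lemma stage_witness k a x l : exists n, stage (S k) n = witness a x (fun y => stage k (nth y l 0)).
Proof.
  destruct (nth_form_onto a) as [d K]. destruct (K d (le_n d)) as [i <-], (nth_list_onto l) as [j hj].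
  exists (Cantor.to_nat (1, Cantor.to_nat (Cantor.to_nat (d, i), Cantor.to_nat (x, Cantor.to_nat (length l, j))))).
  cbn [stage]. rewrite !Cantor.cancel_of_to. now rewrite hj.
Qed.

Definition sub_model : Type := {v : V | exists k n, stage k n = v}.
Definition sub_mem (x y : sub_model) : Prop := E (proj1_sig x) (proj1_sig y).
Lemma stage_proof k n : exists k' n', stage k' n' = stage k n. Proof. eauto. Qed.
Definition of_stage k n : sub_model := exist _ (stage k n) (stage_proof k n).
Lemma of_stage_onto (u : sub_model) : exists k n, of_stage k n = u.
Proof.
  destruct u as (v & k & n & <-). exists k, n. unfold of_stage. f_equal. apply proof_irrelevance.
Qed.
(** The stages increase, so finitely many elements already occur in a common one. *)
Lemma finitely_many_parameters (r : var -> sub_model) b : exists k l, length l = b /\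
  forall i, i < b -> stage k (nth i l 0) = proj1_sig (r i).
Proof.
  induction b as [|b (k & l & hl & K)]; [exists 0, nil; split; [auto|lia]|].
  destruct (proj2_sig (r b)) as (k' & n & hn).
  destruct (stage_mono k' (max k k') n) as [m hm]; [lia|].
  assert (L : exists l', length l' = length l /\ forall i, i < length l -> stage (max k k') (nth i l' 0) = stage k (nth i l 0)).
  { clear -l. induction l as [|x l (l' & h & L)]; [exists nil; simpl; split; [auto|lia]|].
    destruct (stage_mono k (max k k') x) as [y hy]; [lia|]. exists (y :: l'). simpl. split; [auto|].
    intros [|i] hi; [auto|]. apply L. lia. }
  destruct L as (l' & h & L). exists (max k k'), (l' ++ m :: nil). rewrite length_app. simpl. split; [lia|].
  intros i hi. destruct (Nat.eq_dec i b) as [->|N].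
  - rewrite app_nth2, h, hl, Nat.sub_diag by lia. simpl. congruence.
  - rewrite app_nth1, L, K by lia. reflexivity.
Qed.

Lemma sub_model_elementary a : forall r : var -> sub_model,
  sat sub_mem r a <-> sat E (fun i => proj1_sig (r i)) a.
Proof.
  assert (U : forall (r : var -> sub_model) x v,
    (fun i => proj1_sig (upd r x v i)) = upd (fun i => proj1_sig (r i)) x (proj1_sig v)).
  { intros r x v. apply functional_extensionality. intros i. unfold upd. now destruct (Nat.eqb i x). }
  assert (W : forall a (r : var -> sub_model) x, (exists v, sat E (upd (fun i => proj1_sig (r i)) x v) a) ->
    exists v : sub_model, sat E (upd (fun i => proj1_sig (r i)) x (proj1_sig v)) a).
  { intros b r x [v K]. destruct (finitely_many_parameters r (S (list_max (fvs b)))) as (k & l & hl & L).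
    destruct (stage_witness k b x l) as [n hn]. exists (of_stage (S k) n). change (proj1_sig (of_stage (S k) n)) with (stage (S k) n). rewrite hn.
    (* Only the free variables of [b] matter, so the environment may be replaced by the finite list
       from which the stage computes its witness. *)
    assert (A : forall w, sat E (upd (fun i => proj1_sig (r i)) x w) b <->
      sat E (upd (fun y => stage k (nth y l 0)) x w) b).
    { intros w. apply sat_fvs. intros y hy. unfold upd. destruct (Nat.eqb y x); auto. symmetry. apply L.
      assert (h : Forall (fun k => k <= list_max (fvs b)) (fvs b)) by now apply list_max_le.
      rewrite Forall_forall in h. specialize (h y hy). lia. }
    apply A. apply (epsilon_spec (inhabits (e 0)) (fun v => sat E (upd (fun y => stage k (nth y l 0)) x v) b)).
    exists v. now apply A. }
  induction a; intros r; simpl.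
  - reflexivity.
  - split; [now intros ->|]. destruct (r x) as [u hu], (r y) as [v hv]. simpl. intros ->. f_equal. apply proof_irrelevance.
  - reflexivity.
  - now rewrite IHa1, IHa2.
  - now rewrite IHa1, IHa2.
  - now rewrite IHa1, IHa2.
  - split.
    + intros K v. apply NNPP. intros N.
      (* A counterexample in the large model yields one in the submodel, as a witness for the
         negation. *)
      destruct (W (FImp a FBot) r x) as [w hw]; [exists v; exact N|]. apply hw. rewrite <- U. apply IHa, K.
    + intros K v. apply IHa. rewrite U. apply K.
  - split.
    + intros [v K]. exists (proj1_sig v). rewrite <- U. now apply IHa.
    + intros K. destruct (W a r x K) as [v hv]. exists v. apply IHa. now rewrite U.
Qed.
End Hull.

Lemma countable_submodel (V : Type) (E : V -> V -> Prop) (e : var -> V) :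
  exists (U : Type) (F : U -> U -> Prop) (j : U -> V) (r : var -> U) (enum : nat -> U),
    (forall x, exists n, enum n = x) /\ (fun i => j (r i)) = e /\
    forall a s, sat F s a <-> sat E (fun i => j (s i)) a.
Proof.
  exists (sub_model V E e), (sub_mem V E e), (@proj1_sig _ _), (of_stage V E e 0),
    (fun n => let (k, m) := Cantor.of_nat n in of_stage V E e k m).
  split; [|split].
  - intros x. destruct (of_stage_onto V E e x) as (k & m & K). exists (Cantor.to_nat (k, m)).
    now rewrite Cantor.cancel_of_to.
  - reflexivity.
  - intros a s. apply sub_model_elementary.
Qed.

(** * Transfer of the axioms of ZF to the submodel *)

Definition iff_form (a b : form) : form := FAnd (FImp a b) (FImp b a).

Section Schemas.
Variables (V : Type) (E : V -> V -> Prop) (a : form).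
(** A variable beyond those free in [a] and beyond the schema variables 0 and 1. It carries the
    given set, and its successor is free for the bound variable standing for the new set or for the
    unique value. *)
Definition fresh : var := S (S (list_max (fvs a))).
Lemma fresh_lt y : In y (fvs a) -> y < fresh.
Proof.
  intros hy. assert (h : Forall (fun k => k <= list_max (fvs a)) (fvs a)) by now apply list_max_le.
  rewrite Forall_forall in h. specialize (h y hy). unfold fresh. lia.
Qed.
Definition separation_form : form :=
  FEx (S fresh) (FAll 0 (iff_form (FMem 0 (S fresh)) (FAnd (FMem 0 fresh) a))).
Lemma separation_formE (r : var -> V) x : sat E (upd r fresh x) separation_form <->
  exists y, forall z, E z y <-> E z x /\ sat E (upd r 0 z) a.
Proof.
  assert (f2 : 2 <= fresh) by (unfold fresh; lia).
  unfold separation_form. simpl. apply iff_ex. intros y. apply iff_all. intros z.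
  rewrite (sat_fvs E a (upd (upd (upd r fresh x) (S fresh) y) 0 z) (upd r 0 z)).
  - updates. reflexivity.
  - intros i hi. apply fresh_lt in hi. unfold upd. destruct (Nat.eqb i 0); auto.
    destruct (Nat.eqb_spec i (S fresh)); [lia|]. destruct (Nat.eqb_spec i fresh); [lia|auto].
Qed.
Definition functional_form : form :=
  FAll 0 (FImp (FMem 0 fresh) (FEx (S fresh) (FAll 1 (iff_form a (FEq 1 (S fresh)))))).
Lemma functional_formE (r : var -> V) x : sat E (upd r fresh x) functional_form <->
  forall z, E z x -> exists! u, sat E (upd (upd r 0 z) 1 u) a.
Proof.
  assert (f2 : 2 <= fresh) by (unfold fresh; lia).
  unfold functional_form. simpl. apply iff_all. intros z. updates. apply iff_imp; [reflexivity|].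
  assert (K : forall w u, sat E (upd (upd (upd (upd r fresh x) 0 z) (S fresh) w) 1 u) a <-> sat E (upd (upd r 0 z) 1 u) a).
  { intros w u. apply sat_fvs. intros i hi. apply fresh_lt in hi. unfold upd. destruct (Nat.eqb i 1); auto.
    destruct (Nat.eqb_spec i (S fresh)); [lia|]. destruct (Nat.eqb i 0); auto.
    destruct (Nat.eqb_spec i fresh); [lia|auto]. }
  unfold unique. split.
  - intros [w h]. exists w. split.
    + apply (K w). apply (h w). updates. reflexivity.
    + intros u hu. apply (K w) in hu. apply (h u) in hu. revert hu. updates. auto.
  - intros (w & h1 & h2). exists w. intros u. rewrite K. updates. split; [intros h; symmetry; auto|now intros ->].
Qed.
Definition image_form : form :=
  FEx (S fresh) (FAll 1 (iff_form (FMem 1 (S fresh)) (FEx 0 (FAnd (FMem 0 fresh) a)))).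
Lemma image_formE (r : var -> V) x : sat E (upd r fresh x) image_form <->
  exists y, forall u, E u y <-> exists z, E z x /\ sat E (upd (upd r 0 z) 1 u) a.
Proof.
  assert (f2 : 2 <= fresh) by (unfold fresh; lia).
  unfold image_form. simpl. apply iff_ex. intros y. apply iff_all. intros u. updates.
  assert (K : forall z, sat E (upd (upd (upd (upd r fresh x) (S fresh) y) 1 u) 0 z) a <-> sat E (upd (upd r 0 z) 1 u) a).
  { intros w. apply sat_fvs. intros i hi. apply fresh_lt in hi. unfold upd.
    destruct (Nat.eqb_spec i 0) as [->|]; auto. destruct (Nat.eqb i 1); auto.
    destruct (Nat.eqb_spec i (S fresh)); [lia|]. destruct (Nat.eqb_spec i fresh); [lia|auto]. }
  assert (L : (exists z, E (upd (upd (upd (upd r fresh x) (S fresh) y) 1 u) 0 z 0)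
       (upd (upd (upd (upd r fresh x) (S fresh) y) 1 u) 0 z fresh) /\
       sat E (upd (upd (upd (upd r fresh x) (S fresh) y) 1 u) 0 z) a) <->
     exists z, E z x /\ sat E (upd (upd r 0 z) 1 u) a).
  { apply iff_ex. intros z. rewrite K. updates. reflexivity. }
  rewrite L. reflexivity.
Qed.
End Schemas.

(** The single axioms are sentences and transfer as they stand. An instance of a schema is first
    written as one formula in its parameters and the given set, since elementarity speaks only of
    formulas. *)
Lemma elementary_ZF (U V : Type) (F : U -> U -> Prop) (E : V -> V -> Prop) (j : U -> V) (r0 : var -> U) :
  (forall a s, sat F s a <-> sat E (fun i => j (s i)) a) -> ZF E -> ZF F.
Proof.
  intros K H.
  assert (T : forall s : fml, sat E (fun i => j (r0 i)) (s 0) -> sat F r0 (s 0)) by (intros s; apply K).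
  assert (J : forall (r : var -> U) x v, (fun i => j (upd r x v i)) = upd (fun i => j (r i)) x (j v)).
  { intros r x v. apply functional_extensionality. intros i. unfold upd. now destruct (Nat.eqb i x). }
  constructor.
  - exact (T (∀ x, ∀ y, (∀ z, z ∈ x ⇔ z ∈ y) ⇒ x ≐ y)%fml (zf_extensionality H)).
  - exact (T (∀ x, (∃ y, y ∈ x) ⇒ ∃ y, y ∈ x ∧ ∀ z, z ∈ y ⇒ ¬ z ∈ x)%fml (@zf_foundation V E H)).
  - exact (T (∀ x, ∀ y, ∃ z, ∀ w, w ∈ z ⇔ w ≐ x ∨ w ≐ y)%fml (zf_pairing H)).
  - exact (T (∀ x, ∃ u, ∀ w, w ∈ u ⇔ ∃ y, y ∈ x ∧ w ∈ y)%fml (zf_union H)).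
  - exact (T (∀ x, ∃ p, ∀ y, y ∈ p ⇔ ∀ z, z ∈ y ⇒ z ∈ x)%fml (zf_powerset H)).
  - exact (T (∃ w, (∃ z, z ∈ w ∧ ∀ u, ¬ u ∈ z) ∧
      ∀ x, x ∈ w ⇒ ∃ y, y ∈ w ∧ ∀ u, u ∈ y ⇔ u ∈ x ∨ u ≐ x)%fml (zf_infinity H)).
  - intros a r x. apply separation_formE, K. rewrite J. apply separation_formE, (zf_separation H).
  - intros a r x h. apply (proj2 (functional_formE U F a r x)), (proj1 (K _ _)) in h.
    rewrite J in h. pose proof (proj1 (functional_formE V E a _ _) h) as h'.
    apply (proj1 (image_formE U F a r x)), (proj2 (K _ _)). rewrite J. apply (proj2 (image_formE V E a _ _)).
    exact (@zf_replacement V E H a _ _ h').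
Qed.
End Skolem.

(** * From generic extensions back to forcing, and from countable models to all models *)

Lemma forces_DC_countable (V : Type) (E : MemRel V) (H : ZF E) (enum : nat -> V) (P C R one : V) :
  (forall x, exists n, enum n = x) ->
  NotionOfForcing P C R one -> Proper P C R -> DepChoice (V := V) -> forall rho, (forall i, IsName C (rho i)) ->
  Forces C R one (DC 0) rho.
Proof.
  intros sur (T & Po & h1 & hmax) Pr dc rho nr.
  apply (forcing_theorem C R Po enum sur); auto. intros G gen _.
  apply (truth_lemma C R one Po h1 hmax G gen); auto. rewrite sat_DC.
  exact (ext_DC C R one Po h1 hmax enum sur G gen P T Pr dc).
Qed.

Local Open Scope fml_scope.

Theorem theorem4p6 (V : Type) (E : V -> V -> Prop) (hZF : ZF E) :
  holds E
    (∀ P, ∀ C, ∀ R, ∀ one,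
       notion_of_forcing P C R one ⇒
       proper P C R ⇒
       DC ⇒
       forces_sentence C R one DC).
Proof.
  (* The whole implication is a single formula, so elementarity moves it to the countable submodel,
     into which the environment is pulled back. *)
  intros e. destruct (countable_submodel V E e) as (U & F & j & r & enum & sur & <- & K).
  apply K. pose proof (elementary_ZF U V F E j r K hZF) as HU. clear K.
  refine (eq_ind_r (fun X => X) _ (@sat_theorem U F r)). intros P C R one N Pr dc.
  (* The truth lemma wants a name for every variable; for a sentence the empty name will do
     throughout. *)
  apply (proj2 (sat_forces_DC (E := F) r P C R one (fun _ => @emp U F (ZF_Zax U F HU)))).
  apply (@forces_DC_countable U F HU enum P); auto. intros _. apply name_emp.
Qed.
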